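(* Let $j\in\mathbb N$ and set $w:=-\frac n2+j-\gamma_k$. Moreover, let $\tilde f$ be an extension to $\mathbb R^{n+1,1}$ of a smooth $w$-density $f\in C^\infty(S^n,L_w)$. Then the composition $$f\longrightarrow\tilde f\stackrel{\tilde\triangle_k^j}{\longrightarrow}\tilde\triangle_k^j(\tilde f)\longrightarrow\tilde\triangle_k^j(\tilde f)|_C$$ depends on $f$ only and not on its extension $\tilde f$, and consequently induces a nontrivial $G$-invariant differential-difference operator $$\tilde\triangle_k^j|_C: C^\infty(S^n,L_w)\longrightarrow C^\infty(S^n,L_{w-2j})$$ of order $2j$ and symbol $\triangle^j$.
   Context: **Ambient space.** $\mathbb R^{n+1,1}$ is the vector space $\mathbb R^{n+2}$ with coordinates $X=(X^0,X^1,\dots,X^n,X^\infty)$ with respect to the canonical basis $\{e_0,e_1,\dots,e_n,e_\infty\}$, and with the non-degenerate symmetric bilinear form $\langle X,Y\rangle=X^0Y^\infty+X^\infty Y^0+\sum_{i=1}^nX^iY^i$ of signature $(n+1,1)$. **Null-cone, sphere, densities.** $C=\{X\in\mathbb R^{n+1,1}\mid\langle X,X\rangle=0\}$ is the null-cone. Its projectivization is the sphere $S^n$ with its standard (round) conformal structure. The space $C^\infty(S^n,L_w)$ of smooth $w$-densities on $S^n$ (sections of the homogeneous line bundle $L_w\to S^n$) is identified with the space of smooth $w$-homogeneous functions on $C$ (homogeneity with respect to positive scalings). In the local chart $U=\{(1,x_1,\dots,x_n,-\frac12\sum_{i=1}^nx_i^2)\}\simeq\mathbb R^n\subset S^n$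 the identification sends $f(x_1,\dots,x_n)$ to $(X^0)^wf(X^1/X^0,\dots,X^n/X^0)$. An extension $\tilde f$ of a $w$-density $f$ is obtained by taking the corresponding $w$-homogeneous function on $C$ and extending it arbitrarily off $C$ to a neighbourhood of $C$ in $\mathbb R^{n+1,1}$. After $\tilde\triangle_k^j$ is applied, the result is restricted back to $C$. **Reflection group.** For $\alpha\in\mathbb R^{n+1,1}\setminus C$ the reflection is $R_\alpha X=X-2\frac{\langle\alpha,X\rangle}{\langle\alpha,\alpha\rangle}\alpha$. A root system is a finite set $R\subset\mathbb R^{n+1,1}\setminus C$ such that $R\cap\mathbb R\alpha=\{\alpha,-\alpha\}$ and $R_\alpha(R)=R$ for all $\alpha\in R$. It is assumed throughout that the roots lie in the Euclidean subspace $X^0=X^\infty$, i.e. every root has the form $\alpha=(\alpha_0,\alpha_1,\dots,\alpha_n,\alpha_0)$. $G\le O(n+1,1,\mathbb R)$ is the finite reflection group generated by all $R_\alpha$, $\alpha\in R$. It preserves $C$ and acts on $S^n$. $R_+$ is a set of positive roots in $R$. A multiplicity function $k$ is a complex-valued function on the set of $G$-orbits of $R$; $k(\alpha)$ is its value on the orbit of $\alpha$. Put $\gamma_k=\sum_{\alpha\in R_+}k(\alpha)$. **Dunkl operators.** For $\xi\in\mathbb R^{n+1,1}$ and smooth $f$, $$T_\xi(k)f(X)=\partial_\xi f(X)+\sum_{\alpha\in R_+}k(\alpha)\frac{\langle\alpha,\xi\rangle}{\langle\alpha,X\rangle}\bigl(f(X)-f(R_\alpha X)\bigr).$$ The Dunkl-Laplace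 operator on $\mathbb R^{n+1,1}$ is $\tilde\triangle_k=\sum_iT_{e_i}(k)T_{e^i}(k)$, the sum running over the $n+2$ vectors $e_i$ of the canonical basis, with $\{e^i\}$ the dual basis with respect to $\langle\cdot,\cdot\rangle$. It commutes with the action of $G$; ''$G$-invariant'' means commuting with the action of $G$. **Symbol.** $\triangle=\sum_{i=1}^n\frac{\partial^2}{\partial x_i^2}$ is the Laplace operator in the chart $U$.
   Formalization: The extension of f is taken to be smooth and w-homogeneous on a neighbourhood of the cone, not arbitrary off C: for k=0, j=1, f=0 the extensions 0 and <X,X> give different results, 0 and 2(n+2). *)

(* Defs.v *)
From HB Require Import structures.
From mathcomp Require Import all_boot all_order all_algebra.
From mathcomp Require Import perm finmap complex.
From mathcomp Require Import all_classical all_reals all_analysis.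
Set Implicit Arguments.
Unset Strict Implicit.
Unset Printing Implicit Defensive.
Import Order.TTheory GRing.Theory Num.Theory numFieldNormedType.Exports.
Local Open Scope classical_set_scope.
Local Open Scope complex_scope.
Local Open Scope ring_scope.

Section Calculus.
Variables (R : realType) (V : normedModType R).

(* All iterated directional derivatives of order at most [m] exist and are
   continuous on [U]; meant for open [U] and finite-dimensional [V], where this
   is the usual class C^m. *)
Fixpoint Cn_on (m : nat) (U : set V) (f : V -> R) : Prop :=
  (forall x, U x -> {for x, continuous f}) /\
  match m with
  | 0%N => True
  | m'.+1 => (forall x v, U x -> derivable f x v) /\
             (forall v, Cn_on m' U (fun x => 'D_v f x))
  end.

Definition smooth_on (U : set V) (f : V -> R) : Prop :=
  forall m, Cn_on m U f.

(* [R[i]] carries no normed-module structure over [R], so calculus for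
   complex-valued functions is done on real and imaginary parts. *)
Definition csmooth_on (U : set V) (F : V -> R[i]) : Prop :=
  smooth_on U (fun x => complex.Re (F x)) /\
  smooth_on U (fun x => complex.Im (F x)).

Definition cderive (v : V) (F : V -> R[i]) (x : V) : R[i] :=
  'D_v (fun y => complex.Re (F y)) x +i* 'D_v (fun y => complex.Im (F y)) x.

(* l ^ w = exp (w ln l), for l > 0 and a complex exponent w. *)
Definition cpow (l : R) (w : R[i]) : R[i] :=
  (l `^ complex.Re w * cos (complex.Im w * ln l)) +i*
  (l `^ complex.Re w * sin (complex.Im w * ln l)).

End Calculus.

Section Ambient.
Variables (R : realType) (n : nat).

(* R^{n+1,1}.  The index set {0, 1, ..., n, oo} is 'I_n.+2: the coordinate X^0
   has index [ord0], X^oo has index [ord_max], and X^1, ..., X^n have the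
   indices [mid i], i < n. *)
Local Notation amb := 'rV[R]_(n.+2).

Definition mid (i : 'I_n) : 'I_n.+2 := lift ord0 (lift ord_max i).

Definition form (X Y : amb) : R :=
  X 0 ord0 * Y 0 ord_max + X 0 ord_max * Y 0 ord0 +
  \sum_(i < n) X 0 (mid i) * Y 0 (mid i).

Definition basis (i : 'I_n.+2) : amb := delta_mx 0 i.

(* e^0 = e_oo, e^oo = e_0 and e^i = e_i otherwise. *)
Definition dual_basis (i : 'I_n.+2) : amb := basis (tperm ord0 ord_max i).

Lemma form_dual_basis (i l : 'I_n.+2) :
  form (basis i) (dual_basis l) = (i == l)%:R.
Proof.
have basisE a b : basis a 0 b = (b == a)%:R by rewrite mxE eqxx.
have m0 a : (mid a == ord0) = false.
  by rewrite /mid eq_sym; apply/negbTE/neq_lift.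
have mM a : (mid a == ord_max) = false.
  apply: negbTE; rewrite -val_eqE /= /bump /= (leqNgt n) ltn_ord add0n add1n.
  by rewrite eqSS neq_ltn ltn_ord.
have m0' a : (ord0 == mid a) = false by rewrite eq_sym.
have mM' a : (ord_max == mid a) = false by rewrite eq_sym.
have mi a b : (mid a == mid b) = (a == b) by rewrite !(inj_eq lift_inj).
have cases b : [\/ b = ord0, b = ord_max | exists a, b = mid a].
  case: (unliftP ord0 b) => [b' ->|->]; last by constructor 1.
  case: (unliftP ord_max b') => [a ->|->]; first by constructor 3; exists a.
  by constructor 2; apply: val_inj.
suff formE (X : amb) : form X (dual_basis l) = X 0 l.
  by rewrite formE basisE eq_sym.
rewrite /form /dual_basis.
case: (cases l) => [->|->|[b ->]].
- rewrite tpermL !basisE eqxx mulr1 mulr0 addr0 big1 ?addr0 // => c _.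
  by rewrite basisE mM mulr0.
- rewrite tpermR !basisE eqxx mulr1 mulr0 add0r big1 ?addr0 // => c _.
  by rewrite basisE m0 mulr0.
rewrite tpermD ?m0' ?mM' // !basisE m0' mM' !mulr0 !add0r (bigD1 b) //=.
rewrite basisE eqxx mulr1 big1 ?addr0 // => c cb.
by rewrite basisE mi (negbTE cb) mulr0.
Qed.

(* One sheet of the null-cone without its vertex.  Nonzero null vectors satisfy
   X^0 <> X^oo, and the two sheets X^0 > X^oo and X^0 < X^oo are exchanged by
   X |-> - X.  Positive scalings preserve each sheet, and the space of rays of
   one sheet is the projectivized cone S^n. *)
Definition cone : set amb :=
  [set X | form X X = 0 /\ X 0 ord_max < X 0 ord0].

(* The point (1, x_1, ..., x_n, -1/2 sum x_i^2). *)
Definition chart (x : 'rV[R]_n) : amb :=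
  basis ord0 + \sum_(i < n) x 0 i *: basis (mid i)
  - ((\sum_(i < n) x 0 i ^+ 2) / 2) *: basis ord_max.

(* C^oo(S^n, L_w), as smooth w-homogeneous functions on the cone; the values of
   [f] outside [cone] are irrelevant.  Smoothness on the submanifold [cone]
   means that [f] locally extends to a smooth function on the ambient space.
   In the chart, the density is represented by [f \o chart]. *)
Definition density (w : R[i]) (f : amb -> R[i]) : Prop :=
  (forall X, cone X -> exists (U : set amb) (F : amb -> R[i]),
      [/\ open U, U X, csmooth_on U F &
          forall Y, U Y -> cone Y -> F Y = f Y]) /\
  (forall (l : R) X, 0 < l -> cone X -> f (l *: X) = cpow l w * f X).

(* [F] extends the density [f] as a smooth w-homogeneous function to some open
   neighbourhood of the cone.  Homogeneity off the cone cannot be dropped: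
   [F] and [F + Q^2], with Q X = <X,X>, agree on the cone, but for k = 0 the
   squares of the Laplacian of their values there differ by 8(n+2)(n+4). *)
Definition extension (w : R[i]) (f F : amb -> R[i]) : Prop :=
  exists U : set amb,
    [/\ open U, cone `<=` U, csmooth_on U F,
        forall X, cone X -> F X = f X &
        forall (l : R) X, 0 < l -> U X -> U (l *: X) ->
          F (l *: X) = cpow l w * F X].

Definition refl (a X : amb) : amb := X - (2 * form a X / form a a) *: a.

Definition root_system (Phi : {fset amb}) : Prop :=
  [/\ forall a, a \in Phi -> form a a != 0,
      forall a (c : R), a \in Phi ->
        (c *: a \in Phi) = (c == 1) || (c == -1) &
      forall a, a \in Phi -> [set` Phi] = refl a @` [set` Phi]].

Definition euclidean_roots (Phi : {fset amb}) : Prop :=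
  forall a, a \in Phi -> a 0 ord0 = a 0 ord_max.

(* The linear functional defining the positive roots is <., v>. *)
Definition positive_roots (Phi Pos : {fset amb}) : Prop :=
  exists v : amb, (forall a, a \in Phi -> form a v != 0) /\
    (forall a, (a \in Pos) = (a \in Phi) && (0 < form a v)).

(* Reflections are involutions, so closure under composition gives the
   generated group. *)
Inductive refl_group (Phi : {fset amb}) : (amb -> amb) -> Prop :=
| refl_group_id : refl_group Phi idfun
| refl_group_refl a : a \in Phi -> refl_group Phi (refl a)
| refl_group_comp g h :
    refl_group Phi g -> refl_group Phi h -> refl_group Phi (g \o h).

Definition multiplicity (Phi : {fset amb}) (k : amb -> R[i]) : Prop :=
  forall g a, refl_group Phi g -> a \in Phi -> k (g a) = k a.

Definition gamma (Pos : {fset amb}) (k : amb -> R[i]) : R[i] :=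
  \sum_(a <- Pos) k a.

(* (F X - F (R_a X)) / <a,X>, extended by continuity to the hyperplane
   <a,X> = 0: there R_a X = X - (2 <a,X> / <a,a>) a, so for smooth F the
   quotient tends to (2 / <a,a>) d_a F X. *)
Definition diff_quot (a : amb) (F : amb -> R[i]) (X : amb) : R[i] :=
  if form a X == 0 then (2 / form a a)%:C * cderive a F X
  else (F X - F (refl a X)) / (form a X)%:C.

Definition dunkl (Pos : {fset amb}) (k : amb -> R[i]) (xi : amb)
    (F : amb -> R[i]) (X : amb) : R[i] :=
  cderive xi F X +
  \sum_(a <- Pos) k a * (form a xi)%:C * diff_quot a F X.

Definition dunkl_laplace (Pos : {fset amb}) (k : amb -> R[i])
    (F : amb -> R[i]) (X : amb) : R[i] :=
  \sum_(i < n.+2) dunkl Pos k (basis i) (dunkl Pos k (dual_basis i) F) X.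

Definition pderive (i : 'I_n) (h : 'rV[R]_n -> R[i]) : 'rV[R]_n -> R[i] :=
  cderive (delta_mx 0 i) h.

Definition pderives (s : seq 'I_n) (h : 'rV[R]_n -> R[i]) :
    'rV[R]_n -> R[i] :=
  foldr pderive h s.

Definition laplace (h : 'rV[R]_n -> R[i]) (x : 'rV[R]_n) : R[i] :=
  \sum_(i < n) pderive i (pderive i h) x.

Definition regular (Phi : {fset amb}) : set 'rV[R]_n :=
  [set x | forall a, a \in Phi -> form a (chart x) != 0].

(* [A] maps w-densities to functions in the chart.  It is a
   differential-difference operator all of whose terms have order < m when it
   is a finite sum of terms a(x) d^s (f o g), with g in the reflection group and
   |s| < m.  As for Dunkl operators, the coefficients a are smooth off the
   reflection hyperplanes, where they may be singular. *)
Definition diffdiff_lt (Phi : {fset amb}) (w : R[i]) (m : nat)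
    (A : (amb -> R[i]) -> 'rV[R]_n -> R[i]) : Prop :=
  exists (N : nat) (g : 'I_N -> amb -> amb) (s : 'I_N -> seq 'I_n)
         (c : 'I_N -> 'rV[R]_n -> R[i]),
    [/\ forall t, refl_group Phi (g t),
        forall t, (size (s t) < m)%N,
        forall t, csmooth_on (regular Phi) (c t) &
        forall f x, density w f -> regular Phi x ->
          A f x = \sum_(t < N) c t x * pderives (s t) (f \o g t \o chart) x].

Definition diffdiff_order (Phi : {fset amb}) (w : R[i]) (m : nat)
    (A : (amb -> R[i]) -> 'rV[R]_n -> R[i]) : Prop :=
  diffdiff_lt Phi w m.+1 A /\ ~ diffdiff_lt Phi w m A.

(* The operator [A] of order m has the same terms of order m as the
   differential operator [S] of the chart. *)
Definition diffdiff_symbol (Phi : {fset amb}) (w : R[i]) (m : nat)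
    (A : (amb -> R[i]) -> 'rV[R]_n -> R[i])
    (S : ('rV[R]_n -> R[i]) -> 'rV[R]_n -> R[i]) : Prop :=
  diffdiff_lt Phi w m (fun f x => A f x - S (f \o chart) x).

End Ambient.

(* Main.v *)
Require Import Defs.
From HB Require Import structures.
From mathcomp Require Import all_boot all_order all_algebra.
From mathcomp Require Import perm finmap complex.
From mathcomp Require Import all_classical all_reals all_analysis.
From mathcomp Require Import ring lra zify.
Set Implicit Arguments.
Unset Strict Implicit.
Unset Printing Implicit Defensive.
Import Order.TTheory GRing.Theory Num.Theory numFieldNormedType.Exports.
Local Open Scope classical_set_scope.
Local Open Scope complex_scope.
Local Open Scope ring_scope.

(** Write Q for the function X |-> <X,X> and Lap for the Dunkl Laplacian.

    Independence of the extension. On functions of degree w, the commutator of Lap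
    with multiplication by Q is the scalar 4 w + 2 (n + 2) + 4 gamma
    ([dunkl_laplaceM_Q]): Euler's identity yields w up to values at reflected
    points, and these cancel against the ones produced by the product rule.
    Summing over the factors of a power,
      Lap^m (Q H) = Q Lap^m H + m (4 w - 4 m + 4 + 2 (n + 2) + 4 gamma) Lap^(m-1) H
    for H of degree w ([iter_laplaceM_Q]). Two extensions of a w-density differ by a
    function of degree w that vanishes on the cone, hence by Q H with H of degree
    w - 2 ([divide_Q]). For this degree and m = j the scalar is zero exactly by the
    choice of w, so that the j-th powers agree where Q = 0
    ([iter_laplace_extension]).

    The operator on densities. The roots are orthogonal to the time axis
    e_0 - e_oo, so the reflections commute with the projection [cone_proj] to the
    cone along that axis, and f o cone_proj is an extension of f on a domain that is
    invariant under the reflections. Homogeneity of degree w - 2 j is inherited from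
    Lap^j, and equivariance holds because Lap commutes with the reflections
    ([laplace_refl]): the sum over the positive roots is half the sum over all roots,
    which a reflection permutes. The difference quotients of the Dunkl operators and
    the division by Q are both divided differences, whose smoothness is Hadamard's
    lemma ([smooth_on_divided_difference]).

    The symbol. Off the mirrors a Dunkl operator is a derivative plus terms of order
    zero, so Lap^j differs from the j-th power of the wave operator by terms of order
    below 2 j ([diffdiff_iter_laplace_box]). In the stereographic coordinates of
    [cone_proj] and the height (cone_proj X)^0, an extended density is a power of the
    height times a function u of the coordinates. These coordinates are conformal
    ([chart_inv_conformal]), so the wave operator acts on u as the Laplacian up to
    lower order and a power of the height ([chart_below_iter_box]), and the height is
    1 on the chart.

    The exact order, and nontriviality. It remains to see that the j-th power of the
    Laplacian in the chart is not a sum of terms of order below 2 j, even with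
    reflected arguments ([laplace_not_lt]). Let g run over the finitely many group
    elements of such a sum, and let x be a point off the mirrors
    ([exists_regular]). There is a density that vanishes to order 2 j at all points
    g (chart x) and is |y - x|^(2 j) h(y) in the chart, with h(x) different from 0
    ([vanishing_density_chart]). All the terms of the sum annihilate it at x, whereas
    the j-th power of the Laplacian does not ([iter_laplace_dist_sqM]). *)

Local Notation form := Defs.form.
Local Notation basis := Defs.basis.

(** * Directional derivatives *)

Section DirectionalCalculus.
Variables (R : realType) (V : normedModType R).
Implicit Types (U : set V) (f g : V -> R) (x v : V).

Lemma eq_on_derivable U f g x v : open U -> U x ->
  (forall y, U y -> f y = g y) -> derivable f x v -> derivable g x v.
Proof.
move=> oU Ux fg; apply: near_eq_derivable.
by near=> y; apply: fg; near: y; exact: open_nbhs_nbhs.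
Unshelve. all: by end_near. Qed.

Lemma eq_on_derive U f g x v : open U -> U x ->
  (forall y, U y -> f y = g y) -> 'D_v f x = 'D_v g x.
Proof.
move=> oU Ux fg; apply: near_eq_derive.
by near=> y; apply: fg; near: y; exact: open_nbhs_nbhs.
Unshelve. all: by end_near. Qed.

Lemma eq_on_continuous U f g x : open U -> U x ->
  (forall y, U y -> f y = g y) -> {for x, continuous f} -> {for x, continuous g}.
Proof.
move=> oU Ux fg cf; rewrite /prop_for /continuous_at -fg //.
apply: cvg_trans cf; apply: near_eq_cvg.
by near=> y; apply: fg; near: y; exact: open_nbhs_nbhs.
Unshelve. all: by end_near. Qed.

Lemma Cn_on_eq m U f g : open U -> (forall x, U x -> f x = g x) ->
  Cn_on m U f -> Cn_on m U g.
Proof.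
move=> oU; elim: m f g => [|m IHm] f g fg /= [cf df]; split => //.
  by move=> x Ux; exact: (eq_on_continuous oU Ux fg (cf x Ux)).
  by move=> x Ux; exact: (eq_on_continuous oU Ux fg (cf x Ux)).
case: df => df Cdf; split=> [x v Ux|v].
  exact: (eq_on_derivable oU Ux fg (df x v Ux)).
apply: IHm (Cdf v) => x Ux; exact: (eq_on_derive v oU Ux fg).
Qed.

Lemma Cn_onW m U f : Cn_on m.+1 U f -> Cn_on m U f.
Proof.
elim: m f => [|m IHm] f [cf [df Cf]]; first by split.
by split => //; split => // v; exact: IHm (Cf v).
Qed.

Lemma Cn_on_continuous m U f x : Cn_on m U f -> U x -> {for x, continuous f}.
Proof. by case: m => [|m] [cf _] Ux; exact: cf. Qed.

Lemma Cn_on_sub m U W f : W `<=` U -> Cn_on m U f -> Cn_on m W f.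
Proof.
move=> WU; elim: m f => [|m IHm] f [cf].
  by split => // x Wx; apply: cf; exact: WU.
case=> df Cf; split; first by move=> x Wx; apply: cf; exact: WU.
by split=> [x v Wx|v]; [apply: df; exact: WU|exact: IHm (Cf v)].
Qed.

Lemma Cn_on_local m U f :
  (forall x, U x -> exists W, [/\ open W, W x & Cn_on m W f]) -> Cn_on m U f.
Proof.
elim: m f => [|m IHm] f loc.
  by split => // x /loc[W [_ Wx [cf _]]]; exact: cf.
split; first by move=> x /loc[W [_ Wx [cf _]]]; exact: cf.
split; first by move=> x v /loc[W [_ Wx [_ [df _]]]]; exact: df.
move=> v; apply: IHm => x /loc[W [oW Wx [_ [_ Cf]]]].
by exists W; split => //; exact: Cf.
Qed.

(** Any formula [df] for the derivatives may be supplied, so that the regularity of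
    a composite follows from that of a formula for its derivatives. *)
Lemma Cn_onS m U f (df : V -> V -> R) : open U ->
  (forall x, U x -> {for x, continuous f}) ->
  (forall x v, U x -> is_derive x v f (df v x)) ->
  (forall v, Cn_on m U (df v)) -> Cn_on m.+1 U f.
Proof.
move=> oU cf dfE Cf; split=> //; split=> [x v Ux|v].
  by have [] := dfE x v Ux.
by apply: Cn_on_eq (Cf v) => // x Ux; have [_ ->] := dfE x v Ux.
Qed.

Lemma Cn_on_derive m U f x v :
  Cn_on m.+1 U f -> U x -> is_derive x v f ('D_v f x).
Proof. by move=> [_ [df _]] Ux; exact/derivableP/df. Qed.

Lemma Cn_on_partial m U f v : Cn_on m.+1 U f -> Cn_on m U ('D_v f).
Proof. by case=> _ [_]; exact. Qed.

Lemma Cn_on_cst m U (c : R) : open U -> Cn_on m U (cst c).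
Proof.
move=> oU; elim: m c => [|m IHm] c; first by split => // x _; exact: cvg_cst.
apply: (@Cn_onS _ _ _ (fun _ => cst 0)) => // x *; exact: cvg_cst.
Qed.

Lemma Cn_onD m U f g : open U ->
  Cn_on m U f -> Cn_on m U g -> Cn_on m U (fun x => f x + g x).
Proof.
move=> oU; elim: m f g => [|m IHm] f g Cf Cg.
  by split => // x Ux; apply: cvgD;
    [exact: Cn_on_continuous Cf Ux|exact: Cn_on_continuous Cg Ux].
apply: (@Cn_onS _ _ _ (fun v x => 'D_v f x + 'D_v g x)) => //.
- by move=> x Ux; apply: cvgD;
    [exact: Cn_on_continuous Cf Ux|exact: Cn_on_continuous Cg Ux].
- move=> x v Ux; exact: is_deriveD (Cn_on_derive v Cf Ux) (Cn_on_derive v Cg Ux).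
- by move=> v; apply: IHm; exact: Cn_on_partial.
Qed.

Lemma Cn_onM m U f g : open U ->
  Cn_on m U f -> Cn_on m U g -> Cn_on m U (fun x => f x * g x).
Proof.
move=> oU; elim: m f g => [|m IHm] f g Cf Cg.
  by split => // x Ux; apply: cvgM;
    [exact: Cn_on_continuous Cf Ux|exact: Cn_on_continuous Cg Ux].
apply: (@Cn_onS _ _ _ (fun v x => f x * 'D_v g x + g x * 'D_v f x)) => //.
- by move=> x Ux; apply: cvgM;
    [exact: Cn_on_continuous Cf Ux|exact: Cn_on_continuous Cg Ux].
- move=> x v Ux; exact: is_deriveM (Cn_on_derive v Cf Ux) (Cn_on_derive v Cg Ux).
- by move=> v; apply: Cn_onD => //; apply: IHm;
    solve [exact: Cn_onW|exact: Cn_on_partial].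
Qed.

Lemma derive_line f x v : 'D_v f x = 'D_1 (fun t : R => f (t *: v + x)) 0.
Proof.
rewrite /derive; set F := fun h => _; set G := fun h => _.
suff -> : F = G by [].
by apply/funext => t; rewrite /F /G /= addr0 scale0r add0r [_%:A]mulr1.
Qed.

(** A directional derivative is the derivative at 0 of the restriction to a line;
    this transports the calculus of one variable. *)
Lemma is_derive_line f x v df :
  is_derive x v f df <-> is_derive (0 : R) 1 (fun t : R => f (t *: v + x)) df.
Proof.
split=> -[d dE]; apply: DeriveDef.
- exact: (derivable1P _ _ _).1 d.
- by rewrite -derive_line.
- exact: (derivable1P _ _ _).2 d.
- by rewrite derive_line.
Qed.

Lemma is_derive_comp1 f (h : R -> R) x v df dh :
  is_derive x v f df -> is_derive (f x) 1 h dh -> is_derive x v (h \o f) (dh * df).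
Proof.
move=> /is_derive_line [df1 df1E] dh1; apply/is_derive_line.
set phi := fun t => f (t *: v + x) in df1 df1E *.
have phi0 : phi 0 = f x by rewrite /phi scale0r add0r.
rewrite -phi0 in dh1; case: dh1 => dh1 dh1E.
have := derive1_comp df1 dh1; rewrite 3!derive1E df1E dh1E => <-.
apply: derivableP; apply/derivable1_diffP.
apply: (@differentiable_comp _ _ _ _ phi h).
  by apply/derivable1_diffP; exact: df1.
by apply/derivable1_diffP; exact: dh1.
Qed.

End DirectionalCalculus.

Section MeanValue.
Variables (R : realType) (V : normedModType R).
Implicit Types (f : V -> R) (x v : V).

(** The mean value theorem for the restriction of [f] to the segment. *)
Lemma mean_value f x v :
  (forall t : R, 0 <= t <= 1 -> derivable f (t *: v + x) v) ->
  exists2 t : R, 0 <= t <= 1 & f (v + x) - f x = 'D_v f (t *: v + x).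
Proof.
move=> df; pose phi (t : R) := f (t *: v + x).
have dphi (t : R) : 0 <= t <= 1 -> is_derive t 1 phi ('D_v f (t *: v + x)).
  move=> /df dt; have E (y : R) : y *: v + (t *: v + x) = (y + t) *: v + x.
    by rewrite scalerDl addrA.
  apply/is_derive_line; move/derivableP/is_derive_line: dt.
  by under eq_fun do rewrite E; under [in X in _ -> X]eq_fun do rewrite [_%:A]mulr1.
have [|||t] := @MVT _ phi (fun t => 'D_v f (t *: v + x)) 0 1.
- exact: ltr01.
- by move=> t /[!in_itv] /= /andP[t0 t1]; apply: dphi; rewrite !ltW.
- apply: derivable_within_continuous => t /[!in_itv] /= t01.
  by have [] := dphi t t01.
move=> /[!in_itv] /= /andP[t0 t1].
rewrite /phi scale1r scale0r add0r subr0 mulr1 => E.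
by exists t => //; rewrite !ltW.
Qed.

End MeanValue.

(** * Linearity in the direction and the chain rule *)

Section ForContinuous.
Variables (R : realType) (V : normedModType R).
Implicit Types (f g : V -> R) (x : V).

Lemma for_continuousD f g x : {for x, continuous f} -> {for x, continuous g} ->
  {for x, continuous (fun y => f y + g y)}.
Proof. by move=> cf cg; apply: cvgD. Qed.

Lemma for_continuousM f g x : {for x, continuous f} -> {for x, continuous g} ->
  {for x, continuous (fun y => f y * g y)}.
Proof. by move=> cf cg; apply: cvgM. Qed.

End ForContinuous.

Section DirectionLinearity.
Variables (R : realType) (V : normedModType R).
Implicit Types (U : set V) (f : V -> R) (x u v : V).

Lemma is_deriveZ_dir f x v (c : R) df :
  is_derive x v f df -> is_derive x (c *: v) f (c * df).
Proof.
move=> /is_derive_line dphi; apply/is_derive_line.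
set phi := fun t : R => f (t *: v + x) in dphi.
have -> : (fun t : R => f (t *: (c *: v) + x)) = phi \o ( *%R^~ c).
  by apply/funext => t /=; rewrite /phi scalerA.
rewrite mulrC; apply: (@is_derive_comp1 R R^o _ phi).
  have -> : *%R^~ c = c \*: (id : R -> R^o).
    by apply/funext => t /=; rewrite mulrC.
  by apply: is_derive_eq; rewrite [LHS]mulr1.
by rewrite mul0r.
Qed.

(** The intermediate points of [mean_value] as a function of the segment, so that
    limits can be taken along them. *)
Lemma secant_point f : exists t : V -> V -> R, forall b k, 0 <= t b k <= 1 /\
  ((forall s : R, 0 <= s <= 1 -> derivable f (s *: k + b) k) ->
   f (k + b) - f b = 'D_k f (t b k *: k + b)).
Proof.
have /choice[t tP] : forall bk : V * V, exists t : R, 0 <= t <= 1 /\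
  ((forall s : R, 0 <= s <= 1 -> derivable f (s *: bk.2 + bk.1) bk.2) ->
   f (bk.2 + bk.1) - f bk.1 = 'D_(bk.2) f (t *: bk.2 + bk.1)).
  move=> [b k] /=.
  have [df|ndf] := pselect (forall s : R, 0 <= s <= 1 -> derivable f (s *: k + b) k).
    by have [t t01 E] := mean_value df; exists t.
  by exists 0; rewrite lexx ler01.
by exists (fun b k => t (b, k)) => b k; exact: (tP (b, k)).
Qed.

Lemma segment_cvg (T : Type) (F : set_system T) {FF : Filter F} (b k : T -> V)
    (t : T -> R) x : (forall h, 0 <= t h <= 1) ->
  b @ F --> x -> k @ F --> 0 -> (fun h => t h *: k h + b h) @ F --> x.
Proof.
move=> t01 bx k0; rewrite -[x in _ --> x]add0r; apply: cvgD => //.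
apply/cvgr0Pnorm_lt => e e0.
move/cvgr0Pnorm_lt: k0 => /(_ _ e0); apply: filterS => h /(le_lt_trans _); apply.
have /andP[t0 t1] := t01 h.
by rewrite normrZ ger0_norm // ler_piMl.
Qed.

Lemma segment_near (T : Type) (F : set_system T) {FF : Filter F} (b k : T -> V)
    U x : open U -> U x -> b @ F --> x -> k @ F --> 0 ->
  \forall h \near F, forall s : R, 0 <= s <= 1 -> U (s *: k h + b h).
Proof.
move=> oU Ux bx k0.
have /nbhs_ballP[e /= e0 eU] : nbhs x U by exact: open_nbhs_nbhs.
have e20 : 0 < e / 2 by rewrite divr_gt0.
move/cvgrPdist_lt: bx => /(_ _ e20); move/cvgr0Pnorm_lt: k0 => /(_ _ e20).
apply: filterS2 => h kh bh s /andP[s0 s1]; apply: eU.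
rewrite -ball_normE /= opprD addrA addrAC [e]splitr.
rewrite (le_lt_trans (ler_normB _ _)) // ltrD //.
by rewrite (le_lt_trans _ kh) // normrZ ger0_norm // ler_piMl.
Qed.

(** Continuous partial derivatives make the directional derivative additive in
    the direction: split the increment along the two legs of a triangle and
    apply the mean value theorem to the leg that does not start at [x]. *)
Lemma is_deriveD_dir U f x u v : open U -> U x ->
  (forall y, U y -> derivable f y u) -> (forall y, U y -> derivable f y v) ->
  {for x, continuous ('D_v f)} ->
  is_derive x (u + v) f ('D_u f x + 'D_v f x).
Proof.
move=> oU Ux du dv cv; have [t tP] := secant_point f.
pose y h := t (h *: u + x) (h *: v) *: (h *: v) + (h *: u + x).
have cline w (b : V) : (fun h : R => h *: w + b) @ 0^' --> b.
  rewrite -[b in _ --> b]add0r; apply: cvgD; last exact: cvg_cst.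
  rewrite -(scale0r w); apply: cvgZr_tmp => //; exact: nbhs_dnbhs.
have cv0 : (fun h : R => h *: v) @ 0^' --> 0.
  by have := cline v 0; under eq_fun do rewrite addr0.
have yx : y @ 0^' --> x.
  apply: segment_cvg => //; first by move=> h; have [] := tP (h *: u + x) (h *: v).
have L : (fun h : R => h^-1 *: (f (h *: (u + v) + x) - f x)) @ 0^'
    --> 'D_u f x + 'D_v f x.
  have Du : (fun h : R => h^-1 *: (f (h *: u + x) - f x)) @ 0^' --> 'D_u f x.
    exact: du.
  have Dv : 'D_v f \o y @ 0^' --> 'D_v f x by exact: continuous_cvg.
  apply: cvg_trans (cvgD Du Dv); apply: near_eq_cvg; near=> h.
  have h0 : h != 0 by near: h; exact: nbhs_dnbhs_neq.
  have segU : forall s : R, 0 <= s <= 1 -> U (s *: (h *: v) + (h *: u + x)).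
    near: h; exact: (segment_near (b := fun h => h *: u + x) (k := fun h => h *: v) oU Ux (cline u x) cv0).
  have [_ /(_ _)] := tP (h *: u + x) (h *: v).
  rewrite -/(y h) => E.
  have -> : h *: (u + v) + x = h *: v + (h *: u + x).
    by rewrite scalerDr addrA [h *: u + _]addrC.
  rewrite -[f (h *: v + _)](subrK (f (h *: u + x))) E; last first.
    move=> s s01; have [] := is_deriveZ_dir h (derivableP (dv _ (segU s s01))).
    by [].
  have Uy : U (y h).
    by apply: segU; have [] := tP (h *: u + x) (h *: v).
  have [_ ->] := is_deriveZ_dir h (derivableP (dv _ Uy)).
  rewrite /= -addrA scalerDr [RHS]addrC; congr (_ + _).
  by rewrite [RHS]mulrA mulVf // mul1r.
by apply: DeriveDef; [apply/cvg_ex; exists ('D_u f x + 'D_v f x)|exact/cvg_lim].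
Unshelve. all: by end_near. Qed.

Lemma is_derive_sum_dir U f (I : Type) (r : seq I) (c : I -> R) (e : I -> V) x :
  open U -> Cn_on 1 U f -> U x ->
  is_derive x (\sum_(i <- r) c i *: e i) f (\sum_(i <- r) c i * 'D_(e i) f x).
Proof.
move=> oU [_ [df cf]].
elim: r x => [|i r IHr] x Ux.
  by rewrite !big_nil; exact: is_derive0.
rewrite !big_cons.
have D y v : U y -> is_derive y v f ('D_v f y) by move=> Uy; exact/derivableP/df.
set w := \sum_(j <- r) _; set dw := \sum_(j <- r) _.
have cD : {for x, continuous ('D_w f)}.
  have E y : U y -> \sum_(j <- r) c j * 'D_(e j) f y = 'D_w f y.
    by move=> /IHr [].
  apply: (eq_on_continuous oU Ux E).
  elim: {IHr w dw E} r => [|j r IHr].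
    have -> : (fun y => \sum_(j <- [::]) c j * 'D_(e j) f y) = cst 0.
      by apply/funext => y; rewrite big_nil.
    exact: cst_continuous.
  have -> : (fun y => \sum_(k <- j :: r) c k * 'D_(e k) f y) =
      (fun y => c j * 'D_(e j) f y + \sum_(k <- r) c k * 'D_(e k) f y).
    by apply/funext => y; rewrite big_cons.
  apply: for_continuousD => //; apply: for_continuousM; first exact: cst_continuous.
  by have [+ _] := cf (e j); exact.
have [di Ei] := is_deriveZ_dir (c i) (D x (e i) Ux).
have [dr Er] := IHr x Ux.
have d1 y : U y -> derivable f y (c i *: e i).
  by move=> Uy; have [] := is_deriveZ_dir (c i) (D y (e i) Uy).
have d2 y : U y -> derivable f y w by move=> Uy; have [] := IHr y Uy.
have [dd Ed] := is_deriveD_dir oU Ux d1 d2 cD.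
by apply: DeriveDef dd _; rewrite Ed Ei Er.
Qed.

Lemma cvg_sumr (T : Type) (F : set_system T) {FF : Filter F} (I : Type)
    (r : seq I) (g : I -> T -> R) (l : I -> R) :
  (forall i, g i @ F --> l i) ->
  (fun t => \sum_(i <- r) g i t) @ F --> \sum_(i <- r) l i.
Proof.
by move=> gl; apply: (@cvg_big _ _ _ _ xpredT) => //; exact: add_continuous.
Qed.

End DirectionLinearity.

Section RowSpace.
Variables (R : realType) (p : nat).
Local Notation V := 'rV[R]_p.
Implicit Types (W : set V) (f : V -> R).

Lemma derive_dirE W f v x : open W -> Cn_on 1 W f -> W x ->
  'D_v f x = \sum_i v 0 i * 'D_(delta_mx 0 i) f x.
Proof.
by move=> oW cf Wx; have [_] := is_derive_sum_dir (index_enum _) (fun i => v 0 i)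
  (fun i => delta_mx 0 i) oW cf Wx; rewrite -row_sum_delta.
Qed.

Lemma cvg_rV (T : Type) (F : set_system T) {FF : Filter F} (g : T -> V) (y : V) :
  (forall i, (fun t => g t 0 i) @ F --> y 0 i) -> g @ F --> y.
Proof.
move=> gi; apply/cvg_ballP => e e0.
have : \forall t \near F, forall i, ball (y 0 i) e (g t 0 i).
  apply: filter_forall => i.
  by move: (gi i) => /cvg_ballP /(_ _ e0).
by apply: filterS => t gt; split => // a b; rewrite ord1.
Qed.

(** Chain rule: by [mean_value] the increment of [f \o g] is a derivative of [f] in
    the direction of the increment of [g], which is expanded over the canonical
    basis before passing to the limit. *)
Lemma is_derive_comp_rV (U : normedModType R) W f (g : U -> V) (dg : V) (x v : U) :
  open W -> Cn_on 1 W f -> W (g x) -> {for x, continuous g} ->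
  (forall i, is_derive x v (fun y => g y 0 i) (dg 0 i)) ->
  is_derive x v (f \o g) ('D_dg f (g x)).
Proof.
move=> oW cf Wgx cg dgE; have [t tP] := secant_point f.
pose k (h : R) : V := g (h *: v + x) - g x.
have cline : (fun h : R => h *: v + x) @ 0^' --> x.
  rewrite -[x in _ --> x]add0r; apply: cvgD; last exact: cvg_cst.
  rewrite -(scale0r v); apply: cvgZr_tmp => //; exact: nbhs_dnbhs.
have k0 : k @ 0^' --> (0 : V).
  by rewrite -(subrr (g x)); apply: cvgB; [exact: continuous_cvg|exact: cvg_cst].
have cb : (fun _ : R => g x) @ 0^' --> g x by exact: cvg_cst.
pose y h := t (g x) (k h) *: k h + g x.
have yx : y @ 0^' --> g x.
  by apply: segment_cvg => // h; have [] := tP (g x) (k h).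
have L : (fun h : R => h^-1 *: ((f \o g) (h *: v + x) - (f \o g) x)) @ 0^'
    --> 'D_dg f (g x).
  rewrite (derive_dirE dg oW cf Wgx).
  have Ds : (fun h => \sum_i (h^-1 *: (g (h *: v + x) 0 i - g x 0 i)) *
       'D_(delta_mx 0 i) f (y h)) @ 0^' -->
       \sum_i dg 0 i * 'D_(delta_mx 0 i) f (g x).
    apply: cvg_sumr => i; apply: cvgM.
      by have [+ <-] := dgE i; exact.
    apply: (@continuous_cvg _ _ _ _ _ _ ('D_(delta_mx 0 i) f)) => //.
    by case: cf => _ [_ /(_ (delta_mx 0 i)) [+ _]]; exact.
  apply: cvg_trans Ds; apply: near_eq_cvg; near=> h.
  have segW : forall s : R, 0 <= s <= 1 -> W (s *: k h + g x).
    near: h; exact: (segment_near (b := fun=> g x) (k := k) oW Wgx cb k0).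
  have [t01 /(_ _)] := tP (g x) (k h).
  rewrite -/(y h) {1}/k subrK => /= ->; last first.
    by move=> s s01; case: cf => _ [+ _]; apply; exact: segW.
  rewrite (derive_dirE (k h) oW cf (segW _ t01)) scaler_sumr.
  by apply: eq_bigr => i _; rewrite /k !mxE -mulrA.
by apply: DeriveDef; [apply/cvg_ex; exists ('D_dg f (g x))|exact/cvg_lim].
Unshelve. all: by end_near. Qed.

End RowSpace.

(** * Smooth functions *)

Lemma near_open (T : topologicalType) (P : T -> Prop) (x : T) :
  (\forall y \near x, P y) -> exists W, [/\ open W, W x & forall y, W y -> P y].
Proof. by rewrite -nbhs_nearE nbhsE => -[W [oW Wx] WP]; exists W. Qed.

Section SmoothFunctions.
Variables (R : realType) (V : normedModType R).
Implicit Types (U : set V) (f g : V -> R) (h : R -> R).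

Lemma Cn_on_comp1 m U f h (h' : R -> R) : open U ->
  (forall x, U x -> is_derive (f x) 1 h (h' (f x))) ->
  Cn_on m U (h' \o f) -> Cn_on m.+1 U f -> Cn_on m.+1 U (h \o f).
Proof.
move=> oU dh Ch' Cf.
apply: (@Cn_onS _ _ _ _ _ (fun v x => h' (f x) * 'D_v f x)) => //.
- move=> x Ux; apply: continuous_comp; first exact: Cn_on_continuous Cf Ux.
  apply/differentiable_continuous/derivable1_diffP.
  by have [] := dh x Ux.
- move=> x v Ux; exact: is_derive_comp1 (Cn_on_derive v Cf Ux) (dh x Ux).
- by move=> v; apply: Cn_onM => //; exact: Cn_on_partial.
Qed.

Lemma Cn_on_comp0 m U f h (h' : R -> R) : open U ->
  (forall x, U x -> is_derive (f x) 1 h (h' (f x))) ->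
  Cn_on m U f -> Cn_on 0 U (h \o f).
Proof.
move=> oU dh Cf; split=> // x Ux.
apply: continuous_comp; first exact: Cn_on_continuous Cf Ux.
apply/differentiable_continuous/derivable1_diffP.
by have [] := dh x Ux.
Qed.

Lemma smooth_on_eq U f g : open U -> (forall x, U x -> f x = g x) ->
  smooth_on U f -> smooth_on U g.
Proof. by move=> oU fg sf m; apply: Cn_on_eq (sf m). Qed.

Lemma smooth_on_sub U W f : W `<=` U -> smooth_on U f -> smooth_on W f.
Proof. by move=> WU sf m; apply: Cn_on_sub (sf m). Qed.

Lemma smooth_on_local U f :
  (forall x, U x -> exists W, [/\ open W, W x & smooth_on W f]) -> smooth_on U f.
Proof.
by move=> loc m; apply: Cn_on_local => x /loc[W [oW Wx sf]]; exists W.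
Qed.

Lemma smooth_on_derive U f v : smooth_on U f -> smooth_on U ('D_v f).
Proof. by move=> sf m; exact: Cn_on_partial (sf m.+1). Qed.

Lemma smooth_on_is_derive U f v x : smooth_on U f -> U x -> is_derive x v f ('D_v f x).
Proof. by move=> sf; exact: Cn_on_derive (sf 1%N). Qed.

Lemma smooth_on_continuous U f x : smooth_on U f -> U x -> {for x, continuous f}.
Proof. by move=> sf; exact: Cn_on_continuous (sf 0%N). Qed.

Lemma smooth_on_cst U (c : R) : open U -> smooth_on U (cst c).
Proof. by move=> oU m; exact: Cn_on_cst. Qed.

Lemma smooth_onD U f g : open U -> smooth_on U f -> smooth_on U g ->
  smooth_on U (fun x => f x + g x).
Proof. by move=> oU sf sg m; exact: Cn_onD. Qed.

Lemma smooth_onM U f g : open U -> smooth_on U f -> smooth_on U g ->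
  smooth_on U (fun x => f x * g x).
Proof. by move=> oU sf sg m; exact: Cn_onM. Qed.

Lemma smooth_onN U f : open U -> smooth_on U f -> smooth_on U (fun x => - f x).
Proof.
move=> oU sf; apply: (smooth_on_eq (f := fun x => -1 * f x)) => //.
  by move=> x _; rewrite mulN1r.
by apply: smooth_onM => //; exact: smooth_on_cst.
Qed.

Lemma smooth_onB U f g : open U -> smooth_on U f -> smooth_on U g ->
  smooth_on U (fun x => f x - g x).
Proof. by move=> oU sf sg; apply: smooth_onD => //; exact: smooth_onN. Qed.

Lemma smooth_on_sum U (I : Type) (r : seq I) (f : I -> V -> R) : open U ->
  (forall i, smooth_on U (f i)) -> smooth_on U (fun x => \sum_(i <- r) f i x).
Proof.
move=> oU sf; elim: r => [|i r IHr].
  apply: (smooth_on_eq (f := cst 0)) (smooth_on_cst _ oU) => // x _.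
  by rewrite big_nil.
apply: (smooth_on_eq (f := fun x => f i x + \sum_(j <- r) f j x)) => //.
  by move=> x _; rewrite big_cons.
exact: smooth_onD.
Qed.

Lemma smooth_onX U f k : open U -> smooth_on U f -> smooth_on U (fun x => f x ^+ k).
Proof.
move=> oU sf; elim: k => [|k IHk].
  by apply: (smooth_on_eq (f := cst 1)) (smooth_on_cst _ oU) => // x _.
apply: (smooth_on_eq (f := fun x => f x * f x ^+ k)) => //.
  by move=> x _; rewrite exprS.
exact: smooth_onM.
Qed.

Lemma smooth_onV U f : open U -> smooth_on U f -> (forall x, U x -> f x != 0) ->
  smooth_on U (fun x => (f x)^-1).
Proof.
move=> oU sf f0.
have dV x : U x -> is_derive (f x) 1 (fun y : R => y^-1) (- (f x) ^- 2).
  move=> Ux; have := @is_deriveV R id (f x) 1 1 (f0 x Ux) (is_derive_id (f x : R^o) 1).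
  by rewrite [X in is_derive _ _ _ X]mulr1.
elim=> [|m IHm]; first exact: (Cn_on_comp0 (h' := fun y => - y ^- 2) oU dV (sf 0%N)).
apply: (Cn_on_comp1 (h := fun y => y^-1) (h' := fun y => - y ^- 2)) => //.
apply: (Cn_on_eq (f := fun x => -1 * ((f x)^-1 * (f x)^-1))) => //.
  by move=> x Ux /=; rewrite mulN1r expr2 invfM.
by apply: Cn_onM => //; [exact: Cn_on_cst|exact: Cn_onM].
Qed.

Lemma smooth_on_expR U f : open U -> smooth_on U f -> smooth_on U (expR \o f).
Proof.
move=> oU sf.
have d x : U x -> is_derive (f x) 1 expR (expR (f x)) by move=> _; exact: is_derive_expR.
elim=> [|m IHm]; first exact: (Cn_on_comp0 oU d (sf 0%N)).
exact: (Cn_on_comp1 oU d).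
Qed.

Lemma smooth_on_ln U f : open U -> smooth_on U f -> (forall x, U x -> 0 < f x) ->
  smooth_on U (@ln R \o f).
Proof.
move=> oU sf f0.
have d x : U x -> is_derive (f x) 1 (@ln R) (f x)^-1.
  by move=> /f0; exact: is_derive1_ln.
case=> [|m]; first exact: (Cn_on_comp0 (h' := fun y => y^-1) oU d (sf 0%N)).
apply: (Cn_on_comp1 (h' := fun y => y^-1) oU d) => //.
by apply: smooth_onV => // x /f0 /lt0r_neq0.
Qed.

(** The square root of a positive number [t] is [exp (ln t / 2)]. *)
Lemma smooth_on_sqrt U f : open U -> smooth_on U f -> (forall x, U x -> 0 < f x) ->
  smooth_on U (@Num.sqrt R \o f).
Proof.
move=> oU sf f0.
pose g := expR \o (fun x => 2^-1 * (@ln R \o f) x).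
apply: (smooth_on_eq (f := g)) => //.
  move=> x Ux; rewrite /g /=; apply/eqP.
  rewrite -(eqrXn2 (n := 2)) ?expR_ge0 ?sqrtr_ge0 // sqr_sqrtr ?ltW ?f0 //.
  by rewrite -expRM_natl mulrA divff ?mul1r ?lnK ?posrE ?f0 // pnatr_eq0.
apply: smooth_on_expR => //; apply: smooth_onM => //; first exact: smooth_on_cst.
exact: smooth_on_ln.
Qed.

(** Joint induction, as the two functions are each other's derivatives up to sign. *)
Lemma smooth_on_cos_sin U f : open U -> smooth_on U f ->
  smooth_on U (@cos R \o f) /\ smooth_on U (@sin R \o f).
Proof.
move=> oU sf.
have dc x : U x -> is_derive (f x) 1 (@cos R) (- sin (f x)).
  by move=> _; exact: is_derive_cos.
have ds x : U x -> is_derive (f x) 1 (@sin R) (cos (f x)).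
  by move=> _; exact: is_derive_sin.
suff CS m : Cn_on m U (@cos R \o f) /\ Cn_on m U (@sin R \o f).
  by split=> m; have [] := CS m.
elim: m => [|m [IHc IHs]].
  by split; [exact: (Cn_on_comp0 (h' := fun y => - sin y) oU dc (sf 0%N))|
    exact: (Cn_on_comp0 (h' := @cos R) oU ds (sf 0%N))].
split; last exact: (Cn_on_comp1 (h' := @cos R) oU ds).
apply: (Cn_on_comp1 (h' := fun y => - sin y) oU dc) => //.
apply: (Cn_on_eq (f := fun x => -1 * sin (f x))) => //.
  by move=> x _; rewrite mulN1r.
by apply: Cn_onM => //; exact: Cn_on_cst.
Qed.

Lemma smooth_on_cos U f : open U -> smooth_on U f -> smooth_on U (@cos R \o f).
Proof. by move=> oU sf; have [] := smooth_on_cos_sin oU sf. Qed.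

Lemma smooth_on_sin U f : open U -> smooth_on U f -> smooth_on U (@sin R \o f).
Proof. by move=> oU sf; have [] := smooth_on_cos_sin oU sf. Qed.

Lemma is_derive_linear f x v :
  (forall x v (t : R), f (t *: v + x) = t * f v + f x) -> is_derive x v f (f v).
Proof.
move=> lf; apply/is_derive_line.
have -> : (fun t : R => f (t *: v + x)) = ( *%R^~ (f v)) + cst (f x).
  by apply/funext => t; rewrite lf.
have -> : *%R^~ (f v) = f v \*: (id : R -> R^o).
  by apply/funext => t /=; rewrite mulrC.
by apply: is_derive_eq; rewrite addr0 [LHS]mulr1.
Qed.

Lemma smooth_on_linear U f : open U -> continuous f ->
  (forall x v (t : R), f (t *: v + x) = t * f v + f x) -> smooth_on U f.
Proof.
move=> oU cf lf; case=> [|m]; first by split => // x _; exact: cf.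
apply: (@Cn_onS _ _ _ _ _ (fun v => cst (f v))) => //.
- by move=> x _; exact: cf.
- by move=> x v _; exact: is_derive_linear.
- by move=> v; exact: Cn_on_cst.
Qed.

End SmoothFunctions.

Section SmoothComposition.
Variables (R : realType) (p : nat) (V : normedModType R).
Implicit Types (U : set V) (W : set 'rV[R]_p).

Lemma smooth_on_coord W i : open W -> smooth_on W (fun x : 'rV[R]_p => x 0 i).
Proof.
move=> oW; apply: smooth_on_linear => //; first exact: coord_continuous.
by move=> x v t; rewrite !mxE.
Qed.

Lemma is_derive_coord (x v : 'rV[R]_p) i : is_derive x v (fun y => y 0 i) (v 0 i).
Proof. by apply: is_derive_linear => y u t; rewrite !mxE. Qed.

Definition smooth_map U (g : V -> 'rV[R]_p) := forall i, smooth_on U (fun x => g x 0 i).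

Lemma smooth_map_continuous U g x : smooth_map U g -> U x -> {for x, continuous g}.
Proof.
by move=> sg Ux; apply: cvg_rV => i; exact: (smooth_on_continuous (sg i) Ux).
Qed.

Lemma smooth_on_comp_derive U W (f : 'rV[R]_p -> R) (g : V -> 'rV[R]_p) x v :
  open W -> smooth_on W f -> smooth_map U g -> (forall x, U x -> W (g x)) -> U x ->
  is_derive x v (f \o g)
    (\sum_i 'D_v (fun y => g y 0 i) x * 'D_(delta_mx 0 i) f (g x)).
Proof.
move=> oW sf sg gUW Ux; have Wgx := gUW x Ux.
have dg i : is_derive x v (fun y => g y 0 i)
    ((\row_i 'D_v (fun y => g y 0 i) x) 0 i).
  by rewrite mxE; exact: smooth_on_is_derive (sg i) Ux.
have := is_derive_comp_rV oW (sf 1%N) Wgx (smooth_map_continuous sg Ux) dg.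
rewrite (derive_dirE _ oW (sf 1%N) Wgx).
by under eq_bigr do rewrite mxE.
Qed.

(** Induction on the order of differentiability: the derivatives of the composite
    are sums of products of derivatives of [g] with composites of derivatives of [f]. *)
Lemma smooth_on_comp U W (f : 'rV[R]_p -> R) (g : V -> 'rV[R]_p) :
  open U -> open W -> smooth_on W f -> smooth_map U g ->
  (forall x, U x -> W (g x)) -> smooth_on U (f \o g).
Proof.
move=> oU oW sf sg gUW m.
elim: m f sf => [|m IHm] f sf.
  split => // x Ux; apply: continuous_comp; first exact: smooth_map_continuous sg Ux.
  exact: smooth_on_continuous sf (gUW x Ux).
apply: (@Cn_onS _ _ _ _ _ (fun v x =>
  \sum_i 'D_v (fun y => g y 0 i) x * ('D_(delta_mx 0 i) f \o g) x)) => //.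
- move=> x Ux; apply: continuous_comp; first exact: smooth_map_continuous sg Ux.
  exact: smooth_on_continuous sf (gUW x Ux).
- by move=> x v Ux; exact: smooth_on_comp_derive oW sf sg gUW Ux.
move=> v; elim: (index_enum _) => [|i r IHr].
  by apply: (Cn_on_eq (f := cst 0)) (Cn_on_cst _ _ oU) => // x _; rewrite big_nil.
apply: (Cn_on_eq (f := fun x => 'D_v (fun y => g y 0 i) x * ('D_(delta_mx 0 i) f \o g) x
  + \sum_(j <- r) 'D_v (fun y => g y 0 j) x * ('D_(delta_mx 0 j) f \o g) x)) => //.
  by move=> x _; rewrite big_cons.
apply: Cn_onD => //; apply: Cn_onM => //; first exact: (smooth_on_derive v (sg i)).
by apply: IHm; exact: smooth_on_derive.
Qed.

End SmoothComposition.

(** * Integrals depending on a parameter *)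

Section ParametricIntegral.
Variables (R : realType) (V : normedModType R).
Implicit Types (W : set V) (Phi Psi : R -> V -> R) (x y v : V).

Definition avg (phi : R -> R) : R := \int[@lebesgue_measure R]_(s in `[0, 1]) phi s.

Definition jointly_continuous W Phi := forall (s : R) x, 0 <= s <= 1 -> W x ->
  {for (s, x), continuous (fun z : R * V => Phi z.1 z.2)}.

Lemma jointly_continuous_slice W Phi s x : jointly_continuous W Phi ->
  0 <= s <= 1 -> W x -> {for s, continuous (Phi^~ x)}.
Proof.
move=> cPhi s01 Wx.
apply: (@continuous_comp _ _ _ (fun s' : R => (s', x)) (fun z => Phi z.1 z.2)).
  exact: (cvg_pair cvg_id (cvg_cst _)).
exact: cPhi.
Qed.

Lemma jointly_continuous_integrable W Phi x : jointly_continuous W Phi -> W x ->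
  (@lebesgue_measure R).-integrable `[0, 1] (EFin \o Phi^~ x).
Proof.
move=> cPhi Wx; apply: continuous_compact_integrable; first exact: segment_compact.
apply: continuous_in_subspaceT => s /[!inE] /= /[!in_itv] /= s01.
exact: jointly_continuous_slice cPhi s01 Wx.
Qed.

(** The compactness of the unit interval makes the continuity at [x] uniform in the
    parameter. *)
Lemma jointly_continuous_near W Phi x e : jointly_continuous W Phi -> W x ->
  0 < e -> \forall y \near x, forall s : R, 0 <= s <= 1 -> `|Phi s x - Phi s y| < e.
Proof.
move=> cPhi Wx e0.
have /compact_near_coveringP cov := @segment_compact R 0 1.
have e20 : 0 < e / 2 by rewrite divr_gt0.
have : \forall y \near x, `[0, 1]%classic `<=` (fun s => `|Phi s x - Phi s y| < e).
  apply: (cov V (nbhs x) (fun y s => `|Phi s x - Phi s y| < e)) => s /= /[!in_itv] /= s01.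
  have cs := jointly_continuous_slice cPhi s01 Wx.
  move/cvgrPdist_lt : (cPhi s x s01 Wx) => /(_ _ e20) /= n1.
  move/cvgrPdist_lt : cs => /(_ _ e20) /= n2.
  near=> z; rewrite -(subrK (Phi s x) (Phi z.1 x)) -addrA.
  rewrite (le_lt_trans (ler_normD _ _)) // [e]splitr ltrD //.
    by rewrite distrC; near: z; exact: cvg_fst n2.
  by near: z; exact: n1.
by apply: filterS => y ys s s01; apply: ys; rewrite /= in_itv.
Unshelve. all: by end_near. Qed.

(** A bound on the compact slice over [x] extends to nearby slices by the uniform
    continuity above; it serves as the dominating function in [is_derive_avg]. *)
Lemma jointly_continuous_bound W Phi x : jointly_continuous W Phi -> W x ->
  exists2 M, 0 <= M &
    \forall y \near x, forall s : R, 0 <= s <= 1 -> `|Phi s y| <= M.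
Proof.
move=> cPhi Wx.
have /compact_near_coveringP cov := @segment_compact R 0 1.
have : \forall M \near +oo, `[0, 1]%classic `<=` (fun s => `|Phi s x| <= M).
  apply: (cov R +oo (fun M s => `|Phi s x| <= M)) => s /= /[!in_itv] /= s01.
  have cs := jointly_continuous_slice cPhi s01 Wx.
  move/cvgrPdist_lt : cs => /(_ _ ltr01) /= n2.
  near=> z.
  have z1 : `|Phi s x - Phi z.1 x| < 1 by near: z; exact: cvg_fst n2.
  have z2 : `|Phi s x| + 1 <= z.2.
    by near: z; exact: cvg_snd (nbhs_pinfty_ge (num_real _)).
  apply: le_trans z2; rewrite -(subrK (Phi s x) (Phi z.1 x)) addrC.
  by rewrite (le_trans (ler_normD _ _)) // lerD2l distrC ltW.
move=> /(filterI (nbhs_pinfty_ge (num_real (0 : R)))) /filter_ex[M [M0 MP]].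
exists (M + 1); first exact: addr_ge0.
apply: filterS (jointly_continuous_near cPhi Wx ltr01) => y yP s s01.
rewrite -(subrK (Phi s x) (Phi s y)) addrC.
rewrite (le_trans (ler_normD _ _)) // lerD ?MP ?ltW //=; last by rewrite distrC yP.
Unshelve. all: by end_near. Qed.

Lemma avg_cst (c : R) : avg (cst c) = c.
Proof.
rewrite /avg Rintegral_cst //.
have E : (@lebesgue_measure R) [set` `[(0:R), 1]%R] = 1%:E.
  by rewrite lebesgue_measure_itv /= lte_fin ltr01 sube0.
transitivity (c * fine (1%:E : \bar R)); last by rewrite mulr1.
by congr (c * fine _); exact: E.
Qed.

Lemma avg_continuous W Phi x : open W -> jointly_continuous W Phi -> W x ->
  {for x, continuous (fun y => avg (Phi^~ y))}.
Proof.
move=> oW cPhi Wx; apply/cvgrPdist_le => e e0; near=> y.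
have Wy : W y by near: y; exact: open_nbhs_nbhs.
have iPhi z : W z -> _ := @jointly_continuous_integrable W Phi z cPhi.
rewrite /avg -RintegralB //; [|exact: iPhi..].
have mI : measurable (`[0, 1]%classic : set R) by [].
have iB : (@lebesgue_measure R).-integrable `[0, 1] (EFin \o (fun s => Phi s x - Phi s y)).
  have -> : EFin \o (fun s => Phi s x - Phi s y) =
    ((EFin \o Phi^~ x) \- (EFin \o Phi^~ y))%E by apply/funext => s /=; rewrite EFinB.
  by apply: integrableB => //; exact: iPhi.
apply: le_trans.
  by apply: le_normr_Rintegral.
rewrite -[leRHS](avg_cst e) /avg; apply: le_Rintegral => //.
- exact: (integrable_norm iB).
- by apply: (@jointly_continuous_integrable setT (fun _ _ => e) x) => // s z _ _; exact: cst_continuous.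
- move=> s /= /[!in_itv] /= s01; apply/ltW; move: s s01.
  by near: y; exact: jointly_continuous_near cPhi Wx e0.
Unshelve. all: by end_near. Qed.

(** Differentiation under the integral sign, where the derivative is dominated by a
    local bound that is uniform in the parameter. *)
Lemma is_derive_avg W Phi Psi v x : open W ->
  jointly_continuous W Phi -> jointly_continuous W Psi ->
  (forall s y, 0 <= s <= 1 -> W y -> is_derive y v (Phi s) (Psi s y)) ->
  W x -> is_derive x v (fun y => avg (Phi^~ y)) (avg (Psi^~ x)).
Proof.
move=> oW cPhi cPsi dPhi Wx.
have [M M0 Mb] := jointly_continuous_bound cPsi Wx.
have cline : (fun h : R => h *: v + x) @ 0 --> x.
  rewrite -[x in _ --> x]add0r; apply: cvgD; last exact: cvg_cst.
  by rewrite -(scale0r v); exact: cvgZr_tmp.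
have : \forall h \near (0 : R), W (h *: v + x) /\
    forall s : R, 0 <= s <= 1 -> `|Psi s (h *: v + x)| <= M.
  apply: (cline (fun y => W y /\ forall s : R, 0 <= s <= 1 -> `|Psi s y| <= M)).
  by apply: filterI Mb; exact: open_nbhs_nbhs.
move=> /nbhs_ballP[d /= d0 dP].
have dI h : `]-d, d[%classic h -> ball (0 : R) d h.
  by rewrite /= in_itv -ball_normE /= sub0r normrN ltr_norml.
pose F h s := Phi s (h *: v + x).
have I0 : `]-d, d[%classic (0 : R) by rewrite /= in_itv /= oppr_lt0 d0.
have dF h s : `]-d, d[%classic h -> `[0, 1]%classic s -> is_derive h 1 (F^~ s) (Psi s (h *: v + x)).
  move=> /dI /dP[Wh _] /= /[!in_itv] /= s01.
  have := dPhi s _ s01 Wh => /is_derive_line D; apply/is_derive_line.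
  rewrite /F; congr (is_derive _ _ _ _): D; apply/funext => t.
  by rewrite scalerDl -addrA [_%:A]mulr1.
have mI : measurable (`[0, 1]%classic : set R) by [].
have intF h : `]-d, d[%classic h -> (@lebesgue_measure R).-integrable `[0, 1] (EFin \o F h).
  by move=> /dI /dP[Wh _]; exact: (jointly_continuous_integrable cPhi Wh).
have derF h s : `]-d, d[%classic h -> `[0, 1]%classic s -> derivable (F^~ s) h 1.
  by move=> h1 s1; have [] := dF h s h1 s1.
have G_ub h s : `]-d, d[%classic h -> `[0, 1]%classic s -> `|partial1of2 F h s| <= M.
  move=> h1 s1; rewrite partial1of2E; have [_ ->] := dF h s h1 s1.
  by have [_] := dP _ (dI _ h1); apply; move: s1; rewrite /= in_itv.
have intM : (@lebesgue_measure R).-integrable `[0, 1] (EFin \o cst M).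
  by apply: (@jointly_continuous_integrable setT (fun _ _ => M) x) => // s y _ _; exact: cst_continuous.
apply/is_derive_line; apply: DeriveDef.
  by apply: (@derivable_under_integral R _ _ (@lebesgue_measure R) F `[0, 1] _ 0 (- d) d _ _ _ (cst M)).
have := @differentiation_under_integral R _ _ (@lebesgue_measure R) F `[0, 1] _ 0 (- d) d _ _ _ (cst M) _ _ _.
rewrite derive1E => -> //; rewrite /avg; apply: eq_Rintegral => s /[!inE] s01.
rewrite partial1of2E; have [|_ ->] := dF 0 s I0; first by [].
by rewrite scale0r add0r.
Qed.

End ParametricIntegral.

(** * Hadamard's lemma *)

Lemma slide_continuous (R : realType) (V : normedModType R) (th : V -> R)
    (e : V) (s : R) x :
  {for x, continuous th} -> {for x, continuous (fun y => y - (s * th y) *: e)}.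
Proof.
by move=> cth; apply: cvgB => //; apply: cvgZr_tmp; apply: cvgM => //; exact: cvg_cst.
Qed.

Lemma scale_cvg0 (R : realType) (V : normedModType R) (th : V -> R) (e : V) x :
  {for x, continuous th} -> th x = 0 -> (fun y => - th y *: e) @ x --> (0 : V).
Proof.
move=> cth th0; rewrite -(scale0r e) -oppr0 -{1}th0; apply: cvgZr_tmp.
exact: cvgN.
Qed.

Lemma slide_open (R : realType) (V : normedModType R) (th : V -> R) (e : V) U x :
  open U -> U x -> {for x, continuous th} -> th x = 0 ->
  exists W, [/\ open W, W x &
    forall y, W y -> U y /\ forall s : R, 0 <= s <= 1 -> U (y - (s * th y) *: e)].
Proof.
move=> oU Ux cth th0; apply: near_open.
have segU := segment_near oU Ux (b := id) cvg_id (scale_cvg0 e cth th0).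
near=> y; split; first by near: y; exact: open_nbhs_nbhs.
have segy : forall s : R, 0 <= s <= 1 -> U (s *: (- th y *: e) + y).
  by near: y; exact: segU.
move=> s /segy.
by rewrite scalerA mulrN scaleNr addrC.
Unshelve. all: by end_near. Qed.

Section DividedDifference.
Variables (R : realType) (p : nat).
Local Notation V := 'rV[R]_p.
Implicit Types (U W : set V) (F g th : V -> R) (e v x : V).

(** The segment swept when [th x] is removed along [e]. With [e] a root [a] and
    [th = 2 <a, .> / <a, a>] it ends at the reflected point; with [e] the time axis
    and a suitable [th] it ends on the cone. *)
Definition slide th e (s : R) x : V := x - (s * th x) *: e.

(** The value at the zeros of [th] is the limit of the quotient, so that the result
    is smooth across them. *)
Definition divided_difference th e F x : R :=
  if th x == 0 then 'D_e F x else (F x - F (slide th e 1 x)) / th x.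

Lemma derive_dirB U g v e (c : R) x : open U -> smooth_on U g -> U x ->
  'D_(v - c *: e) g x = 'D_v g x - c * 'D_e g x.
Proof.
move=> oU sg Ux; rewrite !(derive_dirE _ oU (sg 1%N) Ux).
rewrite mulr_sumr -sumrB; apply: eq_bigr => i _.
by rewrite !mxE mulrBl mulrA.
Qed.

Section Slide.
Variables (U W : set V) (th : V -> R) (e : V).
Hypotheses (oU : open U) (oW : open W) (sth : smooth_on W th)
  (slideU : forall s x, 0 <= s <= 1 -> W x -> U (slide th e s x)).

Let mom i g s x : R := s ^+ i * g (slide th e s x).

Let mom_continuous i g : smooth_on U g -> jointly_continuous W (mom i g).
Proof.
move=> sg s x s01 Wx.
have cs : {for (s, x), continuous (fun z : R * V => z.1)} by exact: cvg_fst.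
have cx : {for (s, x), continuous (fun z : R * V => z.2)} by exact: cvg_snd.
apply: (@for_continuousM R (R * V)%type (fun z => z.1 ^+ i)
   (fun z => g (slide th e z.1 z.2))).
  apply: (@continuous_comp _ _ _ (fun z : R * V => z.1) (fun y : R => y ^+ i)) => //.
  exact: exprn_continuous.
apply: (@continuous_comp _ _ _ (fun z : R * V => slide th e z.1 z.2) g).
  apply: cvgB => //; apply: cvgZr_tmp; apply: cvgM => //.
  apply: (@continuous_comp _ _ _ (fun z : R * V => z.2) th) => //.
  exact: smooth_on_continuous sth Wx.
exact: smooth_on_continuous sg (slideU s01 Wx).
Qed.

Let is_derive_mom i g s x v : smooth_on U g -> 0 <= s <= 1 -> W x ->
  is_derive x v (mom i g s)
    (mom i ('D_v g) s x - 'D_v th x * mom i.+1 ('D_e g) s x).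
Proof.
move=> sg s01 Wx.
have Ux := slideU s01 Wx.
have dth := smooth_on_is_derive v sth Wx.
pose dg := v - (s * 'D_v th x) *: e.
have dslide j : is_derive x v (fun y => slide th e s y 0 j) (dg 0 j).
  have := is_deriveB (is_derive_coord x v j) (is_deriveZ (s * e 0 j) dth).
  congr (is_derive _ _ _ _).
    by apply/funext => y; rewrite /slide !mxE /= /GRing.scale /= mulrAC.
  by rewrite !mxE /= /GRing.scale /= mulrAC.
have cslide : {for x, continuous (slide th e s)}.
  exact: slide_continuous (smooth_on_continuous sth Wx).
have := is_deriveZ (s ^+ i) (is_derive_comp_rV oU (sg 1%N) Ux cslide dslide).
rewrite (derive_dirB v e _ oU sg Ux) /mom => D.
have E : (s ^+ i \*: (g \o slide th e s)) = (fun y => s ^+ i * g (slide th e s y)) by [].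
rewrite -E; apply: is_derive_eq D _.
rewrite /GRing.scale /= exprS; ring.
Qed.

(** Each derivative of [slide th e s] brings out a factor [s]; with the weights
    [s ^+ i] the family of these averages is stable under differentiation. *)
Lemma smooth_on_avg_slide i g : smooth_on U g ->
  smooth_on W (fun x => avg (fun s => s ^+ i * g (slide th e s x))).
Proof.
move=> sg m; elim: m i g sg => [|m IHm] i g sg.
  by split=> // x Wx; have := avg_continuous oW (@mom_continuous i _ sg) Wx.
have sD v : smooth_on U ('D_v g) by exact: smooth_on_derive.
pose psi v s x := mom i ('D_v g) s x - 'D_v th x * mom i.+1 ('D_e g) s x.
have cpsi v : jointly_continuous W (psi v).
  move=> s x s01 Wx.
  apply: (@for_continuousD R (R * V)%type (fun z => mom i ('D_v g) z.1 z.2)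
     (fun z => - ('D_v th z.2 * mom i.+1 ('D_e g) z.1 z.2))).
    exact: (@mom_continuous i _ (sD v) _ _ s01 Wx).
  apply: cvgN; apply: (@for_continuousM R (R * V)%type (fun z => 'D_v th z.2)
    (fun z => mom i.+1 ('D_e g) z.1 z.2)); last exact: (@mom_continuous i.+1 _ (sD e) _ _ s01 Wx).
  apply: (@continuous_comp _ _ _ (fun z : R * V => z.2) ('D_v th)); first exact: cvg_snd.
  exact: smooth_on_continuous (smooth_on_derive v sth) Wx.
apply: (@Cn_onS _ _ _ _ _ (fun v x => avg (psi v ^~ x))) => //.
- by move=> x Wx; have := avg_continuous oW (@mom_continuous i _ sg) Wx.
- move=> x v Wx; apply: (is_derive_avg oW (@mom_continuous i _ sg) (cpsi v)) => //.
  by move=> s y s01 Wy; exact: is_derive_mom.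
move=> v; apply: (Cn_on_eq (f := fun x => avg (mom i ('D_v g) ^~ x) +
    - 'D_v th x * avg (mom i.+1 ('D_e g) ^~ x))) => //.
  move=> x Wx; rewrite mulNr /avg -RintegralZl //; last first.
    exact: (jointly_continuous_integrable (@mom_continuous i.+1 _ (sD e)) Wx).
  rewrite -RintegralB //.
    exact: (jointly_continuous_integrable (@mom_continuous i _ (sD v)) Wx).
  have := @jointly_continuous_integrable R V W
    (fun s x => 'D_v th x * mom i.+1 ('D_e g) s x) x.
  apply=> // s y s01 Wy.
  apply: (@for_continuousM R (R * V)%type (fun z => 'D_v th z.2)
    (fun z => mom i.+1 ('D_e g) z.1 z.2)); last exact: (@mom_continuous i.+1 _ (sD e) _ _ s01 Wy).
  apply: (@continuous_comp _ _ _ (fun z : R * V => z.2) ('D_v th)); first exact: cvg_snd.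
  exact: smooth_on_continuous (smooth_on_derive v sth) Wy.
apply: Cn_onD => //; first exact: IHm.
apply: Cn_onM => //; last exact: IHm.
exact: (smooth_onN oW (smooth_on_derive v sth)).
Qed.

(** Hadamard's lemma: by the fundamental theorem of calculus the divided difference
    is the mean of the derivative over the segment swept by [slide]. *)
Lemma divided_differenceE g x : smooth_on U g -> W x ->
  divided_difference th e g x = avg (fun s => 'D_e g (slide th e s x)).
Proof.
move=> sg Wx; rewrite /divided_difference.
have s0 : slide th e 0 x = x by rewrite /slide mul0r scale0r subr0.
have [th0|th0] := eqVneq (th x) 0.
  rewrite -[LHS]avg_cst /avg; apply: eq_Rintegral => s _.
  by rewrite /slide th0 mulr0 scale0r subr0.
pose G (s : R) := - (th x)^-1 * g (slide th e s x).
have dG (s : R) : 0 <= s <= 1 -> is_derive s 1 G ('D_e g (slide th e s x)).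
  move=> s01; have := smooth_on_is_derive e sg (slideU s01 Wx).
  move=> /(is_deriveZ_dir (- th x)) /is_derive_line D.
  apply/is_derive_line.
  have -> : (fun t : R => G (t *: (1 : R) + s)) = - (th x)^-1 \*:
      (fun t => g (t *: (- th x *: e) + slide th e s x)).
    apply/funext => t; rewrite /G /slide /= [_%:A]mulr1; congr (_ * g _).
    rewrite scalerA mulrN scaleNr mulrDl scalerDl opprD addrA [in RHS]addrA.
    by congr (_ - _); exact: addrC.
  have := is_deriveZ (- (th x)^-1) D.
  congr (is_derive _ _ _ _).
  by rewrite /GRing.scale /= mulrA mulNr mulrN opprK mulVf // mul1r.
have c01 : {within `[(0 : R), 1], continuous (fun s => 'D_e g (slide th e s x))}.
  apply: continuous_in_subspaceT => s /[!inE] /= /[!in_itv] /= s01.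
  have := jointly_continuous_slice (@mom_continuous 0 _ (smooth_on_derive e sg)) s01 Wx.
  congr (continuous_at _ _).
  by apply/funext => t; rewrite /mom expr0 mul1r.
have cG (s : R) : 0 <= s <= 1 -> {for s, continuous G}.
  move=> s01; apply/differentiable_continuous/derivable1_diffP.
  by have [] := dG s s01.
rewrite /avg /Rintegral (continuous_FTC2 (F := G)) //.
- rewrite /= /G s0 !mulNr opprK addrC -mulrBr mulrC; congr (_ * _).
- split.
  + move=> s /[!in_itv] /= /andP[s0' s1]; have [|//] := dG s.
    by rewrite !ltW.
  + by apply: cvg_at_right_filter; apply: cG; rewrite lexx ler01.
  + by apply: cvg_at_left_filter; apply: cG; rewrite lexx ler01.
- move=> s /[!in_itv] /= /andP[s0' s1]; rewrite derive1E.
  by have [|_ ->] := dG s; first by rewrite !ltW.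
Qed.

End Slide.

(** Away from the zeros of [th] this is a quotient of smooth functions. Near a zero
    the whole swept segment lies in [U], and [divided_differenceE] applies. *)
Lemma smooth_on_divided_difference U th e F : open U ->
  smooth_on U F -> smooth_on U th ->
  smooth_on [set x | U x /\ U (slide th e 1 x)] (divided_difference th e F).
Proof.
move=> oU sF sth; apply: smooth_on_local => x0 [Ux0 Usx0].
have cslide x : U x -> {for x, continuous (slide th e 1)}.
  by move=> Ux; exact: slide_continuous (smooth_on_continuous sth Ux).
have [th0|th0] := eqVneq (th x0) 0; last first.
  have : \forall x \near x0, [/\ U x, U (slide th e 1 x) & th x != 0].
    near=> x; split.
    - by near: x; exact: open_nbhs_nbhs.
    - near: x; apply: (cslide x0 Ux0 U); exact: open_nbhs_nbhs.
    - by near: x; exact: (cvgr_neq0 _ (smooth_on_continuous sth Ux0)).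
  move=> /near_open[W [oW Wx0 WP]]; exists W; split => //.
  have WU : W `<=` U by move=> x /WP[].
  apply: (smooth_on_eq (f := fun x => (F x - F (slide th e 1 x)) * (th x)^-1)) => //.
    by move=> x /WP[_ _ /negbTE th0']; rewrite /divided_difference th0'.
  apply: smooth_onM => //; last first.
    by apply: smooth_onV => //; [exact: smooth_on_sub sth|move=> x /WP[]].
  apply: smooth_onB => //; first exact: smooth_on_sub sF.
  apply: (smooth_on_comp oW oU sF); last by move=> x /WP[].
  move=> i; apply: (smooth_on_eq (f := fun x => x 0 i - th x * e 0 i)) => //.
    by move=> x _; rewrite /slide !mxE mul1r.
  apply: smooth_onB => //; first exact: smooth_on_coord.
  by apply: smooth_onM => //; [exact: smooth_on_sub sth|exact: smooth_on_cst].
have [W [oW Wx0 WP]] := slide_open e oU Ux0 (smooth_on_continuous sth Ux0) th0.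
have WU : W `<=` U by move=> x /WP[].
have sU (s : R) x : 0 <= s <= 1 -> W x -> U (slide th e s x).
  by move=> s01 /WP[_]; exact.
exists W; split => //; have sthW := smooth_on_sub WU sth.
have := smooth_on_avg_slide oU oW sthW sU 0 (smooth_on_derive e sF).
apply: smooth_on_eq => // x Wx.
rewrite (divided_differenceE sthW sU sF Wx); congr avg.
by apply/funext => s; rewrite expr0 mul1r.
Unshelve. all: by end_near. Qed.

End DividedDifference.

(** * Complex-valued functions *)

Section ComplexParts.
Variable R : realType.
Implicit Types z w : R[i].

Lemma ReD z w : complex.Re (z + w) = complex.Re z + complex.Re w.
Proof. by case: z; case: w. Qed.
Lemma ImD z w : complex.Im (z + w) = complex.Im z + complex.Im w.
Proof. by case: z; case: w. Qed.
Lemma ReM z w :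
  complex.Re (z * w) = complex.Re z * complex.Re w - complex.Im z * complex.Im w.
Proof. by case: z; case: w. Qed.
Lemma ImM z w :
  complex.Im (z * w) = complex.Re z * complex.Im w + complex.Im z * complex.Re w.
Proof. by case: z; case: w. Qed.
Lemma complexE z w : complex.Re z = complex.Re w -> complex.Im z = complex.Im w -> z = w.
Proof. by case: z; case: w => a b c d /= -> ->. Qed.

End ComplexParts.

Section ComplexCalculus.
Variables (R : realType) (V : normedModType R).
Implicit Types (U W : set V) (F G : V -> R[i]) (f : V -> R) (x v : V).

Lemma csmooth_on_eq U F G : open U -> (forall x, U x -> F x = G x) ->
  csmooth_on U F -> csmooth_on U G.
Proof.
move=> oU FG [sr si]; split.
  by apply: smooth_on_eq sr => // x Ux; rewrite FG.
by apply: smooth_on_eq si => // x Ux; rewrite FG.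
Qed.

Lemma csmooth_on_sub U W F : W `<=` U -> csmooth_on U F -> csmooth_on W F.
Proof. by move=> WU [sr si]; split; exact: smooth_on_sub WU _. Qed.

Lemma csmooth_on_local U F :
  (forall x, U x -> exists W, [/\ open W, W x & csmooth_on W F]) -> csmooth_on U F.
Proof.
move=> loc; split; apply: smooth_on_local => x /loc[W [oW Wx [sr si]]];
  by exists W.
Qed.

Lemma csmooth_on_real U f : open U -> smooth_on U f -> csmooth_on U (fun x => (f x)%:C).
Proof. by move=> oU sf; split => //=; exact: smooth_on_cst. Qed.

Lemma csmooth_on_cst U (c : R[i]) : open U -> csmooth_on U (fun=> c).
Proof. by move=> oU; split; exact: smooth_on_cst. Qed.

Lemma csmooth_onD U F G : open U -> csmooth_on U F -> csmooth_on U G ->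
  csmooth_on U (fun x => F x + G x).
Proof.
move=> oU [sr si] [tr ti]; split.
  apply: (smooth_on_eq (f := fun x => complex.Re (F x) + complex.Re (G x))) => //.
    by move=> x _; rewrite ReD.
  exact: smooth_onD.
apply: (smooth_on_eq (f := fun x => complex.Im (F x) + complex.Im (G x))) => //.
  by move=> x _; rewrite ImD.
exact: smooth_onD.
Qed.

Lemma csmooth_onM U F G : open U -> csmooth_on U F -> csmooth_on U G ->
  csmooth_on U (fun x => F x * G x).
Proof.
move=> oU [sr si] [tr ti]; split.
  apply: (smooth_on_eq (f := fun x => complex.Re (F x) * complex.Re (G x) -
     complex.Im (F x) * complex.Im (G x))) => //.
    by move=> x _; rewrite ReM.
  by apply: smooth_onB => //; exact: smooth_onM.
apply: (smooth_on_eq (f := fun x => complex.Re (F x) * complex.Im (G x) +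
   complex.Im (F x) * complex.Re (G x))) => //.
  by move=> x _; rewrite ImM.
by apply: smooth_onD => //; exact: smooth_onM.
Qed.

Lemma csmooth_onX U F m : open U -> csmooth_on U F -> csmooth_on U (fun x => F x ^+ m).
Proof.
move=> oU sF; elim: m => [|m IHm]; first exact: csmooth_on_cst.
apply: (csmooth_on_eq (F := fun x => F x * F x ^+ m)) => //; last exact: csmooth_onM.
by move=> x _; rewrite exprS.
Qed.

Lemma csmooth_onN U F : open U -> csmooth_on U F -> csmooth_on U (fun x => - F x).
Proof.
move=> oU sF; apply: (csmooth_on_eq (F := fun x => -1 * F x)) => //.
  by move=> x _; rewrite mulN1r.
by apply: csmooth_onM => //; exact: csmooth_on_cst.
Qed.

Lemma csmooth_onB U F G : open U -> csmooth_on U F -> csmooth_on U G ->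
  csmooth_on U (fun x => F x - G x).
Proof. by move=> oU sF sG; apply: csmooth_onD => //; exact: csmooth_onN. Qed.

Lemma csmooth_on_sum U (I : Type) (r : seq I) (F : I -> V -> R[i]) : open U ->
  (forall i, csmooth_on U (F i)) -> csmooth_on U (fun x => \sum_(i <- r) F i x).
Proof.
move=> oU sF; elim: r => [|i r IHr].
  apply: (csmooth_on_eq (F := fun=> 0)) (csmooth_on_cst _ oU) => // x _.
  by rewrite big_nil.
apply: (csmooth_on_eq (F := fun x => F i x + \sum_(j <- r) F j x)) => //.
  by move=> x _; rewrite big_cons.
exact: csmooth_onD.
Qed.

Lemma csmooth_on_derive U F v : csmooth_on U F -> csmooth_on U (cderive v F).
Proof. by move=> [sr si]; split; exact: smooth_on_derive. Qed.

Lemma cderive_eq U F G x v : open U -> U x -> (forall y, U y -> F y = G y) ->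
  cderive v F x = cderive v G x.
Proof.
move=> oU Ux FG; congr (_ +i* _).
  by apply: (eq_on_derive v oU Ux) => y Uy; rewrite FG.
by apply: (eq_on_derive v oU Ux) => y Uy; rewrite FG.
Qed.

Lemma cderive_cst (c : R[i]) v x : cderive v (fun=> c) x = 0.
Proof. by rewrite /cderive !derive_cst. Qed.

Lemma cderive_real f v x : cderive v (fun y => (f y)%:C) x = ('D_v f x)%:C.
Proof. by rewrite /cderive /= derive_cst. Qed.

Lemma cderiveD U F G v x : csmooth_on U F -> csmooth_on U G -> U x ->
  cderive v (fun y => F y + G y) x = cderive v F x + cderive v G x.
Proof.
move=> [sr si] [tr ti] Ux; congr (_ +i* _).
  have [_ <-] := is_deriveD (smooth_on_is_derive v sr Ux) (smooth_on_is_derive v tr Ux).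
  suff -> : (fun y => complex.Re (F y + G y)) =
    (fun y => complex.Re (F y)) + (fun y => complex.Re (G y)) by [].
  by apply/funext => y; rewrite ReD.
have [_ <-] := is_deriveD (smooth_on_is_derive v si Ux) (smooth_on_is_derive v ti Ux).
suff -> : (fun y => complex.Im (F y + G y)) =
  (fun y => complex.Im (F y)) + (fun y => complex.Im (G y)) by [].
by apply/funext => y; rewrite ImD.
Qed.

Lemma cderiveM U F G v x : csmooth_on U F -> csmooth_on U G -> U x ->
  cderive v (fun y => F y * G y) x = cderive v F x * G x + F x * cderive v G x.
Proof.
move=> [sr si] [tr ti] Ux; apply: complexE.
  have M1 := is_deriveM (smooth_on_is_derive v sr Ux) (smooth_on_is_derive v tr Ux).
  have M2 := is_deriveM (smooth_on_is_derive v si Ux) (smooth_on_is_derive v ti Ux).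
  have [_ D] := is_deriveB M1 M2.
  have E : (fun y => complex.Re (F y * G y)) =
      (fun y => complex.Re (F y)) * (fun y => complex.Re (G y)) -
      (fun y => complex.Im (F y)) * (fun y => complex.Im (G y)).
    by apply/funext => y; rewrite ReM.
  by rewrite {1}/cderive /= E D ReD !ReM /cderive /= /GRing.scale /=; ring.
have M1 := is_deriveM (smooth_on_is_derive v sr Ux) (smooth_on_is_derive v ti Ux).
have M2 := is_deriveM (smooth_on_is_derive v si Ux) (smooth_on_is_derive v tr Ux).
have [_ D] := is_deriveD M1 M2.
have E : (fun y => complex.Im (F y * G y)) =
    (fun y => complex.Re (F y)) * (fun y => complex.Im (G y)) +
    (fun y => complex.Im (F y)) * (fun y => complex.Re (G y)).
  by apply/funext => y; rewrite ImM.
by rewrite {1}/cderive /= E D ImD !ImM /cderive /= /GRing.scale /=; ring.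
Qed.

Lemma cderiveZ U (c : R[i]) F v x : open U -> csmooth_on U F -> U x ->
  cderive v (fun y => c * F y) x = c * cderive v F x.
Proof.
move=> oU sF Ux; rewrite (cderiveM v (csmooth_on_cst c oU) sF Ux).
by rewrite cderive_cst mul0r add0r.
Qed.

Lemma cderive_sum U (I : Type) (r : seq I) (F : I -> V -> R[i]) v x : open U ->
  (forall i, csmooth_on U (F i)) -> U x ->
  cderive v (fun y => \sum_(i <- r) F i y) x = \sum_(i <- r) cderive v (F i) x.
Proof.
move=> oU sF Ux; elim: r => [|i r IHr].
  rewrite big_nil -[RHS](cderive_cst 0 v x); congr (cderive v _ x).
  by apply/funext => y; rewrite big_nil.
rewrite big_cons -IHr -(cderiveD v (sF i) (csmooth_on_sum r oU sF) Ux).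
by congr (cderive v _ x); apply/funext => y; rewrite big_cons.
Qed.

Lemma cderive_linear_comp (V' : normedModType R) F (L : V' -> V) (v x : V') :
  (forall t : R, L (t *: v + x) = t *: L v + L x) ->
  cderive v (F \o L) x = cderive (L v) F (L x).
Proof.
move=> lL; congr (_ +i* _); rewrite derive_line [RHS]derive_line.
  have -> : (fun t : R => complex.Re ((F \o L) (t *: v + x))) =
      (fun t : R => complex.Re (F (t *: L v + L x))) by apply/funext => t /=; rewrite lL.
  by [].
have -> : (fun t : R => complex.Im ((F \o L) (t *: v + x))) =
    (fun t : R => complex.Im (F (t *: L v + L x))) by apply/funext => t /=; rewrite lL.
by [].
Qed.

End ComplexCalculus.

Section ComplexCalculusRow.
Variables (R : realType) (p : nat) (V : normedModType R).
Implicit Types (U : set V) (W : set 'rV[R]_p) (F : 'rV[R]_p -> R[i]).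

Lemma cderive_dirE W F v x : open W -> csmooth_on W F -> W x ->
  cderive v F x = \sum_i (v 0 i)%:C * cderive (delta_mx 0 i) F x.
Proof.
move=> oW [sr si] Wx; rewrite {1}/cderive.
rewrite (derive_dirE v oW (sr 1%N) Wx) (derive_dirE v oW (si 1%N) Wx).
elim: (index_enum _) => [|i r IHr]; first by rewrite !big_nil.
by rewrite !big_cons -IHr; apply: complexE;
  rewrite ?ReD ?ImD ?ReM ?ImM /= mul0r ?subr0 ?addr0.
Qed.

Lemma cderive_comp U W F (g : V -> 'rV[R]_p) x v :
  open W -> csmooth_on W F -> smooth_map U g -> (forall x, U x -> W (g x)) -> U x ->
  cderive v (F \o g) x =
    \sum_i ('D_v (fun y => g y 0 i) x)%:C * cderive (delta_mx 0 i) F (g x).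
Proof.
move=> oW [sr si] sg gW Ux; rewrite {1}/cderive.
have [_ ->] := smooth_on_comp_derive v oW sr sg gW Ux.
have [_ ->] := smooth_on_comp_derive v oW si sg gW Ux.
elim: (index_enum _) => [|i r IHr]; first by rewrite !big_nil.
by rewrite !big_cons -IHr; apply: complexE;
  rewrite ?ReD ?ImD ?ReM ?ImM /= mul0r ?subr0 ?addr0.
Qed.

Lemma csmooth_on_comp U W F (g : V -> 'rV[R]_p) :
  open U -> open W -> csmooth_on W F -> smooth_map U g ->
  (forall x, U x -> W (g x)) -> csmooth_on U (F \o g).
Proof.
move=> oU oW [sr si] sg gW; split.
  exact: (smooth_on_comp oU oW sr sg gW).
exact: (smooth_on_comp oU oW si sg gW).
Qed.

End ComplexCalculusRow.

(** * Complex powers and homogeneity *)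

Section ComplexPower.
Variable R : realType.
Implicit Types (l m : R) (w z : R[i]).

Lemma cpowE l w : 0 < l -> cpow l w =
  (expR (complex.Re w * ln l) * cos (complex.Im w * ln l)) +i*
  (expR (complex.Re w * ln l) * sin (complex.Im w * ln l)).
Proof. by move=> l0; rewrite /cpow /powR gt_eqF. Qed.

Lemma cpowD l w z : 0 < l -> cpow l (w + z) = cpow l w * cpow l z.
Proof.
move=> l0; rewrite !cpowE // ReD ImD !mulrDl expRD cosD sinD.
by apply: complexE; rewrite ?ReM ?ImM /=; ring.
Qed.

Lemma cpowMl l m w : 0 < l -> 0 < m -> cpow (l * m) w = cpow l w * cpow m w.
Proof.
move=> l0 m0; rewrite !cpowE ?mulr_gt0 // lnM ?posrE // !mulrDr expRD cosD sinD.
by apply: complexE; rewrite ?ReM ?ImM /=; ring.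
Qed.

Lemma cpow0 l : 0 < l -> cpow l 0 = 1.
Proof. by move=> l0; rewrite cpowE // !mul0r expR0 cos0 sin0 mulr1 mulr0. Qed.

Lemma cpow1 l : 0 < l -> cpow l 1 = l%:C.
Proof.
by move=> l0; rewrite cpowE // mul1r mul0r cos0 sin0 mulr1 mulr0 lnK.
Qed.

Lemma cpow1l w : cpow (1 : R) w = 1.
Proof. by rewrite cpowE // ln1 !mulr0 expR0 cos0 sin0 mulr1 mulr0. Qed.

Lemma cpow_nat l k : 0 < l -> cpow l k%:R = (l ^+ k)%:C.
Proof.
move=> l0; elim: k => [|k IHk]; first by rewrite cpow0.
by rewrite -addn1 natrD cpowD // IHk cpow1 // exprD expr1 rmorphM.
Qed.

Lemma cpow_neq0 l w : 0 < l -> cpow l w != 0.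
Proof.
move=> l0; apply/eqP => z0.
have : cpow l (w - w) = 0 by rewrite cpowD // z0 mul0r.
by rewrite subrr cpow0 // => /eqP; rewrite oner_eq0.
Qed.

Lemma cpowB_nat l w k : 0 < l -> (l ^+ k)%:C * cpow l (w - k%:R) = cpow l w.
Proof. by move=> l0; rewrite -cpow_nat // -cpowD // addrC subrK. Qed.

Lemma csmooth_on_cpow (V : normedModType R) (U : set V) (f : V -> R) w :
  open U -> smooth_on U f -> (forall x, U x -> 0 < f x) ->
  csmooth_on U (fun x => cpow (f x) w).
Proof.
move=> oU sf f0; have sl := smooth_on_ln oU sf f0.
have s1 (c : R) : smooth_on U (fun x => c * (@ln R \o f) x).
  by apply: smooth_onM => //; exact: smooth_on_cst.
split.
  apply: (smooth_on_eq (f := fun x => (expR \o (fun x => complex.Re w * (@ln R \o f) x)) x *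
      (@cos R \o (fun x => complex.Im w * (@ln R \o f) x)) x)) => //.
    by move=> x Ux; rewrite cpowE // f0.
  by apply: smooth_onM => //; [exact: smooth_on_expR|exact: smooth_on_cos].
apply: (smooth_on_eq (f := fun x => (expR \o (fun x => complex.Re w * (@ln R \o f) x)) x *
    (@sin R \o (fun x => complex.Im w * (@ln R \o f) x)) x)) => //.
  by move=> x Ux; rewrite cpowE // f0.
by apply: smooth_onM => //; [exact: smooth_on_expR|exact: smooth_on_sin].
Qed.

(** Euler's identity: on the ray through [x] the function is [cpow (1 + h) w * F x],
    with derivative [w * F x] at [h = 0]. *)
Lemma cderive_euler (V : normedModType R) (U : set V) (F : V -> R[i]) w x :
  open U -> U x -> (forall l, 0 < l -> U (l *: x) -> F (l *: x) = cpow l w * F x) ->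
  cderive x F x = w * F x.
Proof.
move=> oU Ux homF.
have cline : (fun h : R => h *: x + x) @ 0 --> x.
  rewrite -[x in _ --> x]add0r; apply: cvgD; last exact: cvg_cst.
  by rewrite -(scale0r x); exact: cvgZr_tmp.
have nU : \forall h \near (0 : R), U (h *: x + x).
  by apply: cline; exact: open_nbhs_nbhs.
have n1 : \forall h \near (0 : R), 0 < 1 + h.
  near=> h; rewrite -ltrBlDl sub0r; near: h.
  by apply: (lt_nbhsr) => //; rewrite oppr_lt0.
have [W [oW W0 WP]] := near_open (filterI nU n1).
have WE h : W h -> F (h *: x + x) = cpow (1 + h) w * F x.
  by move=> /WP[Uh h1]; rewrite -{2}(scale1r x) -scalerDl addrC homF // scalerDl scale1r addrC.
pose a := complex.Re w; pose b := complex.Im w.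
have dln : is_derive (0 : R) 1 (fun h => ln (1 + h)) (1 : R).
  have d1 : is_derive (0 : R) 1 (fun h : R => 1 + h) (1 : R).
    have := is_deriveD (is_derive_cst (1 : R) (0 : R^o) 1) (is_derive_id (0 : R^o) 1).
    by rewrite add0r.
  have d2 : is_derive (1 + (0 : R)) 1 (@ln R) 1.
    by rewrite addr0 -[X in is_derive _ _ _ X]invr1; exact: is_derive1_ln.
  by have := is_derive_comp1 d1 d2; rewrite mulr1.
have dc c : is_derive (0 : R) 1 (fun h : R => c * ln (1 + h)) c.
  have := is_deriveZ c dln; by rewrite [X in is_derive _ _ _ X]mulr1.
have l0 c : c * ln (1 + (0 : R)) = 0 by rewrite addr0 ln1 mulr0.
have de : is_derive (0 : R) 1 (fun h : R => expR (a * ln (1 + h))) a.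
  have d2 : is_derive (a * ln (1 + (0 : R))) 1 expR 1.
    by have := is_derive_expR (0 : R); rewrite l0 expR0.
  by have := is_derive_comp1 (dc a) d2; rewrite mul1r.
have dcos : is_derive (0 : R) 1 (fun h : R => cos (b * ln (1 + h))) 0.
  have d2 : is_derive (b * ln (1 + (0 : R))) 1 (@cos R) 0.
    by have := is_derive_cos (0 : R); rewrite l0 sin0 oppr0.
  by have := is_derive_comp1 (dc b) d2; rewrite mul0r.
have dsin : is_derive (0 : R) 1 (fun h : R => sin (b * ln (1 + h))) b.
  have d2 : is_derive (b * ln (1 + (0 : R))) 1 (@sin R) 1.
    by have := is_derive_sin (0 : R); rewrite l0 cos0.
  by have := is_derive_comp1 (dc b) d2; rewrite mul1r.
have dr := is_deriveM de dcos; have di := is_deriveM de dsin.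
rewrite !l0 expR0 cos0 sin0 in dr di.
apply: complexE; rewrite /cderive /= derive_line.
  have [_ E] := is_deriveB (is_deriveZ (complex.Re (F x)) dr) (is_deriveZ (complex.Im (F x)) di).
  rewrite ReM -/a -/b; transitivity (complex.Re (F x) *: (1 *: (0 : R) + 1 *: a) -
     complex.Im (F x) *: (1 *: b + 0 *: a)); last by rewrite /GRing.scale /=; ring.
  rewrite -E; apply: (@eq_on_derive R R^o W _ _ 0 1 oW W0) => h Wh.
  rewrite WE // ReM cpowE; last by have [] := WP h Wh.
  by rewrite /= !fctE /GRing.scale_fun /GRing.scale /= -/a -/b; ring.
have [_ E] := is_deriveD (is_deriveZ (complex.Im (F x)) dr) (is_deriveZ (complex.Re (F x)) di).
rewrite ImM -/a -/b; transitivity (complex.Im (F x) *: (1 *: (0 : R) + 1 *: a) +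
   complex.Re (F x) *: (1 *: b + 0 *: a)); last by rewrite /GRing.scale /=; ring.
rewrite -E; apply: (@eq_on_derive R R^o W _ _ 0 1 oW W0) => h Wh.
rewrite WE // ImM cpowE; last by have [] := WP h Wh.
by rewrite /= !fctE /GRing.scale_fun /GRing.scale /= -/a -/b; ring.
Unshelve. all: by end_near. Qed.

End ComplexPower.

(** * The null-cone *)

Lemma open_forall_seq (T : topologicalType) (I : eqType) (s : seq I) (Q : I -> set T) :
  (forall i, open (Q i)) -> open [set x | forall i, i \in s -> Q i x].
Proof.
move=> oQ; elim: s => [|b s IHs].
  rewrite (_ : [set x | _] = setT); first exact: openT.
  by apply/seteqP; split.
rewrite (_ : [set x | _] = Q b `&` [set x | forall i, i \in s -> Q i x]).
  exact: openI.
apply/seteqP; split => x /=.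
  by move=> Qx; split; [apply: Qx; rewrite mem_head|move=> i is_; apply: Qx; rewrite inE is_ orbT].
by move=> [Qb Qs] i; rewrite inE => /orP[/eqP ->//|/Qs].
Qed.

Section OpenSets.
Variables (R : realType) (V : normedModType R).
Implicit Types (f : V -> R).

Lemma open_pos f : continuous f -> open [set x | 0 < f x].
Proof. by move=> cf; apply: (@open_comp _ _ f [set y | 0 < y]) => // *; exact: open_gt. Qed.

Lemma open_neq0 f : continuous f -> open [set x | f x != 0].
Proof. by move=> cf; apply: (@open_comp _ _ f [set y | y != 0]) => // *; exact: open_neq. Qed.

Lemma smoothT_continuous f : smooth_on setT f -> continuous f.
Proof. by move=> sf x; exact: smooth_on_continuous sf _. Qed.

End OpenSets.

Section Geometry.
Variables (R : realType) (n : nat).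
Local Notation amb := 'rV[R]_(n.+2).
Implicit Types (X Y a : amb) (x y : 'rV[R]_n) (l : R).

Lemma amb_cases (b : 'I_n.+2) : [\/ b = ord0, b = ord_max | exists i : 'I_n, b = mid i].
Proof.
case: (unliftP ord0 b) => [b' ->|->]; last by constructor 1.
case: (unliftP ord_max b') => [a ->|->]; first by constructor 3; exists a.
by constructor 2; apply: val_inj.
Qed.

Lemma mid_neq0 (i : 'I_n) : (mid i == ord0) = false.
Proof. by rewrite /mid eq_sym; apply/negbTE/neq_lift. Qed.

Lemma mid_neq_max (i : 'I_n) : (mid i == ord_max) = false.
Proof.
apply: negbTE; rewrite -val_eqE /= /bump /= (leqNgt n) ltn_ord add0n add1n.
by rewrite eqSS neq_ltn ltn_ord.
Qed.

Lemma mid_eq (i l : 'I_n) : (mid i == mid l) = (i == l).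
Proof. by rewrite !(inj_eq lift_inj). Qed.

Lemma form_sym X Y : form X Y = form Y X.
Proof.
rewrite /form [X in X + _]addrC ![X 0 _ * _]mulrC; congr (_ + _).
by apply: eq_bigr => i _; rewrite mulrC.
Qed.

Lemma form_linl X Y l a : form (l *: X + Y) a = l * form X a + form Y a.
Proof.
have E : \sum_(i < n) (l *: X + Y) 0 (mid i) * a 0 (mid i) =
    l * (\sum_(i < n) X 0 (mid i) * a 0 (mid i)) + \sum_(i < n) Y 0 (mid i) * a 0 (mid i).
  by rewrite mulr_sumr -big_split; apply: eq_bigr => i _; rewrite !mxE /=; ring.
by rewrite /form E !mxE; ring.
Qed.

Lemma form_scalel l X Y : form (l *: X) Y = l * form X Y.
Proof.
have E0 : form 0 Y = 0.
  have := form_linl 0 0 1 Y; rewrite scale1r addr0 mul1r => /eqP.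
  by rewrite -subr_eq subrr eq_sym => /eqP.
by rewrite -[l *: X]addr0 form_linl E0 addr0.
Qed.

Lemma form_addl X Y a : form (X + Y) a = form X a + form Y a.
Proof. by rewrite -[X]scale1r form_linl mul1r scale1r. Qed.

Lemma form_subl X Y a : form (X - Y) a = form X a - form Y a.
Proof. by rewrite -scaleN1r form_addl form_scalel mulN1r. Qed.

Lemma form_scaler l X Y : form X (l *: Y) = l * form X Y.
Proof. by rewrite form_sym form_scalel form_sym. Qed.

Lemma form_addr X Y a : form a (X + Y) = form a X + form a Y.
Proof. by rewrite form_sym form_addl !(form_sym a). Qed.

Lemma form_subr X Y a : form a (X - Y) = form a X - form a Y.
Proof. by rewrite form_sym form_subl !(form_sym a). Qed.

Lemma form_sumr (I : Type) (r : seq I) (F : I -> amb) X :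
  form X (\sum_(i <- r) F i) = \sum_(i <- r) form X (F i).
Proof.
elim: r => [|i r IHr]; last by rewrite !big_cons form_addr IHr.
by rewrite !big_nil -(scale0r 0) form_scaler mul0r.
Qed.

Lemma form_basis_eq X : X = \sum_i X 0 i *: basis R i.
Proof. exact: row_sum_delta. Qed.

Lemma form_dual X i : form X (dual_basis R i) = X 0 i.
Proof.
rewrite {1}(form_basis_eq X) form_sym form_sumr (bigD1 i) //= form_scaler form_sym.
rewrite form_dual_basis eqxx mulr1 big1 ?addr0 // => l li.
by rewrite form_scaler form_sym form_dual_basis (negbTE li) mulr0.
Qed.

Lemma sum_form_dual X Y :
  \sum_i form X (basis R i) * form Y (dual_basis R i) = form X Y.
Proof.
rewrite {2}(form_basis_eq Y) form_sumr; apply: eq_bigr => i _.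
by rewrite form_dual form_scaler mulrC.
Qed.

Lemma dual_basis_expand X : X = \sum_i form X (basis R i) *: dual_basis R i.
Proof.
apply/rowP => j; rewrite summxE -form_dual -sum_form_dual.
apply: eq_bigr => i _; rewrite mxE; congr (_ * _).
by rewrite form_sym form_dual.
Qed.

Lemma basis_expand X : X = \sum_i form X (dual_basis R i) *: basis R i.
Proof. by rewrite {1}(form_basis_eq X); apply: eq_bigr => i _; rewrite form_dual. Qed.

(** Up to a factor [sqrt 2], the coordinate along the negative direction orthogonal
    to the hyperplane [X^0 = X^oo] of the roots. *)
Definition time X : R := X 0 ord0 - X 0 ord_max.

(** Twice the squared Euclidean norm of the component of [X] in the hyperplane
    [X^0 = X^oo], see [space_sqE]. *)
Definition space_sq X : R := 2 * form X X + time X ^+ 2.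

Lemma space_sqE X :
  space_sq X = (X 0 ord0 + X 0 ord_max) ^+ 2 + 2 * \sum_(i < n) X 0 (mid i) ^+ 2.
Proof.
rewrite /space_sq /time /form.
by under [\sum_i _]eq_bigr do rewrite -expr2; ring.
Qed.

Definition time_axis : amb := basis R ord0 - basis R ord_max.

Lemma time_lin l X Y : time (l *: X + Y) = l * time X + time Y.
Proof. by rewrite /time !mxE; ring. Qed.

Lemma time_axisE : time time_axis = 2.
Proof.
by rewrite /time /time_axis !mxE !eqxx /=; ring.
Qed.

Lemma form_time_axis X : form X time_axis = - time X.
Proof.
rewrite /time_axis form_subr /time.
have b0 : form X (basis R ord0) = X 0 ord_max.
  by rewrite -form_dual /dual_basis tpermR.
have bM : form X (basis R ord_max) = X 0 ord0.
  by rewrite -form_dual /dual_basis tpermL.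
by rewrite b0 bM opprB.
Qed.

Definition space_norm X : R := Num.sqrt (space_sq X).

Definition spacelike_nonzero : set amb := [set X | 0 < space_sq X].

(** The point of the cone on the line through [X] along the time axis: on the cone
    the time equals [space_norm], which depends on the space-like part only. *)
Definition cone_proj X : amb := X + ((space_norm X - time X) / 2) *: time_axis.

Lemma time_cone_proj X : time (cone_proj X) = space_norm X.
Proof. by rewrite /cone_proj addrC time_lin time_axisE; field. Qed.

Lemma cone_proj_cone X : spacelike_nonzero X -> cone (cone_proj X).
Proof.
move=> X0; split; last by rewrite -subr_gt0 -/(time _) time_cone_proj sqrtr_gt0.
have [fe te] := (form_time_axis, time_axisE).
rewrite /cone_proj; move: time_axis fe te => e fe te.
rewrite !(form_addl, form_addr, form_scalel, form_scaler) (form_sym e X) !fe te.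
have E : form X X = (space_norm X ^+ 2 - time X ^+ 2) / 2.
  by rewrite sqr_sqrtr ?ltW // /space_sq; field.
by rewrite E; field.
Qed.

Lemma cone_spacelike X : cone X -> spacelike_nonzero X.
Proof.
move=> [X0 Xt]; rewrite /spacelike_nonzero /= /space_sq X0 mulr0 add0r exprn_gt0 //.
by rewrite subr_gt0.
Qed.

Lemma space_norm_cone X : cone X -> space_norm X = time X.
Proof.
move=> [X0 Xt]; rewrite /space_norm /space_sq X0 mulr0 add0r sqrtr_sqr gtr0_norm //.
by rewrite subr_gt0.
Qed.

Lemma cone_proj_id X : cone X -> cone_proj X = X.
Proof. by move=> cX; rewrite /cone_proj space_norm_cone // subrr mul0r scale0r addr0. Qed.

Lemma space_sqZ l X : space_sq (l *: X) = l ^+ 2 * space_sq X.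
Proof.
rewrite /space_sq form_scalel form_scaler; have := time_lin l X 0.
by rewrite addr0 /time !mxE subrr addr0 => ->; ring.
Qed.

Lemma timeZ l X : time (l *: X) = l * time X.
Proof. by rewrite /time !mxE; ring. Qed.

Lemma space_normZ l X : 0 < l -> space_norm (l *: X) = l * space_norm X.
Proof.
by move=> l0; rewrite /space_norm space_sqZ sqrtrM ?sqr_ge0 // sqrtr_sqr gtr0_norm.
Qed.

Lemma cone_projZ l X : 0 < l -> cone_proj (l *: X) = l *: cone_proj X.
Proof.
move=> l0; rewrite /cone_proj space_normZ // timeZ; move: time_axis => e.
by rewrite scalerDr scalerA; congr (_ + _ *: _); ring.
Qed.

Lemma coneZ l X : 0 < l -> cone X -> cone (l *: X).
Proof.
by move=> l0 [X0 Xt]; split; rewrite ?form_scalel ?form_scaler ?X0 ?mulr0 // !mxE ltr_pM2l.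
Qed.

Lemma spacelikeZ l X : 0 < l -> spacelike_nonzero X -> spacelike_nonzero (l *: X).
Proof.
by move=> l0 X0; rewrite /spacelike_nonzero /= space_sqZ mulr_gt0 // exprn_gt0.
Qed.

Lemma smooth_on_form (U : set amb) a : open U -> smooth_on U (form a).
Proof.
move=> oU; apply: smooth_onD => //.
  by apply: smooth_onD => //; apply: smooth_onM => //;
    solve [exact: smooth_on_cst|exact: smooth_on_coord].
apply: smooth_on_sum => // i; apply: smooth_onM => //.
  exact: smooth_on_cst.
exact: smooth_on_coord.
Qed.

Lemma smooth_on_Q (U : set amb) : open U -> smooth_on U (fun X => form X X).
Proof.
move=> oU; apply: smooth_onD => //.
  by apply: smooth_onD => //; apply: smooth_onM => //; exact: smooth_on_coord.
by apply: smooth_on_sum => // i; apply: smooth_onM => //; exact: smooth_on_coord.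
Qed.

Lemma smooth_on_time (U : set amb) : open U -> smooth_on U time.
Proof. by move=> oU; apply: smooth_onB => //; exact: smooth_on_coord. Qed.

Lemma smooth_on_space_sq (U : set amb) : open U -> smooth_on U space_sq.
Proof.
move=> oU; apply: smooth_onD => //.
  by apply: smooth_onM => //; [exact: smooth_on_cst|exact: smooth_on_Q].
by apply: smooth_onX => //; exact: smooth_on_time.
Qed.

Lemma open_spacelike : open spacelike_nonzero.
Proof. exact: open_pos (smoothT_continuous (smooth_on_space_sq openT)). Qed.

Lemma smooth_on_space_norm : smooth_on spacelike_nonzero space_norm.
Proof.
apply: smooth_on_sqrt => //; first exact: open_spacelike.
exact: smooth_on_space_sq open_spacelike.
Qed.

Lemma smooth_map_cone_proj : smooth_map spacelike_nonzero cone_proj.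
Proof.
have oU := open_spacelike; move=> i.
apply: (smooth_on_eq (f := fun X => X 0 i +
    (space_norm X - time X) * (2^-1 * time_axis 0 i))) => //.
  by move=> X _; rewrite /cone_proj !mxE; ring.
apply: smooth_onD => //; first exact: smooth_on_coord.
apply: smooth_onM => //; last exact: smooth_on_cst.
by apply: smooth_onB => //; [exact: smooth_on_space_norm|exact: smooth_on_time].
Qed.

Lemma smooth_map_comp (V' : normedModType R) (U : set V') (W : set amb) p
    (g : V' -> amb) (h : amb -> 'rV[R]_p) : open U -> open W ->
  smooth_map U g -> (forall z, U z -> W (g z)) -> smooth_map W h -> smooth_map U (h \o g).
Proof.
by move=> oU oW sg gW sh i; exact: (smooth_on_comp oU oW (sh i) sg gW).
Qed.

(** A density composed with a smooth map into the cone is smooth: locally the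
    density is the restriction of a smooth function. *)
Lemma csmooth_density_comp (V' : normedModType R) (U : set V') w
    (f : amb -> R[i]) (g : V' -> amb) : open U -> density w f ->
  smooth_map U g -> (forall z, U z -> cone (g z)) -> csmooth_on U (f \o g).
Proof.
move=> oU [locf _] sg gC; apply: csmooth_on_local => x0 Ux0.
have [U1 [F [oU1 U1x sF Ff]]] := locf _ (gC x0 Ux0).
have : \forall x \near x0, U x /\ U1 (g x).
  near=> x; split; first by near: x; exact: open_nbhs_nbhs.
  near: x; apply: (smooth_map_continuous sg Ux0).
  exact: open_nbhs_nbhs.
move=> /near_open[W [oW Wx0 WP]]; exists W; split => //.
apply: (csmooth_on_eq (F := F \o g)) => //.
  by move=> x Wx; rewrite /= Ff //; [have [] := WP x Wx|apply: gC; have [] := WP x Wx].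
apply: (csmooth_on_comp oW oU1 sF); last by move=> x /WP[].
by move=> i; apply: smooth_on_sub (sg i) => x /WP[].
Unshelve. all: by end_near. Qed.

Lemma csmooth_cone_proj w f : density w f -> csmooth_on spacelike_nonzero (f \o cone_proj).
Proof.
move=> df; apply: (csmooth_density_comp open_spacelike df smooth_map_cone_proj).
exact: cone_proj_cone.
Qed.

(** The projection to the cone is positively homogeneous and fixes the cone. *)
Lemma extension_cone_proj w f : density w f -> extension w f (f \o cone_proj).
Proof.
move=> df; exists spacelike_nonzero; split.
- exact: open_spacelike.
- exact: cone_spacelike.
- exact: csmooth_cone_proj df.
- by move=> X cX; rewrite /= cone_proj_id.
- move=> l X l0 X0 _; rewrite /= cone_projZ //.
  by case: df => _; apply => //; exact: cone_proj_cone.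
Qed.

End Geometry.

(** * The stereographic chart *)

Section Chart.
Variables (R : realType) (n : nat).
Local Notation amb := 'rV[R]_(n.+2).
Implicit Types (X Y : amb) (x y : 'rV[R]_n).

Lemma chart_coord x :
  [/\ chart x 0 ord0 = 1, chart x 0 ord_max = - ((\sum_i x 0 i ^+ 2) / 2)
    & forall i, chart x 0 (mid i) = x 0 i].
Proof.
have chartE j : chart x 0 j = (j == ord0)%:R + \sum_(i < n) x 0 i * (j == mid i)%:R
     - ((\sum_i x 0 i ^+ 2) / 2) * (j == ord_max)%:R.
  rewrite /chart !mxE !eqxx /= summxE; congr (_ + _ - _).
  by apply: eq_bigr => i _; rewrite !mxE eqxx.
split; rewrite ?chartE.
- rewrite eqxx big1 => [|i _]; last by rewrite eq_sym mid_neq0 mulr0.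
  by rewrite (_ : ord0 == ord_max = false) // mulr0 subr0 addr0.
- rewrite (_ : ord_max == ord0 = false) // eqxx mulr1 big1 ?add0r // => i _.
  by rewrite eq_sym mid_neq_max mulr0.
move=> i; rewrite chartE mid_neq0 mid_neq_max mulr0 subr0 add0r (bigD1 i) //= eqxx mulr1 big1 ?addr0 //.
by move=> l li; rewrite mid_eq eq_sym (negbTE li) mulr0.
Qed.

Lemma form_chart X x :
  form X (chart x) = X 0 ord_max + \sum_i X 0 (mid i) * x 0 i
    - X 0 ord0 * ((\sum_i x 0 i ^+ 2) / 2).
Proof.
have [c0 cM ci] := chart_coord x; rewrite /form c0 cM mulr1.
have -> : \sum_i X 0 (mid i) * chart x 0 (mid i) = \sum_i X 0 (mid i) * x 0 i.
  by apply: eq_bigr => i _; rewrite ci.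
by ring.
Qed.

Lemma form_chart_chart x y :
  form (chart x) (chart y) = - ((\sum_i (y 0 i - x 0 i) ^+ 2) / 2).
Proof.
rewrite form_chart; have [-> -> ci] := chart_coord x.
have -> : \sum_i (y 0 i - x 0 i) ^+ 2 =
   \sum_i y 0 i ^+ 2 - 2 * (\sum_i chart x 0 (mid i) * y 0 i) + \sum_i x 0 i ^+ 2.
  rewrite mulr_sumr -sumrB -big_split /=; apply: eq_bigr => i _.
  by rewrite ci; ring.
by field.
Qed.

Lemma cone_chart x : cone (chart x).
Proof.
split.
  rewrite form_chart_chart big1 ?mul0r ?oppr0 // => i _.
  by rewrite subrr expr0n.
have [-> -> _] := chart_coord x.
rewrite (@le_lt_trans _ _ 0) // oppr_le0 divr_ge0 // sumr_ge0 // => i _.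
exact: sqr_ge0.
Qed.

Lemma smooth_map_chart : smooth_map setT (@chart R n).
Proof.
have sq : smooth_on setT (fun x : 'rV[R]_n => - ((\sum_i x 0 i ^+ 2) * 2^-1)).
  apply: smooth_onN; first exact: openT.
  apply: smooth_onM; [exact: openT| |exact: smooth_on_cst openT].
  apply: smooth_on_sum; first exact: openT.
  by move=> i; apply: smooth_onX; [exact: openT|exact: smooth_on_coord openT].
move=> j; have [->|->|[i ->]] := amb_cases j.
- apply: (smooth_on_eq (f := cst 1)) (smooth_on_cst _ openT); first exact: openT.
  by move=> x _; have [-> _ _] := chart_coord x.
- apply: (smooth_on_eq openT _ sq) => x _.
  by have [_ -> _] := chart_coord x.
- apply: (smooth_on_eq openT _ (smooth_on_coord i openT)) => x _.
  by have [_ _ ->] := chart_coord x.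
Qed.

(** The coordinate [(cone_proj X)^0]. *)
Definition height X : R := (X 0 ord0 + X 0 ord_max + space_norm X) / 2.

Definition chart_region : set amb := [set X | spacelike_nonzero X /\ 0 < height X].

(** The stereographic coordinates of [cone_proj X]. *)
Definition chart_inv X : 'rV[R]_n := \row_i (X 0 (mid i) / height X).

(** So a density composed with [cone_proj] is a power of the height times a function
    of the stereographic coordinates. *)
Lemma cone_projE X : chart_region X ->
  cone_proj X = height X *: chart (chart_inv X).
Proof.
move=> [X0 hX]; have h0 : height X != 0 by rewrite gt_eqF.
have [c0 cM ci] := chart_coord (chart_inv X).
apply/rowP => j; rewrite [RHS]mxE; have [->|->|[i ->]] := amb_cases j.
- rewrite c0 /cone_proj /time_axis !mxE eqxx (_ : ord0 == ord_max = false) //=.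
  by rewrite /height /time; field.
- rewrite cM /cone_proj /time_axis !mxE !eqxx (_ : ord_max == ord0 = false) //=.
  have -> : \sum_i chart_inv X 0 i ^+ 2 =
     (space_sq X - (X 0 ord0 + X 0 ord_max) ^+ 2) / 2 / height X ^+ 2.
    rewrite space_sqE [_ - _ ^+ 2]addrC addKr [2 * _]mulrC mulfK ?pnatr_eq0 // mulr_suml.
    by apply: eq_bigr => i _; rewrite mxE expr_div_n.
  have -> : space_sq X = space_norm X ^+ 2 by rewrite sqr_sqrtr ?ltW.
  rewrite /time; move: h0; rewrite /height; set s := X 0 ord0 + X 0 ord_max.
  move=> h0; have h0' : s + space_norm X != 0.
    by apply: contraNneq h0 => ->; rewrite mul0r.
  have -> : X 0 ord_max = s - X 0 ord0 by rewrite /s; ring.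
  by field.
- by rewrite ci /cone_proj /time_axis !mxE mid_neq0 mid_neq_max /=; field.
Qed.

Lemma chart_invK x : [/\ chart_region (chart x), chart_inv (chart x) = x & height (chart x) = 1].
Proof.
have cx := cone_chart x; have [c0 cM ci] := chart_coord x.
have h1 : height (chart x) = 1.
  by rewrite /height space_norm_cone // /time c0; field.
split => //; first by split; [exact: cone_spacelike|rewrite h1].
by apply/rowP => i; rewrite mxE h1 divr1 ci.
Qed.

Lemma smooth_on_height : smooth_on (@spacelike_nonzero R n) height.
Proof.
have oU := @open_spacelike R n.
apply: smooth_onM => //; last exact: smooth_on_cst.
apply: smooth_onD => //; last exact: smooth_on_space_norm.
by apply: smooth_onD => //; exact: smooth_on_coord.
Qed.

Lemma open_chart_region : open chart_region.
Proof.
rewrite openE => X [X0 hX].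
have : \forall Y \near X, spacelike_nonzero Y /\ 0 < height Y.
  near=> Y; split; first by near: Y; apply: open_nbhs_nbhs; split => //; exact: open_spacelike.
  by near: Y; exact: (cvgr_gt _ (smooth_on_continuous smooth_on_height X0)).
by [].
Unshelve. all: by end_near. Qed.

Lemma smooth_map_chart_inv : smooth_map chart_region chart_inv.
Proof.
have oW := open_chart_region; move=> i.
apply: (smooth_on_eq (f := fun X => X 0 (mid i) * (height X)^-1)) => //.
  by move=> X _; rewrite mxE.
apply: smooth_onM => //; first exact: smooth_on_coord.
apply: smooth_onV => //; last by move=> X [_ /lt0r_neq0].
by apply: smooth_on_sub smooth_on_height => X [].
Qed.

End Chart.

(** * Complex divided differences and homogeneous functions *)

Section SeqSums.
Variables (R : realType) (V : normedModType R).

Lemma csmooth_on_sum_seq (U : set V) (I : eqType) (r : seq I) (F : I -> V -> R[i]) :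
  open U -> (forall i, i \in r -> csmooth_on U (F i)) ->
  csmooth_on U (fun x => \sum_(i <- r) F i x).
Proof.
move=> oU sF.
apply: (csmooth_on_eq (F := fun x => \sum_(i <- r) (if i \in r then F i x else 0))) => //.
  by move=> x _; rewrite [RHS]big_seq -big_mkcondr /= -big_seq.
apply: csmooth_on_sum => // i; case: (boolP (i \in r)) => [/sF //|_].
exact: csmooth_on_cst.
Qed.

End SeqSums.

Section ComplexDividedDifference.
Variables (R : realType) (p : nat).
Local Notation V := 'rV[R]_p.
Implicit Types (U : set V) (F : V -> R[i]) (th : V -> R) (e : V).

Definition cdivided_difference th e F x : R[i] :=
  divided_difference th e (fun y => complex.Re (F y)) x +i*
  divided_difference th e (fun y => complex.Im (F y)) x.

Lemma cdivided_differenceE th e F x : cdivided_difference th e F x =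
  if th x == 0 then cderive e F x else (F x - F (slide th e 1 x)) / (th x)%:C.
Proof.
rewrite /cdivided_difference /divided_difference; case: ifPn => // th0.
rewrite -fmorphV; case: (F x) => a b; case: (F _) => c d.
apply/eqP; rewrite eq_complex; apply/andP; split; apply/eqP; rewrite ?ReM ?ImM /=; ring.
Qed.

Lemma csmooth_on_cdivided_difference U th e F : open U ->
  csmooth_on U F -> smooth_on U th ->
  csmooth_on [set x | U x /\ U (slide th e 1 x)] (cdivided_difference th e F).
Proof. by move=> oU [sr si] sth; split; exact: smooth_on_divided_difference. Qed.

Lemma cderiveZ_dir F U (c : R) v x : open U -> csmooth_on U F -> U x ->
  cderive (c *: v) F x = c%:C * cderive v F x.
Proof.
move=> oU sF Ux; rewrite !(cderive_dirE _ oU sF Ux) mulr_sumr.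
by apply: eq_bigr => i _; rewrite mxE rmorphM /= mulrA.
Qed.

Lemma cderive_sum_dir U F (I : Type) (r : seq I) (c : I -> R) (e : I -> V) x :
  open U -> csmooth_on U F -> U x ->
  cderive (\sum_(i <- r) c i *: e i) F x = \sum_(i <- r) (c i)%:C * cderive (e i) F x.
Proof.
move=> oU sF Ux; rewrite (cderive_dirE _ oU sF Ux).
under eq_bigr => j _ do rewrite summxE rmorph_sum mulr_suml.
rewrite exchange_big; apply: eq_bigr => i _; rewrite (cderive_dirE (e i) oU sF Ux) mulr_sumr.
by apply: eq_bigr => j _; rewrite mxE rmorphM /= mulrA.
Qed.

Definition homogeneous_on U (w : R[i]) F := forall (l : R) x,
  0 < l -> U x -> U (l *: x) -> F (l *: x) = cpow l w * F x.

(** Differentiate [F (l *: y) = cpow l w * F y] in [y] and cancel a factor [l]. *)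
Lemma cderive_homogeneous U w F v (l : R) x : open U -> csmooth_on U F ->
  homogeneous_on U w F -> 0 < l -> U x -> U (l *: x) ->
  cderive v F (l *: x) = cpow l (w - 1) * cderive v F x.
Proof.
move=> oU sF hF l0 Ux Ulx.
have lC0 : l%:C != 0 by rewrite fmorph_eq0 gt_eqF.
apply: (mulfI lC0); rewrite mulrA.
have := cpowB_nat w 1 l0; rewrite expr1 => ->.
rewrite -(cderiveZ_dir _ _ oU sF Ulx) -(@cderive_linear_comp R V V F ( *:%R l) v x); last first.
  by move=> t; rewrite scalerDr !scalerA mulrC.
have [W [oW Wx WP]] : exists W, [/\ open W, W x & forall y, W y -> U y /\ U (l *: y)].
  apply: near_open; near=> y; split; first by near: y; exact: open_nbhs_nbhs.
  near: y; have : {for x, continuous ( *:%R l : V -> V)} by exact: scaler_continuous.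
  by apply; exact: open_nbhs_nbhs.
have sFW : csmooth_on W F by apply: csmooth_on_sub sF => y /WP[].
rewrite -(cderiveZ _ _ oW sFW Wx); apply: (cderive_eq v oW Wx) => y Wy /=.
by have [Uy Uly] := WP y Wy; rewrite hF.
Unshelve. all: by end_near. Qed.

End ComplexDividedDifference.

(** * Reflections *)

Section Isometries.
Variables (R : realType) (n : nat).
Local Notation amb := 'rV[R]_(n.+2).
Implicit Types (X Y a : amb) (g h : amb -> amb).

(** The linear isometries which fix the time axis, hence preserve the cone and
    commute with the projection to it; reflections in Euclidean roots are of this
    kind. *)
Definition space_isometry g :=
  [/\ forall (t : R) X Y, g (t *: X + Y) = t *: g X + g Y,
      forall X Y, form (g X) (g Y) = form X Y & g (@time_axis R n) = @time_axis R n].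

Lemma refl_lin a (t : R) X Y : refl a (t *: X + Y) = t *: refl a X + refl a Y.
Proof.
rewrite /refl (form_sym a) form_linl !(form_sym a) scalerBr scalerA [RHS]addrACA; congr (_ + _).
by rewrite -opprD -scalerDl; congr (- (_ *: _)); ring.
Qed.

Lemma refl_form a X Y : form a a != 0 -> form (refl a X) (refl a Y) = form X Y.
Proof.
move=> a0; rewrite /refl !(form_subl, form_subr, form_scalel, form_scaler) (form_sym X a).
by field.
Qed.

Lemma refl_invol a : form a a != 0 -> involutive (refl a).
Proof.
move=> a0 X; rewrite /refl; set c := 2 * form a X / form a a.
have -> : form a (X - c *: a) = - form a X by rewrite form_subr form_scaler /c; field.
by rewrite mulrN mulNr scaleNr opprK subrK.
Qed.

Lemma refl_space_isometry a : form a a != 0 -> a 0 ord0 = a 0 ord_max ->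
  space_isometry (refl a).
Proof.
move=> a0 ea; split; [exact: refl_lin|by move=> X Y; exact: refl_form|].
by rewrite /refl form_time_axis /time ea subrr oppr0 mulr0 mul0r scale0r subr0.
Qed.

Lemma space_isometry_comp g h : space_isometry g -> space_isometry h ->
  space_isometry (g \o h).
Proof.
move=> [lg fg tg] [lh fh th]; split => /=.
- by move=> t X Y; rewrite lh lg.
- by move=> X Y; rewrite fg fh.
- by rewrite th tg.
Qed.

Lemma space_isometry_id : space_isometry id.
Proof. by split. Qed.

Section Isometry.
Variable g : amb -> amb.
Hypothesis isog : space_isometry g.

Lemma isometryD X Y : g (X + Y) = g X + g Y.
Proof. by case: isog => lg _ _; rewrite -[X]scale1r lg !scale1r. Qed.

Lemma isometryZ (t : R) X : g (t *: X) = t *: g X.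
Proof.
have g0 : g 0 = 0.
  by have := isometryD 0 0; rewrite addr0 => /eqP; rewrite -subr_eq subrr eq_sym => /eqP.
by case: isog => lg _ _; rewrite -[t *: X]addr0 lg g0 addr0.
Qed.

Lemma isometry0 : g 0 = 0.
Proof. by have := isometryZ 0 0; rewrite !scale0r. Qed.

Lemma isometry_time X : time (g X) = time X.
Proof.
by apply: oppr_inj; case: isog => _ fg tg; rewrite -!form_time_axis -{1}tg fg.
Qed.

Lemma isometry_space_sq X : space_sq (g X) = space_sq X.
Proof. by case: isog => _ fg tg; rewrite /space_sq fg isometry_time. Qed.

Lemma isometry_cone X : cone X -> cone (g X).
Proof.
case: isog => _ fg _ [X0 Xt]; split; rewrite ?fg // -subr_gt0 -/(time _).
by rewrite isometry_time subr_gt0.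
Qed.

Lemma isometry_cone_proj X : cone_proj (g X) = g (cone_proj X).
Proof.
rewrite /cone_proj /space_norm isometry_space_sq isometry_time isometryD isometryZ.
by case: isog => _ _ ->.
Qed.

Lemma smooth_map_isometry (U : set amb) : open U -> smooth_map U g.
Proof.
move=> oU i.
apply: (smooth_on_eq (f := fun X => \sum_j X 0 j * g (delta_mx 0 j) 0 i)) => //.
  move=> X _; rewrite {2}(row_sum_delta X).
  elim: (index_enum _) => [|j r IHr].
    by rewrite !big_nil isometry0 mxE.
  by rewrite !big_cons isometryD isometryZ IHr !mxE.
apply: smooth_on_sum => // j; apply: smooth_onM => //; last exact: smooth_on_cst.
exact: smooth_on_coord.
Qed.

Lemma density_isometry w (f : amb -> R[i]) : density w f -> density w (f \o g).
Proof.
move=> df; split.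
  move=> X cX; exists (@spacelike_nonzero R n), (f \o g \o @cone_proj R n); split.
  - exact: open_spacelike.
  - exact: cone_spacelike.
  - apply: (csmooth_density_comp (@open_spacelike R n) df).
      apply: (smooth_map_comp (@open_spacelike R n) openT (@smooth_map_cone_proj R n)) => //.
      exact: smooth_map_isometry openT.
    by move=> Y Y0; apply: isometry_cone; exact: cone_proj_cone.
  - by move=> Y _ cY /=; rewrite cone_proj_id.
move=> l X l0 cX /=; rewrite isometryZ; case: df => _; apply => //.
exact: isometry_cone.
Qed.

End Isometry.

Lemma refl_group_isometry (Phi : {fset amb}) g : root_system Phi ->
  euclidean_roots Phi -> refl_group Phi g -> space_isometry g.
Proof.
move=> [nd _ _] eu; elim=> [|a aP|g1 h1 _ ig _ ih].
- exact: space_isometry_id.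
- by apply: refl_space_isometry; [exact: nd|exact: eu].
- exact: space_isometry_comp.
Qed.

End Isometries.

(** * Dunkl operators *)

Section DunklOperators.
Variables (R : realType) (n : nat).
Local Notation amb := 'rV[R]_(n.+2).
Variables (Pos : {fset amb}) (k : amb -> R[i]).
Hypothesis nondegenerate : forall a, a \in Pos -> form a a != 0.
Implicit Types (X Y a xi eta : amb) (U : set amb) (F G H : amb -> R[i]).

Local Notation T := (dunkl Pos k).
Local Notation Lap := (dunkl_laplace Pos k).

(** The Dunkl operators are not local: values near [X] involve the values near
    the reflected points, hence this smaller domain. *)
Definition reflect_core U : set amb :=
  [set X | U X /\ forall a, a \in Pos -> U (refl a X)].

Lemma reflect_core_sub U : reflect_core U `<=` U.
Proof. by move=> X []. Qed.

Lemma smooth_on_mirror a U : open U -> smooth_on U (fun Y => 2 * form a Y / form a a).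
Proof.
move=> oU; apply: smooth_onM => //; last exact: smooth_on_cst.
by apply: smooth_onM => //; [exact: smooth_on_cst|exact: smooth_on_form].
Qed.

Lemma slide_mirror a X : slide (fun Y => 2 * form a Y / form a a) a 1 X = refl a X.
Proof. by rewrite /slide mul1r. Qed.

Lemma refl_continuous a : continuous (@refl R n a).
Proof.
have -> : refl a = fun Y => Y - (1 * (2 * form a Y / form a a)) *: a.
  by apply/funext => Y; rewrite /refl mul1r.
move=> X; apply: slide_continuous.
exact: (smooth_on_continuous (smooth_on_mirror a openT)).
Qed.

Lemma open_reflect_core U : open U -> open (reflect_core U).
Proof.
move=> oU; apply: openI => //; apply: (@open_forall_seq _ _ (enum_fset Pos)) => a.
by apply: open_comp => // X _; exact: refl_continuous.
Qed.

(** The difference quotients of the Dunkl operators are divided differences, hence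
    smooth across the mirrors. *)
Lemma diff_quot_slide a F X : form a a != 0 -> diff_quot a F X =
  (2 / form a a)%:C * cdivided_difference (fun Y => 2 * form a Y / form a a) a F X.
Proof.
move=> a0; rewrite cdivided_differenceE /diff_quot slide_mirror.
have -> : (2 * form a X / form a a == 0) = (form a X == 0).
  by rewrite !mulf_eq0 invr_eq0 (negbTE a0) pnatr_eq0 orbF.
case: ifPn => // aX; have aC : (form a a)%:C != 0 by rewrite fmorph_eq0.
have aXC : (form a X)%:C != 0 by rewrite fmorph_eq0.
rewrite !rmorphM /= fmorphV (_ : 2%:C = 2 :> R[i]); last exact: rmorph_nat.
by field; rewrite aC aXC.
Qed.

Lemma csmooth_on_diff_quot a F U : open U -> form a a != 0 -> csmooth_on U F ->
  csmooth_on [set X | U X /\ U (refl a X)] (diff_quot a F).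
Proof.
move=> oU a0 sF.
have E : [set X | U X /\ U (refl a X)] = [set X | U X /\
    U (slide (fun Y => 2 * form a Y / form a a) a 1 X)].
  by apply/seteqP; split => X /=; rewrite slide_mirror.
have oW : open [set X | U X /\ U (refl a X)].
  have -> : [set X | U X /\ U (refl a X)] = U `&` (refl a @^-1` U) by [].
  by apply: openI => //; apply: open_comp => // X _; exact: refl_continuous.
apply: (csmooth_on_eq (F := fun X => (2 / form a a)%:C *
    cdivided_difference (fun Y => 2 * form a Y / form a a) a F X)) => //.
  by move=> X _; rewrite diff_quot_slide.
apply: csmooth_onM => //; first exact: csmooth_on_cst.
by rewrite E; apply: csmooth_on_cdivided_difference => //; exact: smooth_on_mirror.
Qed.

Lemma csmooth_on_dunkl xi F U : open U -> csmooth_on U F ->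
  csmooth_on (reflect_core U) (T xi F).
Proof.
move=> oU sF; have oW := open_reflect_core oU.
apply: csmooth_onD => //.
  by apply: csmooth_on_derive; exact: csmooth_on_sub (@reflect_core_sub U) sF.
apply: csmooth_on_sum_seq => // a aP; apply: csmooth_onM => //.
  exact: csmooth_on_cst.
apply: csmooth_on_sub (csmooth_on_diff_quot oU (nondegenerate aP) sF) => X [UX aU].
by split => //; exact: aU.
Qed.

Lemma dunkl_eq xi F G U X : open U -> reflect_core U X ->
  (forall Y, U Y -> F Y = G Y) -> T xi F X = T xi G X.
Proof.
move=> oU [UX aU] FG; rewrite /dunkl (cderive_eq xi oU UX FG); congr (_ + _).
rewrite !big_seq; apply: eq_bigr => a aP; rewrite /diff_quot.
by rewrite (cderive_eq a oU UX FG) !FG //; exact: aU.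
Qed.

Lemma diff_quotD a F G U X : csmooth_on U F -> csmooth_on U G -> U X ->
  diff_quot a (fun Y => F Y + G Y) X = diff_quot a F X + diff_quot a G X.
Proof.
move=> sF sG UX; rewrite /diff_quot (cderiveD a sF sG UX).
by case: ifP => _; [rewrite mulrDr|rewrite -mulrDl; congr (_ / _); ring].
Qed.

Lemma dunklD xi F G U X : csmooth_on U F -> csmooth_on U G -> U X ->
  T xi (fun Y => F Y + G Y) X = T xi F X + T xi G X.
Proof.
move=> sF sG UX; rewrite /dunkl (cderiveD xi sF sG UX) addrACA -big_split /=.
congr (_ + _); apply: eq_bigr => a _.
by rewrite (diff_quotD a sF sG UX) mulrDr.
Qed.

Lemma diff_quotZ a (c : R[i]) F U X : open U -> csmooth_on U F -> U X ->
  diff_quot a (fun Y => c * F Y) X = c * diff_quot a F X.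
Proof.
move=> oU sF UX; rewrite /diff_quot (cderiveZ c a oU sF UX).
by case: ifP => _; ring.
Qed.

Lemma dunklZ xi (c : R[i]) F U X : open U -> csmooth_on U F -> U X ->
  T xi (fun Y => c * F Y) X = c * T xi F X.
Proof.
move=> oU sF UX; rewrite /dunkl (cderiveZ c xi oU sF UX) mulrDr mulr_sumr.
congr (_ + _); apply: eq_bigr => a _.
by rewrite (diff_quotZ a c oU sF UX); ring.
Qed.

Lemma dunkl_sum_dir F U X (I : Type) (r : seq I) (c : I -> R) (e : I -> amb) :
  open U -> csmooth_on U F -> U X ->
  T (\sum_(i <- r) c i *: e i) F X = \sum_(i <- r) (c i)%:C * T (e i) F X.
Proof.
move=> oU sF UX; rewrite /dunkl (cderive_sum_dir _ _ _ oU sF UX).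
under [RHS]eq_bigr do rewrite mulrDr mulr_sumr.
rewrite big_split /= exchange_big /=; congr (_ + _); apply: eq_bigr => a _.
rewrite form_sumr rmorph_sum mulr_sumr mulr_suml; apply: eq_bigr => i _.
by rewrite form_scaler rmorphM /=; ring.
Qed.

Lemma dunkl_homogeneous xi F U w : open U -> csmooth_on U F ->
  homogeneous_on U w F -> homogeneous_on (reflect_core U) (w - 1) (T xi F).
Proof.
move=> oU sF hF l X l0 [UX aX] [UlX alX].
have lC0 : l%:C != 0 by rewrite fmorph_eq0 gt_eqF.
rewrite /dunkl (cderive_homogeneous xi oU sF hF l0 UX UlX) mulrDr mulr_sumr.
congr (_ + _); rewrite !big_seq; apply: eq_bigr => a aP.
suff -> : diff_quot a F (l *: X) = cpow l (w - 1) * diff_quot a F X by ring.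
rewrite /diff_quot form_scaler mulf_eq0 gt_eqF //=.
case: ifPn => [_|aX0].
  by rewrite (cderive_homogeneous a oU sF hF l0 UX UlX); ring.
have E : refl a (l *: X) = l *: refl a X.
  by have := refl_lin a l X 0; rewrite addr0 {3}/refl form_sym
    -(scale0r 0) form_scalel !(mul0r, mulr0, scale0r) subrr addr0.
have := cpowB_nat w 1 l0; rewrite expr1 => E1.
rewrite E !hF //; [|exact: aX|by rewrite -E; exact: alX].
rewrite -E1 rmorphM /=; have aC : (form a X)%:C != 0 by rewrite fmorph_eq0.
by field; rewrite aC lC0.
Qed.

End DunklOperators.

(** * Multiplication by the quadratic form *)

Section DunklLaplacian.
Variables (R : realType) (n : nat).
Local Notation amb := 'rV[R]_(n.+2).
Variables (Pos : {fset amb}) (k : amb -> R[i]).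
Hypothesis nondegenerate : forall a, a \in Pos -> form a a != 0.
Implicit Types (X Y a xi eta : amb) (U : set amb) (F G H : amb -> R[i]).

Local Notation T := (dunkl Pos k).
Local Notation Lap := (dunkl_laplace Pos k).
Local Notation core := (reflect_core Pos).

Lemma is_derive_form xi v X : is_derive X v (form xi) (form xi v).
Proof. by apply: is_derive_linear => Y u t; rewrite form_addr form_scaler. Qed.

Lemma is_derive_Q v X : is_derive X v (fun Y => form Y Y) (2 * form v X).
Proof.
apply/is_derive_line.
have -> : (fun t : R => form (t *: v + X) (t *: v + X)) =
   (form v v \*: (fun t : R => t * t)) + (2 * form v X \*: (id : R -> R^o)) + cst (form X X).
  apply/funext => t; rewrite !(form_addl, form_addr, form_scalel, form_scaler) (form_sym X v).
  by rewrite !fctE /GRing.scale_fun /GRing.scale /=; ring.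
have dtt := is_deriveM (is_derive_id (0 : R^o) 1) (is_derive_id (0 : R^o) 1).
have := is_deriveD (is_deriveD (is_deriveZ (form v v) dtt)
  (is_deriveZ (2 * form v X) (is_derive_id (0 : R^o) 1))) (is_derive_cst (form X X) (0 : R^o) 1).
congr (is_derive _ _ _ _).
by rewrite /GRing.scale /=; ring.
Qed.

Lemma cderive_Q xi X : cderive xi (fun Y => (form Y Y)%:C) X = (2 * form xi X)%:C.
Proof. by rewrite cderive_real; have [_ ->] := is_derive_Q xi X. Qed.

Lemma cderive_form eta xi X : cderive xi (fun Y => (form eta Y)%:C) X = (form eta xi)%:C.
Proof. by rewrite cderive_real; have [_ ->] := is_derive_form eta xi X. Qed.

Lemma csmooth_on_Q U : open U -> csmooth_on U (fun X => (form X X)%:C).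
Proof. by move=> oU; apply: csmooth_on_real => //; exact: smooth_on_Q. Qed.

Lemma csmooth_on_form eta U : open U -> csmooth_on U (fun X => (form eta X)%:C).
Proof. by move=> oU; apply: csmooth_on_real => //; exact: smooth_on_form. Qed.

Lemma refl_fix a X : form a X = 0 -> refl a X = X.
Proof. by move=> aX; rewrite /refl aX mulr0 mul0r scale0r subr0. Qed.

(** The quadratic form is invariant under reflections, so that the difference
    quotients are linear over it and only the derivative contributes. *)
Lemma dunklM_Q xi H U X : open U -> csmooth_on U H -> core U X ->
  T xi (fun Y => (form Y Y)%:C * H Y) X =
  (form X X)%:C * T xi H X + (2 * form xi X)%:C * H X.
Proof.
move=> oU sH [UX aX]; rewrite /dunkl (cderiveM xi (csmooth_on_Q oU) sH UX) cderive_Q.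
set S := \sum_(a <- Pos) _; set S' := \sum_(a <- Pos) _.
suff -> : S = (form X X)%:C * S' by ring.
rewrite /S /S' mulr_sumr !big_seq; apply: eq_bigr => a aP.
suff -> : diff_quot a (fun Y => (form Y Y)%:C * H Y) X = (form X X)%:C * diff_quot a H X.
  by ring.
rewrite /diff_quot (cderiveM a (csmooth_on_Q oU) sH UX) cderive_Q.
case: ifPn => [/eqP ->|_]; first by rewrite mulr0 mul0r add0r; ring.
by rewrite refl_form ?nondegenerate //; ring.
Qed.

(** The difference quotient of the linear form [<eta, .>] is the constant
    [2 <a, eta> / <a, a>]; it multiplies the value of [H] at the reflected point. *)
Lemma dunklM_form eta xi H U X : open U -> csmooth_on U H -> core U X ->
  T xi (fun Y => (form eta Y)%:C * H Y) X =
  (form eta X)%:C * T xi H X + (form eta xi)%:C * H X +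
  \sum_(a <- Pos) k a * (form a xi * (2 * form a eta / form a a))%:C * H (refl a X).
Proof.
move=> oU sH [UX aX]; rewrite /dunkl (cderiveM xi (csmooth_on_form eta oU) sH UX) cderive_form.
set S := \sum_(a <- Pos) _; set S' := \sum_(a <- Pos) _; set S'' := \sum_(a <- Pos) _.
suff -> : S = (form eta X)%:C * S' + S'' by ring.
rewrite /S /S' /S'' mulr_sumr -big_split /= !big_seq; apply: eq_bigr => a aP.
suff -> : diff_quot a (fun Y => (form eta Y)%:C * H Y) X =
    (form eta X)%:C * diff_quot a H X + (2 * form a eta / form a a)%:C * H (refl a X).
  by rewrite [(form a xi * _)%:C]rmorphM /=; ring.
have a0 := nondegenerate aP; have aC : (form a a)%:C != 0 by rewrite fmorph_eq0.
rewrite /diff_quot (cderiveM a (csmooth_on_form eta oU) sH UX) cderive_form.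
case: ifPn => [/eqP aX0|aX0].
  by rewrite (refl_fix aX0) (form_sym eta a) [2 * form a eta / _]mulrAC rmorphM /=; ring.
have aXC : (form a X)%:C != 0 by rewrite fmorph_eq0.
have -> : (form eta (refl a X))%:C =
    (form eta X)%:C - (2 * form a eta / form a a)%:C * (form a X)%:C.
  rewrite -rmorphM -rmorphB /refl form_subr form_scaler (form_sym eta a) /=.
  by congr (_%:C); field.
move: aXC; set u := (form a X)%:C; set v := (form eta X)%:C; set c := (_ / _)%:C.
by move=> u0; field; rewrite aC u0.
Qed.

(** The commutator of the Dunkl Laplacian with multiplication by [<X, X>] is twice
    [sum_i <e_i, X> T_(e^i)] plus twice [sum_i T_(e_i) <e^i, X>]. By Euler's identity
    the first sum, and the second up to the contributions of [dunklM_form], is [T_X],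
    that is [w] plus reflection terms. The values of [H] at reflected points cancel
    and leave a scalar. *)
Lemma dunkl_laplaceM_Q H U X w : open U -> csmooth_on U H -> homogeneous_on U w H ->
  core (core U) X ->
  Lap (fun Y => (form Y Y)%:C * H Y) X = (form X X)%:C * Lap H X +
    (4 * w + 2 * n.+2%:R + 4 * gamma Pos k) * H X.
Proof.
move=> oU sH hH cX; have oW := open_reflect_core (Pos := Pos) oU.
have WX : core U X by case: cX.
have UX : U X by case: WX.
set L := Lap H X; rewrite /dunkl_laplace.
pose D i := T (dual_basis R i) H.
have sD i : csmooth_on (core U) (D i) by exact: csmooth_on_dunkl.
have sHW : csmooth_on (core U) H by exact: csmooth_on_sub (@reflect_core_sub _ _ _ U) sH.
have step i : T (basis R i) (T (dual_basis R i) (fun Y => (form Y Y)%:C * H Y)) X =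
    (form X X)%:C * T (basis R i) (D i) X + (2 * form (basis R i) X)%:C * D i X +
    2 * ((form (dual_basis R i) X)%:C * T (basis R i) H X +
         (form (dual_basis R i) (basis R i))%:C * H X +
     \sum_(a <- Pos) k a * (form a (basis R i) *
         (2 * form a (dual_basis R i) / form a a))%:C * H (refl a X)).
  rewrite (dunkl_eq (G := fun Y => (form Y Y)%:C * D i Y +
     2 * ((form (dual_basis R i) Y)%:C * H Y)) k (basis R i) oW cX); last first.
    move=> Y WY; rewrite (dunklM_Q _ oU sH WY); congr (_ + _).
    by rewrite rmorphM /= (_ : 2%:C = 2 :> R[i]) ?rmorph_nat // mulrA.
  have s1 : csmooth_on (core U) (fun Y => (form (dual_basis R i) Y)%:C * H Y).
    by apply: csmooth_onM => //; exact: csmooth_on_form.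
  rewrite (dunklD Pos k (basis R i) (U := core U) _ _ WX).
  - by rewrite (dunklM_Q _ oW (sD i) cX) (dunklZ Pos k (basis R i) 2 oW s1 WX) (dunklM_form _ _ oU sH WX).
  - by apply: csmooth_onM => //; exact: csmooth_on_Q.
  - by apply: csmooth_onM => //; exact: csmooth_on_cst.
under eq_bigr do rewrite step.
have split_sum (c : R[i]) (A B C E F' : 'I_n.+2 -> R[i]) :
    \sum_i (A i + B i + c * (C i + E i + F' i)) =
    \sum_i A i + \sum_i B i + c * (\sum_i C i + \sum_i E i + \sum_i F' i).
  by rewrite big_split /= big_split /= -mulr_sumr big_split /= [X in c * (X + _)]big_split.
rewrite split_sum -mulr_sumr -/L -addrA; congr (_ + _).
(* Euler's identity for the derivative part of [T_X]. *)
have E0 : T X H X = w * H X + \sum_(a <- Pos) k a * (H X - H (refl a X)).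
  rewrite /dunkl (cderive_euler (w := w) oU UX); last by move=> l l0 Ul; exact: hH.
  congr (_ + _); rewrite !big_seq; apply: eq_bigr => a aP; rewrite -mulrA; congr (_ * _).
  rewrite /diff_quot; case: ifPn => [/eqP aX|aX].
    by rewrite aX mul0r refl_fix // subrr.
  by rewrite mulrC divfK // fmorph_eq0.
have E1 : \sum_i (2 * form (basis R i) X)%:C * D i X = 2 * T X H X.
  have := dunkl_sum_dir Pos k (index_enum _) (fun i => form X (basis R i))
    (@dual_basis R n) oU sH UX.
  rewrite -dual_basis_expand => ->; rewrite mulr_sumr.
  apply: eq_bigr => i _; rewrite rmorphM /= mulrA (form_sym X).
  by rewrite (_ : 2%:C = 2 :> R[i]) ?rmorph_nat.
have E2 : \sum_i (form (dual_basis R i) X)%:C * T (basis R i) H X = T X H X.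
  have := dunkl_sum_dir Pos k (index_enum _) (fun i => form X (dual_basis R i))
    (@basis R n) oU sH UX.
  rewrite -basis_expand => ->.
  by apply: eq_bigr => i _; rewrite (form_sym X).
have E3 : \sum_(i < n.+2) (form (dual_basis R i) (basis R i))%:C * H X = n.+2%:R * H X.
  under eq_bigr do rewrite form_sym form_dual_basis eqxx mul1r.
  by rewrite sumr_const card_ord mulr_natl.
have E4 : \sum_(i < n.+2) \sum_(a <- Pos) k a * (form a (basis R i) *
     (2 * form a (dual_basis R i) / form a a))%:C * H (refl a X) =
     2 * \sum_(a <- Pos) k a * H (refl a X).
  rewrite exchange_big mulr_sumr /= !big_seq; apply: eq_bigr => a aP.
  rewrite -mulr_suml -mulr_sumr -rmorph_sum /=.
  have -> : \sum_(i < n.+2) form a (basis R i) * (2 * form a (dual_basis R i) / form a a) = 2.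
    transitivity (\sum_(i < n.+2) (form a (basis R i) * form a (dual_basis R i)) * (2 / form a a)).
      by apply: eq_bigr => i _; ring.
    by rewrite -mulr_suml sum_form_dual; have := nondegenerate aP => ?; field.
  by rewrite (_ : 2%:C = 2 :> R[i]) ?rmorph_nat //; ring.
rewrite E1 E2 E3 E4 E0 /gamma.
have -> : \sum_(a <- Pos) k a * (H X - H (refl a X)) =
    (\sum_(a <- Pos) k a) * H X - \sum_(a <- Pos) k a * H (refl a X).
  by rewrite mulr_suml -sumrB; apply: eq_bigr => a _; ring.
by ring.
Qed.

End DunklLaplacian.

(** * Powers of the Dunkl Laplacian *)

Section Iterates.
Variables (R : realType) (n : nat).
Local Notation amb := 'rV[R]_(n.+2).
Variables (Pos : {fset amb}) (k : amb -> R[i]).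
Hypothesis nondegenerate : forall a, a \in Pos -> form a a != 0.
Implicit Types (X Y a xi eta : amb) (U : set amb) (F G H : amb -> R[i]) (w : R[i]).

Local Notation T := (dunkl Pos k).
Local Notation Lap := (dunkl_laplace Pos k).
Local Notation core := (reflect_core Pos).

(** Each of the two Dunkl operators in the Laplacian shrinks the domain once. *)
Definition iter_core m U : set amb := iter m (fun U => core (core U)) U.

Lemma iter_coreS_sub m U : iter_core m.+1 U `<=` iter_core m U.
Proof. by move=> X [[]]. Qed.

Lemma open_iter_core m U : open U -> open (iter_core m U).
Proof. by move=> oU; elim: m => //= m IHm; do 2 apply: open_reflect_core. Qed.

Lemma csmooth_on_laplace F U : open U -> csmooth_on U F -> csmooth_on (core (core U)) (Lap F).
Proof.
move=> oU sF; have oW := open_reflect_core (Pos := Pos) oU.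
apply: csmooth_on_sum => [|i]; first exact: open_reflect_core.
by apply: csmooth_on_dunkl => //; exact: csmooth_on_dunkl.
Qed.

Lemma laplace_eq F G U X : open U -> core (core U) X ->
  (forall Y, U Y -> F Y = G Y) -> Lap F X = Lap G X.
Proof.
move=> oU cX FG; apply: eq_bigr => i _.
apply: (dunkl_eq k _ (open_reflect_core oU) cX) => Y cY.
exact: (dunkl_eq k _ oU cY FG).
Qed.

Lemma laplace_lin (c : R[i]) F G U X : open U -> csmooth_on U F -> csmooth_on U G ->
  core (core U) X -> Lap (fun Y => F Y + c * G Y) X = Lap F X + c * Lap G X.
Proof.
move=> oU sF sG cX; have oW := open_reflect_core (Pos := Pos) oU.
have WX : core U X by case: cX.
rewrite /dunkl_laplace mulr_sumr -big_split /=; apply: eq_bigr => i _.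
have sTF := csmooth_on_dunkl k nondegenerate (dual_basis R i) oU sF.
have sTG := csmooth_on_dunkl k nondegenerate (dual_basis R i) oU sG.
have scTG : csmooth_on (core U) (fun Y => c * T (dual_basis R i) G Y).
  by apply: csmooth_onM => //; exact: csmooth_on_cst.
have scG : csmooth_on U (fun Y => c * G Y).
  by apply: csmooth_onM => //; exact: csmooth_on_cst.
rewrite -(dunklZ Pos k _ c oW sTG WX) -(dunklD Pos k _ sTF scTG WX).
apply: (dunkl_eq k _ oW cX) => Y [UY _].
by rewrite (dunklD Pos k _ sF scG UY) (dunklZ Pos k _ c oU sG UY).
Qed.

Lemma laplace_homogeneous F U w : open U -> csmooth_on U F ->
  homogeneous_on U w F -> homogeneous_on (core (core U)) (w - 2%:R) (Lap F).
Proof.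
move=> oU sF hF l X l0 cX clX; have oW := open_reflect_core (Pos := Pos) oU.
rewrite /dunkl_laplace mulr_sumr; apply: eq_bigr => i _.
have sTF := csmooth_on_dunkl k nondegenerate (dual_basis R i) oU sF.
have hTF : homogeneous_on (core U) (w - 1) (T (dual_basis R i) F).
  exact: dunkl_homogeneous.
rewrite (dunkl_homogeneous k _ oW sTF hTF l0 cX clX).
by congr (cpow _ _ * _); ring.
Qed.

Lemma csmooth_on_iter m F U : open U -> csmooth_on U F ->
  csmooth_on (iter_core m U) (iter m Lap F).
Proof.
move=> oU sF; elim: m => //= m IHm; apply: csmooth_on_laplace => //.
exact: open_iter_core.
Qed.

Lemma iter_laplace_eq m F G U X : open U -> iter_core m U X ->
  (forall Y, U Y -> F Y = G Y) -> iter m Lap F X = iter m Lap G X.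
Proof.
move=> oU + FG; elim: m X => [|m IHm] X; first exact: FG.
have oW : open (iter_core m U) by exact: open_iter_core.
by move=> mX; apply: (laplace_eq oW mX) => Y; exact: IHm.
Qed.

Lemma iter_laplace_lin m (c : R[i]) F G U X : open U -> csmooth_on U F ->
  csmooth_on U G -> iter_core m U X ->
  iter m Lap (fun Y => F Y + c * G Y) X = iter m Lap F X + c * iter m Lap G X.
Proof.
move=> oU sF sG; elim: m X => // m IHm X mX.
have oW : open (iter_core m U) by exact: open_iter_core.
rewrite !iterS (laplace_eq oW mX IHm) (laplace_lin c oW _ _ mX) //.
  exact: csmooth_on_iter.
exact: csmooth_on_iter.
Qed.

Lemma iter_laplace_homogeneous m F U w : open U -> csmooth_on U F ->
  homogeneous_on U w F -> homogeneous_on (iter_core m U) (w - (2 * m)%:R) (iter m Lap F).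
Proof.
move=> oU sF hF; elim: m => [|m IHm]; first by rewrite muln0 subr0.
have -> : w - (2 * m.+1)%:R = w - (2 * m)%:R - 2%:R by rewrite mulnS natrD; ring.
apply: laplace_homogeneous => //; first exact: open_iter_core.
exact: csmooth_on_iter.
Qed.

(** The sum of the scalars of [dunkl_laplaceM_Q] for the degrees [w - 2 i], [i < m]. *)
Definition commutator_coef m w : R[i] :=
  m%:R * (4 * w - 4 * m%:R + 4 + 2 * n.+2%:R + 4 * gamma Pos k).

Lemma iter_laplaceM_Q m H U w X : open U -> csmooth_on U H -> homogeneous_on U w H ->
  iter_core m U X ->
  iter m Lap (fun Y => (form Y Y)%:C * H Y) X =
    (form X X)%:C * iter m Lap H X + commutator_coef m w * iter m.-1 Lap H X.
Proof.
move=> oU sH hH; elim: m X => [|m IHm] X mX.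
  by rewrite /commutator_coef !mul0r addr0.
have oW : open (iter_core m U) by exact: open_iter_core.
have sm : csmooth_on (iter_core m U) (iter m Lap H) by exact: csmooth_on_iter.
have sQ : csmooth_on (iter_core m U) (fun Y => (form Y Y)%:C * iter m Lap H Y).
  by apply: csmooth_onM => //; exact: csmooth_on_Q.
have sm1 : csmooth_on (iter_core m U) (iter m.-1 Lap H).
  case: m {mX IHm oW sm sQ} => [//|m] /=.
  by apply: csmooth_on_sub (@iter_coreS_sub m U) _; exact: csmooth_on_iter.
rewrite iterS (laplace_eq oW mX IHm) (laplace_lin _ oW sQ sm1 mX).
have hm : homogeneous_on (iter_core m U) (w - (2 * m)%:R) (iter m Lap H).
  exact: iter_laplace_homogeneous.
rewrite (dunkl_laplaceM_Q k nondegenerate oW sm hm mX).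
rewrite -addrA; congr (_ + _).
(* For [m = 0] the truncated predecessor is harmless, as the coefficient vanishes. *)
have -> : commutator_coef m w * Lap (iter m.-1 Lap H) X =
    commutator_coef m w * iter m Lap H X.
  by case: m {mX IHm oW sm sQ sm1 hm} => [|m] //; rewrite /commutator_coef !mul0r.
rewrite -mulrDl; congr (_ * _).
by rewrite /commutator_coef natrM -!natr1; ring.
Qed.

Hypothesis euclidean : forall a, a \in Pos -> a 0 ord0 = a 0 ord_max.

Lemma cone_core U : @cone R n `<=` U -> @cone R n `<=` core U.
Proof.
move=> cU X cX; split=> [|a aP]; apply: cU => //.
by apply: isometry_cone cX; apply: refl_space_isometry; [exact: nondegenerate|exact: euclidean].
Qed.

Lemma cone_iter_core m U : @cone R n `<=` U -> @cone R n `<=` iter_core m U.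
Proof. by move=> cU; elim: m => //= m IHm; do 2 apply: cone_core. Qed.

End Iterates.

(** * Independence of the extension *)

Section DivisionByQ.
Variables (R : realType) (n : nat).
Local Notation amb := 'rV[R]_(n.+2).
Implicit Types (X Y : amb) (U : set amb) (F H : amb -> R[i]) (w : R[i]).

(** The coefficient in [X = cone_proj X + cone_defect X *: time_axis]. *)
Definition cone_defect X : R := (time X - space_norm X) / 2.

Lemma slide_cone_defect X : slide cone_defect (@time_axis R n) 1 X = cone_proj X.
Proof.
rewrite /slide mul1r /cone_proj -scaleNr; congr (_ + _ *: _).
by rewrite /cone_defect -mulNr opprB.
Qed.

Lemma Q_cone_defect X : spacelike_nonzero X ->
  form X X = - (cone_defect X * (space_norm X + time X)).
Proof.
move=> X0; rewrite /cone_defect.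
have := sqr_sqrtr (ltW X0); rewrite -/(space_norm X) /space_sq => E.
have -> : form X X = (space_norm X ^+ 2 - time X ^+ 2) / 2 by rewrite E; field.
by field.
Qed.

(** Hadamard's lemma along the time axis divides [F] by [cone_defect], and [<X, X>]
    is [cone_defect] times the nonvanishing factor [- (space_norm X + time X)]. *)
Lemma divide_Q U F w : open U -> @cone R n `<=` U -> csmooth_on U F ->
  homogeneous_on U w F -> (forall X, cone X -> F X = 0) ->
  exists W H, [/\ open W, @cone R n `<=` W, W `<=` U,
    csmooth_on W H /\ homogeneous_on W (w - 2%:R) H &
    forall X, W X -> F X = (form X X)%:C * H X].
Proof.
move=> oU cU sF hF F0.
pose V0 : set amb := U `&` @spacelike_nonzero R n.
have oV0 : open V0 by apply: openI => //; exact: open_spacelike.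
have snV : smooth_on V0 (@space_norm R n).
  by apply: smooth_on_sub (@smooth_on_space_norm R n) => X [].
have sth : smooth_on V0 cone_defect.
  apply: smooth_onM => //; last exact: smooth_on_cst.
  by apply: smooth_onB => //; exact: smooth_on_time.
pose S := slide cone_defect (@time_axis R n) 1.
pose W : set amb := [set X | (V0 X /\ V0 (S X)) /\ 0 < time X].
have oW : open W.
  rewrite openE => X [[VX VSX] tX].
  have : \forall Y \near X, (V0 Y /\ V0 (S Y)) /\ 0 < time Y.
    near=> Y; split; first split.
    - by near: Y; exact: open_nbhs_nbhs.
    - rewrite /S slide_cone_defect; near: Y.
      apply: (smooth_map_continuous (@smooth_map_cone_proj R n) VX.2).
      by rewrite -slide_cone_defect; exact: open_nbhs_nbhs.
    - near: Y; have ct := smooth_on_continuous (@smooth_on_time R n _ openT) (I : setT X).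
      exact: (cvgr_gt _ ct).
  by [].
have posn X : W X -> 0 < space_norm X + time X.
  by move=> [[[_ X0] _] tX]; rewrite addr_gt0 // sqrtr_gt0.
pose dd := cdivided_difference cone_defect (@time_axis R n) F.
have sdd : csmooth_on W dd.
  apply: csmooth_on_sub (csmooth_on_cdivided_difference (@time_axis R n) oV0 _ sth).
    by move=> X [].
  by apply: csmooth_on_sub sF => X [].
have FE X : W X -> F X = (cone_defect X)%:C * dd X.
  move=> [[[UX X0] _] tX]; rewrite /dd cdivided_differenceE slide_cone_defect.
  case: ifPn => [/eqP th0|th0].
    rewrite th0 mul0r F0 // -[X](_ : cone_proj X = X); first exact: cone_proj_cone.
    by rewrite -slide_cone_defect /slide th0 mulr0 scale0r subr0.
  rewrite (F0 (cone_proj X)) ?subr0; last exact: cone_proj_cone.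
  by rewrite mulrC divfK // fmorph_eq0.
exists W, (fun X => (- (space_norm X + time X)^-1)%:C * dd X); split => //.
- move=> X cX; rewrite /W /= /S slide_cone_defect cone_proj_id //.
  have VX : V0 X by split; [exact: cU|exact: cone_spacelike].
  by split => //; case: cX => _; rewrite -subr_gt0.
- by move=> X [[[]]].
- split.
    apply: csmooth_onM => //; apply: csmooth_on_real => //; apply: smooth_onN => //.
    apply: smooth_onV => //; last by move=> X /posn /lt0r_neq0.
    apply: smooth_onD => //; last exact: smooth_on_time.
    by apply: smooth_on_sub snV => X [[]].
  move=> l X l0 WX WlX; rewrite space_normZ // timeZ -mulrDr.
  have lC0 : l%:C != 0 by rewrite fmorph_eq0 gt_eqF.
  have pC0 : (space_norm X + time X)%:C != 0 by rewrite fmorph_eq0 gt_eqF ?posn.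
  have ddl : dd (l *: X) = cpow l (w - 1) * dd X.
    case: (WX) (WlX) => [[[UX X0] VSX] tX] [[[UlX _] VSlX] _].
    rewrite /dd !cdivided_differenceE !slide_cone_defect.
    have -> : cone_defect (l *: X) = l * cone_defect X.
      by rewrite /cone_defect space_normZ // timeZ; ring.
    rewrite mulf_eq0 gt_eqF //=; case: ifPn => [_|th0].
      exact: (cderive_homogeneous _ oU sF hF l0 UX UlX).
    have cl : cone (cone_proj (l *: X)) by apply: cone_proj_cone; exact: spacelikeZ.
    rewrite hF // (F0 _ cl) (F0 (cone_proj X)) ?subr0; last exact: cone_proj_cone.
    have := cpowB_nat w 1 l0; rewrite expr1 => <-.
    by rewrite rmorphM /=; field; rewrite lC0 fmorph_eq0 th0.
  rewrite ddl; have := cpowB_nat (w - 1) 1 l0; rewrite expr1 => <-.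
  rewrite (_ : w - 1 - 1%:R = w - 2%:R); last by ring.
  rewrite !rmorphN !fmorphV !rmorphM /=.
  move: pC0; move: (space_norm X + time X)%:C => u u0.
  by field; rewrite lC0 u0.
- move=> X WX; rewrite FE // (Q_cone_defect (X := X)); last by case: WX => [[[]]].
  have p0 : space_norm X + time X != 0 by rewrite gt_eqF ?posn.
  rewrite mulrA -rmorphM /=; congr (_%:C * _).
  by field.
Unshelve. all: by end_near. Qed.

End DivisionByQ.

Section Independence.
Variables (R : realType) (n : nat).
Local Notation amb := 'rV[R]_(n.+2).
Variables (Pos : {fset amb}) (k : amb -> R[i]).
Hypothesis nondegenerate : forall a, a \in Pos -> form a a != 0.
Hypothesis euclidean : forall a, a \in Pos -> a 0 ord0 = a 0 ord_max.

(** Two extensions differ by [<X, X> H] with [H] of degree [w - 2], and the value of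
    [w] is the one for which [commutator_coef] vanishes at that degree. *)
Lemma iter_laplace_extension j w (f F1 F2 : amb -> R[i]) X :
  w = - (n%:R / 2%:R) + j%:R - gamma Pos k ->
  extension w f F1 -> extension w f F2 -> cone X ->
  iter j (dunkl_laplace Pos k) F1 X = iter j (dunkl_laplace Pos k) F2 X.
Proof.
move=> wE [U1 [oU1 cU1 sF1 F1f hF1]] [U2 [oU2 cU2 sF2 F2f hF2]] cX.
pose U := U1 `&` U2; have oU : open U by exact: openI.
have cU : @cone R n `<=` U by move=> Y cY; split; [exact: cU1|exact: cU2].
have s1 : csmooth_on U F1 by apply: csmooth_on_sub sF1 => Y [].
have s2 : csmooth_on U F2 by apply: csmooth_on_sub sF2 => Y [].
pose F Y := F1 Y + -1 * F2 Y.
have sF : csmooth_on U F.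
  by apply: csmooth_onD => //; apply: csmooth_onM => //; exact: csmooth_on_cst.
have hF : homogeneous_on U w F.
  move=> l Y l0 [U1Y U2Y] [U1l U2l]; rewrite /F hF1 // hF2 //; ring.
have F0 Y : cone Y -> F Y = 0 by move=> cY; rewrite /F F1f // F2f //; ring.
have [W [H [oW cW WU [sH hH] FQ]]] := divide_Q oU cU sF hF F0.
have mX V : @cone R n `<=` V -> iter_core Pos j V X.
  by move=> cV; apply: cone_iter_core cX.
have := iter_laplace_lin k nondegenerate (-1) oU s1 s2 (mX U cU).
rewrite -/F (iter_laplace_eq k oW (mX W cW) FQ).
rewrite (iter_laplaceM_Q k nondegenerate oW sH hH (mX W cW)).
case: (cX) => -> _; rewrite mul0r add0r.
have -> : commutator_coef Pos k j (w - 2%:R) = 0.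
  rewrite /commutator_coef wE -!natr1; apply/eqP; rewrite mulf_eq0; apply/orP; right.
  by apply/eqP; field.
by rewrite mul0r mulN1r => /esym/eqP; rewrite subr_eq0 => /eqP.
Qed.

End Independence.

(** * Equivariance under the reflection group *)

Section Equivariance.
Variables (R : realType) (n : nat).
Local Notation amb := 'rV[R]_(n.+2).
Variables (Phi Pos : {fset amb}) (k : amb -> R[i]).
Hypotheses (rootsPhi : root_system Phi) (euclPhi : euclidean_roots Phi)
  (posPhi : positive_roots Phi Pos) (multk : multiplicity Phi k).
Implicit Types (X Y a b xi eta : amb) (F G H : amb -> R[i]) (g h : amb -> amb).

Local Notation T := (dunkl Pos k).
Local Notation Lap := (dunkl_laplace Pos k).
Local Notation S := (@spacelike_nonzero R n).

Lemma pos_root a : a \in Pos -> a \in Phi.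
Proof. by case: posPhi => v [_ ->] /andP[]. Qed.

Lemma pos_nondegenerate a : a \in Pos -> form a a != 0.
Proof. by move=> /pos_root; case: rootsPhi => nd _ _; exact: nd. Qed.

Lemma pos_euclidean a : a \in Pos -> a 0 ord0 = a 0 ord_max.
Proof. by move=> /pos_root; exact: euclPhi. Qed.

Lemma root_isometry b : b \in Phi -> space_isometry (refl b).
Proof.
by move=> bP; apply: refl_space_isometry; [case: rootsPhi => + _ _; exact|exact: euclPhi].
Qed.

Lemma spacelike_isometry g X : space_isometry g -> S X -> S (g X).
Proof. by move=> ig; rewrite /spacelike_nonzero /= isometry_space_sq. Qed.

(** The reflections preserve this set, so that here the Dunkl operators do not shrink
    the domain. *)
Lemma spacelike_core : S `<=` reflect_core Pos S.
Proof.
move=> X SX; split=> // a /pos_root aP.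
exact: spacelike_isometry (root_isometry aP) SX.
Qed.

Lemma csmooth_spacelike_dunkl xi F : csmooth_on S F -> csmooth_on S (T xi F).
Proof.
move=> sF; apply: csmooth_on_sub spacelike_core _.
by apply: csmooth_on_dunkl => //; [exact: pos_nondegenerate|exact: open_spacelike].
Qed.

Lemma spacelike_core2 : S `<=` reflect_core Pos (reflect_core Pos S).
Proof.
move=> X SX; split=> [|a /pos_root aP]; apply: spacelike_core => //.
exact: spacelike_isometry (root_isometry aP) SX.
Qed.

Lemma csmooth_spacelike_laplace F : csmooth_on S F -> csmooth_on S (Lap F).
Proof.
move=> sF; apply: csmooth_on_sub spacelike_core2 _.
by apply: csmooth_on_laplace => //; [exact: pos_nondegenerate|exact: open_spacelike].
Qed.

Lemma csmooth_spacelike_iter m F : csmooth_on S F -> csmooth_on S (iter m Lap F).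
Proof. by move=> sF; elim: m => //= m; exact: csmooth_spacelike_laplace. Qed.

Lemma csmooth_spacelike_isometry g F : space_isometry g -> csmooth_on S F ->
  csmooth_on S (F \o g).
Proof.
move=> ig sF; have oS := @open_spacelike R n.
apply: (csmooth_on_comp oS oS sF); first exact: smooth_map_isometry.
by move=> X; exact: spacelike_isometry.
Qed.

Lemma spacelike_laplace_eq F G X : S X -> (forall Y, S Y -> F Y = G Y) -> Lap F X = Lap G X.
Proof. by move=> SX; apply: laplace_eq (@open_spacelike R n) _; exact: spacelike_core2. Qed.

Lemma spacelike_dunkl_eq xi F G X : S X -> (forall Y, S Y -> F Y = G Y) ->
  T xi F X = T xi G X.
Proof. by move=> SX; apply: dunkl_eq (@open_spacelike R n) _; exact: spacelike_core. Qed.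

Lemma dunkl_sum xi (I : Type) (r : seq I) (c : I -> R[i]) (F : I -> amb -> R[i]) X :
  (forall i, csmooth_on S (F i)) -> S X ->
  T xi (fun Y => \sum_(i <- r) c i * F i Y) X = \sum_(i <- r) c i * T xi (F i) X.
Proof.
move=> sF SX; have oS := @open_spacelike R n.
have scF i : csmooth_on S (fun Y => c i * F i Y).
  by apply: csmooth_onM => //; exact: csmooth_on_cst.
elim: r => [|i r IHr].
  rewrite big_nil (spacelike_dunkl_eq (G := fun Y => 0 * cst 0 Y) _ SX); last first.
    by move=> Y _; rewrite big_nil mul0r.
  by rewrite (dunklZ Pos k _ _ oS (csmooth_on_cst 0 oS) SX) mul0r.
rewrite big_cons -IHr -(dunklZ Pos k _ _ oS (sF i) SX).
rewrite -(dunklD Pos k _ (scF i) (csmooth_on_sum r oS scF) SX).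
by apply: spacelike_dunkl_eq => // Y _; rewrite big_cons.
Qed.

Lemma root_opp a : a \in Phi -> - a \in Phi.
Proof.
case: rootsPhi => _ cP _ aP; have := cP a (-1) aP.
by rewrite scaleN1r eqxx orbT.
Qed.

Lemma mult_opp a : a \in Phi -> k (- a) = k a.
Proof.
move=> aP; rewrite -(multk (refl_group_refl aP) aP); congr k.
have a0 : form a a != 0 by case: rootsPhi => + _ _; exact.
rewrite /refl (_ : 2 * form a a / form a a = 2); last by field.
by rewrite scaler_nat mulr2n opprD addrA subrr add0r.
Qed.

(** A sum over the positive roots of a summand that is even in the root is half
    the sum over all roots, whatever the choice of positive roots. *)
Lemma sum_pos_roots (f : amb -> R[i]) : (forall a, a \in Phi -> f (- a) = f a) ->
  \sum_(a <- Phi) f a = 2 * \sum_(a <- Pos) f a.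
Proof.
move=> fN; case: posPhi => v [v0 PosE].
rewrite (bigID (fun a => 0 < form a v)) /= mulr_natl mulr2n; congr (_ + _).
  rewrite -big_filter; apply: perm_big; apply: uniq_perm.
  - by rewrite filter_uniq // fset_uniq.
  - exact: fset_uniq.
  - by move=> a; rewrite mem_filter PosE andbC.
have fN' a : a \in Pos -> f a = f (- a) by move=> /pos_root /fN ->.
rewrite [RHS](eq_big_seq (fun a => f (- a))) //.
rewrite -(big_map -%R xpredT f) -big_filter; apply: perm_big; apply: uniq_perm.
- by rewrite filter_uniq // fset_uniq.
- by rewrite map_inj_uniq ?fset_uniq //; exact: oppr_inj.
move=> a; rewrite mem_filter; apply/idP/idP.
  move=> /andP[av aP]; apply/mapP; exists (- a); last by rewrite opprK.
  rewrite PosE root_opp //= -scaleN1r form_scalel mulN1r oppr_gt0.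
  by rewrite lt_def eq_sym v0 //= leNgt.
move=> /mapP[b]; rewrite PosE => /andP[bP bv] ->.
by rewrite root_opp // andbT -scaleN1r form_scalel mulN1r oppr_gt0 -leNgt ltW.
Qed.

Lemma sum_roots_refl b (f : amb -> R[i]) : b \in Phi ->
  \sum_(a <- Phi) f (refl b a) = \sum_(a <- Phi) f a.
Proof.
move=> bP; rewrite -(big_map (refl b) xpredT f); apply: perm_big.
have b0 : form b b != 0 by case: rootsPhi => + _ _; exact.
case: rootsPhi => _ _ /(_ b bP) E.
apply: uniq_perm; last 1 first.
- move=> a; apply/idP/idP => [/mapP[c cP ->]|aP].
    have : [set` Phi] (refl b c) by rewrite E; exists c.
    by [].
  have : [set` Phi] a by [].
  by rewrite E => -[c cP <-]; apply: map_f.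
- by rewrite map_inj_uniq ?fset_uniq //; exact: can_inj (refl_invol b0).
- exact: fset_uniq.
Qed.

Lemma refl_isometry g a X : space_isometry g -> refl (g a) (g X) = g (refl a X).
Proof.
move=> ig; case: (ig) => _ fg _; rewrite /refl !fg.
have gN Y : g (- Y) = - g Y by have := isometryZ ig (-1) Y; rewrite !scaleN1r.
by rewrite isometryD // gN (isometryZ ig).
Qed.

Lemma diff_quot_isometry g a F X : space_isometry g ->
  diff_quot a (F \o g) X = diff_quot (g a) F (g X).
Proof.
move=> ig; case: (ig) => lg fg _.
by rewrite /diff_quot !fg (refl_isometry a X ig) (@cderive_linear_comp R amb amb F g a X).
Qed.

Lemma diff_quot_opp a F X : csmooth_on S F -> S X -> diff_quot (- a) F X = - diff_quot a F X.
Proof.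
move=> sF SX; have oS := @open_spacelike R n.
have fN b Y : form (- b) Y = - form b Y by rewrite -scaleN1r form_scalel mulN1r.
have rN : refl (- a) X = refl a X.
  rewrite /refl !fN (form_sym a (- a)) fN opprK scalerN -scaleNr; congr (_ - _ *: _).
  by rewrite mulrN mulNr opprK.
rewrite /diff_quot rN !fN (form_sym a (- a)) fN opprK oppr_eq0.
rewrite -[- a]scaleN1r (cderiveZ_dir _ _ oS sF SX) rmorphN /= mulN1r mulrN.
by case: ifP => // _; rewrite rmorphN /= invrN mulrN.
Qed.

(** A reflection does not permute the positive roots but it permutes all roots, and
    the summand is even in the root. *)
Lemma dunkl_refl b xi F X : b \in Phi -> csmooth_on S F -> S X ->
  T xi (F \o refl b) X = T (refl b xi) F (refl b X).
Proof.
move=> bP sF SX; have ig := root_isometry bP; case: (ig) => lg fg _.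
have SgX := spacelike_isometry ig SX.
rewrite /dunkl (@cderive_linear_comp R amb amb F (refl b) xi X); last by move=> t; rewrite lg.
congr (_ + _).
pose f eta G Y a := k a * (form a eta)%:C * diff_quot a G Y.
have f_even eta G Y a : csmooth_on S G -> S Y -> a \in Phi -> f eta G Y (- a) = f eta G Y a.
  move=> sG SY aP; rewrite /f mult_opp // diff_quot_opp // -scaleN1r form_scalel mulN1r.
  by rewrite rmorphN /=; ring.
have two0 : (2 : R[i]) != 0 by rewrite pnatr_eq0.
apply: (mulfI two0).
have sFg := csmooth_spacelike_isometry ig sF.
rewrite -(@sum_pos_roots (f xi (F \o refl b) X)); last by move=> a; exact: f_even.
rewrite -(@sum_pos_roots (f (refl b xi) F (refl b X))); last by move=> a; exact: f_even.
rewrite -(@sum_roots_refl b (f (refl b xi) F (refl b X)) bP).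
rewrite !big_seq; apply: eq_bigr => a aP; rewrite /f fg.
by rewrite (multk (refl_group_refl bP) aP) diff_quot_isometry.
Qed.

(** The reflected dual basis is expanded over the dual basis; moved to the outer
    Dunkl operators, the coefficients undo the reflection of the basis. *)
Lemma laplace_refl b F X : b \in Phi -> csmooth_on S F -> S X ->
  Lap (F \o refl b) X = Lap F (refl b X).
Proof.
move=> bP sF SX; have ig := root_isometry bP; case: (ig) => lg fg _.
have b0 : form b b != 0 by case: rootsPhi => + _ _; exact.
have SgX := spacelike_isometry ig SX; have oS := @open_spacelike R n.
rewrite /dunkl_laplace.
pose c i l := form (refl b (dual_basis R i)) (basis R l).
have sT eta : csmooth_on S (T eta F) by exact: csmooth_spacelike_dunkl.
have step i : T (basis R i) (T (dual_basis R i) (F \o refl b)) X =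
    \sum_l (c i l)%:C * T (refl b (basis R i)) (T (dual_basis R l) F) (refl b X).
  rewrite (spacelike_dunkl_eq (G := T (refl b (dual_basis R i)) F \o refl b) _ SX); last first.
    by move=> Y SY; rewrite dunkl_refl.
  rewrite dunkl_refl // -dunkl_sum //; apply: spacelike_dunkl_eq => // Y SY.
  by rewrite -(dunkl_sum_dir Pos k _ _ _ oS sF SY) -dual_basis_expand.
transitivity (\sum_i \sum_l (c i l)%:C *
    T (refl b (basis R i)) (T (dual_basis R l) F) (refl b X)).
  by apply: eq_bigr => i _; exact: step.
transitivity (\sum_l \sum_i (c i l)%:C *
    T (refl b (basis R i)) (T (dual_basis R l) F) (refl b X)).
  exact: exchange_big.
apply: eq_bigr => l _.
rewrite -(dunkl_sum_dir Pos k _ _ _ oS (sT _) SgX).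
suff -> : \sum_i c i l *: refl b (basis R i) = basis R l by [].
rewrite -[RHS](refl_invol b0) [X in _ = refl b X]basis_expand.
elim: (index_enum _) => [|i r IHr]; first by rewrite !big_nil (isometry0 ig).
rewrite !big_cons (isometryD ig) (isometryZ ig) IHr; congr (_ *: _ + _).
by rewrite /c -[in RHS]fg (refl_invol b0) form_sym.
Qed.

Lemma iter_laplace_group m g F X : refl_group Phi g -> csmooth_on S F -> S X ->
  iter m Lap (F \o g) X = iter m Lap F (g X).
Proof.
move=> gP; elim: gP F X => {g} [|b bP|g h gP IHg hP IHh] F X sF SX //.
  elim: m X SX => [//|m IHm] X SX; rewrite !iterS.
  have sm : csmooth_on S (iter m Lap F) by exact: csmooth_spacelike_iter.
  rewrite -(laplace_refl bP sm SX).
  exact: spacelike_laplace_eq.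
have [ig ih] := (refl_group_isometry rootsPhi euclPhi gP, refl_group_isometry rootsPhi euclPhi hP).
have sFg := csmooth_spacelike_isometry ig sF.
transitivity (iter m Lap (F \o g) (h X)); first exact: IHh.
exact: (IHg F _ sF (spacelike_isometry ih SX)).
Qed.

End Equivariance.

(** * Operators that are sums of terms of bounded order *)

Section TermSums.
Variables (R : realType) (V : normedModType R) (E I : Type).
Variables (D : set V) (adm : E -> Prop) (valid : I -> Prop) (ord : I -> nat)
  (term : I -> E -> V -> R[i]).
Hypothesis oD : open D.
Implicit Types (A B : E -> V -> R[i]) (c : V -> R[i]) (u : E) (x v : V) (m : nat) (i : I).

(** Finite sums of terms with smooth coefficients. Adding one term at a time, rather
    than giving a list of them, turns the closure properties into inductions; the
    terms are abstract because three kinds of them are compared below. *)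
Inductive terms_below m : (E -> V -> R[i]) -> Prop :=
| terms_zero A : (forall u x, adm u -> D x -> A u x = 0) -> terms_below m A
| terms_cons c i A B : csmooth_on D c -> valid i -> (ord i < m)%N -> terms_below m B ->
    (forall u x, adm u -> D x -> A u x = c x * term i u x + B u x) -> terms_below m A.

Lemma terms_eq m A B : (forall u x, adm u -> D x -> A u x = B u x) ->
  terms_below m A -> terms_below m B.
Proof.
move=> AB dA; case: dA AB => [{}A A0|c i {}A A' sc vi im dA' EA] AB.
  by apply: terms_zero => u x au Dx; rewrite -AB // A0.
by apply: (terms_cons sc vi im dA') => u x au Dx; rewrite -AB // EA.
Qed.

Lemma terms_le m m' A : (m <= m')%N -> terms_below m A -> terms_below m' A.
Proof.
move=> mm'; elim=> [{}A A0|c i {}A B sc vi im _ IH EA]; first exact: terms_zero.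
exact: (terms_cons sc vi (leq_trans im mm') IH EA).
Qed.

Lemma terms_term m c i : csmooth_on D c -> valid i -> (ord i < m)%N ->
  terms_below m (fun u x => c x * term i u x).
Proof.
move=> sc vi im; apply: (terms_cons sc vi im (B := fun _ _ => 0)) => [|u x _ _].
  exact: terms_zero.
by rewrite addr0.
Qed.

Lemma terms_single m i A : valid i -> (ord i < m)%N ->
  (forall u x, adm u -> D x -> A u x = term i u x) -> terms_below m A.
Proof.
move=> vi im EA; apply: terms_eq (terms_term (csmooth_on_cst 1 oD) vi im) => u x au Dx.
by rewrite mul1r EA.
Qed.

Lemma termsD m A B : terms_below m A -> terms_below m B ->
  terms_below m (fun u x => A u x + B u x).
Proof.
move=> dA dB; elim: dA => [{}A A0|c i {}A A' sc vi im _ IH EA].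
  by apply: terms_eq dB => u x au Dx; rewrite A0 // add0r.
by apply: (terms_cons sc vi im IH) => u x au Dx; rewrite EA // addrA.
Qed.

Lemma termsM m c A : csmooth_on D c -> terms_below m A ->
  terms_below m (fun u x => c x * A u x).
Proof.
move=> sc; elim=> [{}A A0|c' i {}A A' sc' vi im _ IH EA].
  by apply: terms_zero => u x au Dx; rewrite A0 // mulr0.
by apply: (terms_cons (csmooth_onM oD sc sc') vi im IH) => u x au Dx; rewrite EA // mulrDr mulrA.
Qed.

Lemma terms_sum m (J : eqType) (r : seq J) (A : J -> E -> V -> R[i]) :
  (forall j, j \in r -> terms_below m (A j)) ->
  terms_below m (fun u x => \sum_(j <- r) A j u x).
Proof.
elim: r => [|j r IHr] dA.
  by apply: terms_zero => u x _ _; rewrite big_nil.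
apply: (terms_eq (A := fun u x => A j u x + \sum_(l <- r) A l u x)).
  by move=> u x _ _; rewrite big_cons.
apply: termsD; first by apply: dA; rewrite mem_head.
by apply: IHr => l lr; apply: dA; rewrite inE lr orbT.
Qed.

Hypothesis csmooth_term : forall i u, valid i -> adm u -> csmooth_on D (term i u).

Lemma csmooth_terms m A u : terms_below m A -> adm u -> csmooth_on D (A u).
Proof.
move=> dA au; elim: dA => [{}A A0|c i {}A B sc vi _ _ IH EA].
  by apply: csmooth_on_eq (csmooth_on_cst 0 oD) => // x Dx; rewrite A0.
apply: (csmooth_on_eq oD (F := fun x => c x * term i u x + B u x)).
  by move=> x Dx; rewrite EA.
by apply: csmooth_onD => //; apply: csmooth_onM => //; exact: csmooth_term.
Qed.

(* A derivative raises the order of a term by at most one. *)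
Hypothesis cderive_term : forall v i, valid i ->
  terms_below (ord i).+2 (fun u => cderive v (term i u)).

Lemma terms_cderive m v A : terms_below m A -> terms_below m.+1 (fun u => cderive v (A u)).
Proof.
elim=> [{}A A0|c i {}A B sc vi im dB IH EA].
  apply: terms_zero => u x au Dx; rewrite -(cderive_cst 0 v x).
  by apply: (cderive_eq v oD Dx) => y Dy; rewrite A0.
apply: (terms_eq (A := fun u x =>
    cderive v c x * term i u x + c x * cderive v (term i u) x + cderive v (B u) x)).
  move=> u x au Dx; have st := csmooth_term vi au.
  rewrite -(cderiveM v sc st Dx) -(cderiveD v (csmooth_onM oD sc st) (csmooth_terms dB au) Dx).
  by apply: (cderive_eq v oD Dx) => y Dy; rewrite EA.
apply: termsD => //; apply: termsD.
  by apply: terms_term => //; [exact: csmooth_on_derive|exact: leqW].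
by apply: termsM => //; exact: (@terms_le (ord i).+2 m.+1 _ im (cderive_term v vi)).
Qed.

End TermSums.

Arguments terms_term {R V E I D adm valid ord term m c} i.
Arguments terms_single {R V E I D adm valid ord term} oD {m} i {A}.

(** The class of a sum is controlled term by term under substitution in both the
    function and the point. *)
Lemma terms_pull (R : realType) (V V' : normedModType R) (E E' I I' : Type)
    (D : set V) (D' : set V') adm adm' valid valid' ord ord'
    (term : I -> E -> V -> R[i]) (term' : I' -> E' -> V' -> R[i])
    (phi : E' -> E) (psi : V' -> V) m m' A :
  (forall u, adm' u -> adm (phi u)) -> (forall x, D' x -> D (psi x)) ->
  (forall c i, csmooth_on D c -> valid i -> (ord i < m)%N ->
     terms_below D' adm' valid' ord' term' m'
       (fun u x => c (psi x) * term i (phi u) (psi x))) ->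
  terms_below D adm valid ord term m A ->
  terms_below D' adm' valid' ord' term' m' (fun u x => A (phi u) (psi x)).
Proof.
move=> hphi hpsi ht; elim=> [{}A A0|c i {}A B sc vi im _ IH EA].
  by apply: terms_zero => u x au Dx; apply: A0; [exact: hphi|exact: hpsi].
apply: terms_eq (termsD (ht c i sc vi im) IH) => u x au Dx.
by rewrite EA //; [exact: hphi|exact: hpsi].
Qed.

(** * Comparison with the wave operator *)

Section DifferentialDifference.
Variables (R : realType) (n : nat).
Local Notation amb := 'rV[R]_(n.+2).
Variables (Phi Pos : {fset amb}) (k : amb -> R[i]).
Hypotheses (rootsPhi : root_system Phi) (euclPhi : euclidean_roots Phi)
  (posPhi : positive_roots Phi Pos) (multk : multiplicity Phi k).
Implicit Types (X Y a b xi eta v : amb) (F G H : amb -> R[i]) (g h : amb -> amb).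
Implicit Types (A B : (amb -> R[i]) -> amb -> R[i]) (s : seq amb) (m : nat).

Local Notation T := (dunkl Pos k).
Local Notation Lap := (dunkl_laplace Pos k).
Local Notation S := (@spacelike_nonzero R n).

Definition off_mirrors : set amb := S `&` [set X | forall a, a \in Phi -> form a X != 0].
Local Notation Omega := off_mirrors.

Lemma open_off_mirrors : open Omega.
Proof.
apply: openI; first exact: open_spacelike.
apply: open_forall_seq => a; apply: open_neq0.
exact: smoothT_continuous (smooth_on_form a openT).
Qed.

Lemma off_mirrors_refl b X : b \in Phi -> Omega X -> Omega (refl b X).
Proof.
move=> bP [SX aX]; have ig := root_isometry rootsPhi euclPhi bP.
have b0 : form b b != 0 by case: rootsPhi => + _ _; exact.
split; first exact: spacelike_isometry.
move=> a aP; rewrite -(refl_invol b0 a) refl_form //; apply: aX.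
case: rootsPhi => _ _ /(_ b bP) E.
have : [set` Phi] (refl b a) by rewrite E; exists a.
by [].
Qed.

Lemma off_mirrors_core : Omega `<=` reflect_core Pos Omega.
Proof.
move=> X OX; split=> // a /(pos_root posPhi) aP; exact: off_mirrors_refl.
Qed.

Definition mderive s F : amb -> R[i] := foldr (@cderive R amb) F s.

Lemma csmooth_on_mderive (U : set amb) s F : csmooth_on U F -> csmooth_on U (mderive s F).
Proof. by move=> sF; elim: s => //= v s; exact: csmooth_on_derive. Qed.

Lemma mderive_refl b s F X : form b b != 0 ->
  mderive s F (refl b X) = mderive (map (refl b) s) (F \o refl b) X.
Proof.
move=> b0; elim: s X => [//|v s IHs] X /=.
have -> : mderive (map (refl b) s) (F \o refl b) = mderive s F \o refl b.
  by apply/funext => Y; rewrite -IHs.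
rewrite (@cderive_linear_comp R amb amb _ (refl b) (refl b v) X) ?refl_invol //.
by move=> t; rewrite refl_lin refl_invol.
Qed.

(** Off the mirrors, terms [c(X) d^s (F o g)] with [g] in the reflection group.
    The derivatives are along arbitrary vectors, so that reflecting a term gives
    a single term again. *)
Local Notation diffdiff_below := (terms_below Omega (csmooth_on S)
  (fun sg => refl_group Phi sg.2) (fun sg => size sg.1)
  (fun sg F => mderive sg.1 (F \o sg.2))).

Lemma csmooth_off_mirrors_term (sg : seq amb * (amb -> amb)) F : refl_group Phi sg.2 ->
  csmooth_on S F -> csmooth_on Omega (mderive sg.1 (F \o sg.2)).
Proof.
move=> gP sF; apply: csmooth_on_mderive.
apply: (@csmooth_on_sub R amb S) => [X []//|].
exact: csmooth_spacelike_isometry (refl_group_isometry rootsPhi euclPhi gP) sF.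
Qed.

Lemma csmooth_diffdiff m A F : diffdiff_below m A -> csmooth_on S F -> csmooth_on Omega (A F).
Proof. exact: (csmooth_terms open_off_mirrors csmooth_off_mirrors_term). Qed.

Lemma diffdiff_cderive m v A : diffdiff_below m A ->
  diffdiff_below m.+1 (fun F => cderive v (A F)).
Proof.
apply: (terms_cderive open_off_mirrors csmooth_off_mirrors_term) => {}v [s g] gP.
exact: (terms_single open_off_mirrors (v :: s, g)).
Qed.

Lemma csmooth_off_mirrors_refl a c : a \in Phi -> csmooth_on Omega c ->
  csmooth_on Omega (c \o refl a).
Proof.
move=> aP sc; have oO := open_off_mirrors.
apply: (csmooth_on_comp oO oO sc); last by move=> X; exact: off_mirrors_refl.
have ig := root_isometry rootsPhi euclPhi aP.
exact: (smooth_map_isometry ig oO).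
Qed.

Lemma diffdiff_refl m a A : a \in Phi -> diffdiff_below m A ->
  diffdiff_below m (fun F X => A F (refl a X)).
Proof.
move=> aP; have a0 : form a a != 0 by case: rootsPhi => + _ _; exact.
apply: (terms_pull (phi := id) (psi := refl a)) => // [X|c [s g] sc gP sm].
  exact: off_mirrors_refl.
apply: (terms_eq (A := fun F X =>
    (c \o refl a) X * mderive (map (refl a) s) (F \o (g \o refl a)) X)).
  by move=> F X sF OX /=; rewrite mderive_refl.
apply: (terms_term (map (refl a) s, g \o refl a)) => /=.
- exact: csmooth_off_mirrors_refl aP sc.
- exact: refl_group_comp gP (refl_group_refl aP).
- by rewrite size_map.
Qed.

Lemma csmooth_off_mirrors_inv a : a \in Phi ->
  csmooth_on Omega (fun X => ((form a X)%:C)^-1).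
Proof.
move=> aP; have oO := open_off_mirrors.
apply: (csmooth_on_eq oO (F := fun X => ((form a X)^-1)%:C)).
  by move=> X OX; rewrite fmorphV.
apply: csmooth_on_real => //; apply: smooth_onV => //; first exact: smooth_on_form.
by move=> X [_ +]; exact.
Qed.

(** Off the mirrors a difference quotient is a difference of two values times a
    smooth function, without derivatives. *)
Lemma diffdiff_dunkl_local m xi A : diffdiff_below m A ->
  diffdiff_below m (fun F X => T xi (A F) X - cderive xi (A F) X).
Proof.
move=> dA; have oO := open_off_mirrors.
apply: (terms_eq (A := fun F X => \sum_(a <- Pos)
   (k a * (form a xi)%:C * ((form a X)%:C)^-1) * (A F X + -1 * A F (refl a X)))).
  move=> F X sF [SX aX]; rewrite /dunkl [cderive xi (A F) X + _]addrC addrK !big_seq.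
  apply: eq_bigr => a /(pos_root posPhi) aP; rewrite /diff_quot (negbTE (aX a aP)).
  by ring.
apply: terms_sum => a /(pos_root posPhi) aP.
apply: (termsM oO).
  by apply: csmooth_onM => //; [exact: csmooth_on_cst|exact: csmooth_off_mirrors_inv].
apply: termsD => //; apply: (termsM oO); first exact: csmooth_on_cst.
exact: diffdiff_refl.
Qed.

Lemma diffdiff_dunkl m xi A : diffdiff_below m A -> diffdiff_below m.+1 (fun F => T xi (A F)).
Proof.
move=> dA; apply: (terms_eq (A := fun F X =>
    (T xi (A F) X - cderive xi (A F) X) + cderive xi (A F) X)).
  by move=> F X _ _; rewrite subrK.
apply: termsD; last exact: diffdiff_cderive.
by apply: terms_le (leqnSn m) _; exact: diffdiff_dunkl_local.
Qed.

(** The wave operator of R^{n+1,1}: the Dunkl Laplacian for [k = 0]. *)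
Definition box F X : R[i] :=
  \sum_(i < n.+2) cderive (basis R i) (cderive (dual_basis R i) F) X.

Lemma box_eq (U : set amb) F G X : open U -> U X -> (forall Y, U Y -> F Y = G Y) ->
  box F X = box G X.
Proof.
move=> oU UX FG; apply: eq_bigr => i _; apply: (cderive_eq _ oU UX) => Y UY.
exact: (cderive_eq _ oU UY FG).
Qed.

Lemma diffdiff_box m A : diffdiff_below m A -> diffdiff_below m.+2 (fun F => box (A F)).
Proof.
by move=> dA; apply: terms_sum => i _; do 2 apply: diffdiff_cderive.
Qed.

Lemma diffdiff_laplace m A : diffdiff_below m A -> diffdiff_below m.+2 (fun F => Lap (A F)).
Proof.
by move=> dA; apply: terms_sum => i _; do 2 apply: diffdiff_dunkl.
Qed.

Lemma diffdiff_laplace_box m A : diffdiff_below m A ->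
  diffdiff_below m.+1 (fun F X => Lap (A F) X - box (A F) X).
Proof.
move=> dA; have oO := open_off_mirrors.
apply: (terms_eq (A := fun F X => \sum_(i < n.+2)
  ((T (basis R i) (T (dual_basis R i) (A F)) X -
    cderive (basis R i) (T (dual_basis R i) (A F)) X) +
   cderive (basis R i) (fun Y => T (dual_basis R i) (A F) Y -
       cderive (dual_basis R i) (A F) Y) X))).
  move=> F X sF OX; rewrite -sumrB; apply: eq_bigr => i _.
  have sA := csmooth_diffdiff dA sF.
  have sT := csmooth_diffdiff (diffdiff_dunkl (dual_basis R i) dA) sF.
  have sD := csmooth_diffdiff (diffdiff_cderive (dual_basis R i) dA) sF.
  have -> : cderive (basis R i) (fun Y => T (dual_basis R i) (A F) Y -
     cderive (dual_basis R i) (A F) Y) X =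
     cderive (basis R i) (T (dual_basis R i) (A F)) X -
     cderive (basis R i) (cderive (dual_basis R i) (A F)) X.
    rewrite -[X in _ = _ - X]mul1r -mulNr -(cderiveZ _ _ oO sD OX).
    have sND : csmooth_on Omega (fun Y => -1 * cderive (dual_basis R i) (A F) Y).
      by apply: csmooth_onM => //; exact: csmooth_on_cst.
    rewrite -(cderiveD _ sT sND OX); congr (cderive _ _ X).
    by apply/funext => Y; rewrite mulN1r.
  by rewrite addrA subrK.
apply: terms_sum => i _; apply: termsD.
  by apply: diffdiff_dunkl_local; exact: diffdiff_dunkl.
by apply: diffdiff_cderive; exact: diffdiff_dunkl_local.
Qed.

Lemma off_mirrors_laplace_lin (c : R[i]) F G X : csmooth_on Omega F -> csmooth_on Omega G ->
  Omega X -> Lap (fun Y => F Y + c * G Y) X = Lap F X + c * Lap G X.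
Proof.
move=> sF sG OX; apply: (laplace_lin k (pos_nondegenerate rootsPhi posPhi) _ open_off_mirrors) => //.
split=> [|a /(pos_root posPhi) aP]; apply: off_mirrors_core => //.
exact: off_mirrors_refl.
Qed.

Lemma diffdiff_iter_box j : diffdiff_below (2 * j).+1 (fun F => iter j box F).
Proof.
elim: j => [|j IHj].
  exact: (terms_single open_off_mirrors ([::], id) (refl_group_id Phi)).
by rewrite mulnS; exact: diffdiff_box IHj.
Qed.

(** Replacing one Dunkl Laplacian after the other by the wave operator, each time at
    the cost of terms of lower order ([diffdiff_laplace_box]). *)
Lemma diffdiff_iter_laplace_box j :
  diffdiff_below (2 * j) (fun F X => iter j Lap F X - iter j box F X).
Proof.
have oO := open_off_mirrors.
elim: j => [|j IHj]; first by apply: terms_zero => F X _ _; rewrite subrr.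
apply: (terms_eq (A := fun F X => (Lap (iter j box F) X - box (iter j box F) X) +
   Lap (fun Y => iter j Lap F Y - iter j box F Y) X)).
  move=> F X sF OX; rewrite !iterS.
  have sL : csmooth_on Omega (iter j Lap F).
    apply: (@csmooth_on_sub R amb S) => [Y []//|].
    exact: (csmooth_spacelike_iter k rootsPhi euclPhi posPhi j sF).
  have sB := csmooth_diffdiff (diffdiff_iter_box j) sF.
  have -> : (fun Y => iter j Lap F Y - iter j box F Y) =
     (fun Y => iter j Lap F Y + -1 * iter j box F Y).
    by apply/funext => Y; rewrite mulN1r.
  by rewrite (off_mirrors_laplace_lin (-1) sL sB OX) mulN1r addrC addrA subrK.
rewrite mulnS; apply: termsD; last exact: diffdiff_laplace.
exact: (diffdiff_laplace_box (diffdiff_iter_box j)).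
Qed.

End DifferentialDifference.

(** * The wave operator in the chart *)

Section ChartOperators.
Variables (R : realType) (n : nat).
Local Notation amb := 'rV[R]_(n.+2).
Local Notation aff := 'rV[R]_n.
Implicit Types (X Y v : amb) (x y : aff) (u f : aff -> R[i]) (c : amb -> R[i]).
Implicit Types (A B : (aff -> R[i]) -> amb -> R[i]) (s : seq 'I_n) (m j : nat) (w : R[i]).

Local Notation W := (@chart_region R n).
Local Notation csm := (csmooth_on [set: aff]).

Lemma form_oppr X Y : form X (- Y) = - form X Y.
Proof. by rewrite -scaleN1r form_scaler mulN1r. Qed.

Lemma form_oppl X Y : form (- X) Y = - form X Y.
Proof. by rewrite -scaleN1r form_scalel mulN1r. Qed.

Lemma csmooth_pderives s u : csm u -> csm (pderives s u).
Proof. by move=> su; elim: s => //= i s; exact: csmooth_on_derive. Qed.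

Lemma csmooth_affine_laplace u : csm u -> csm (laplace u).
Proof.
move=> su; apply: csmooth_on_sum => [|i]; first exact: openT.
exact: (csmooth_pderives [:: i; i] su).
Qed.

Lemma csmooth_affine_iter j u : csm u -> csm (iter j (@laplace R n) u).
Proof. by move=> su; elim: j => //= j; exact: csmooth_affine_laplace. Qed.

Lemma pderives_sum s (J : Type) (r : seq J) (F : J -> aff -> R[i]) x :
  (forall i, csm (F i)) ->
  pderives s (fun y => \sum_(i <- r) F i y) x = \sum_(i <- r) pderives s (F i) x.
Proof.
move=> sF; elim: s x => [//|l s IHs] x /=.
rewrite /pderive -(cderive_sum r (delta_mx 0 l) openT _ (I : setT x)); last first.
  by move=> i; exact: csmooth_pderives.
by congr (cderive _ _ x); apply/funext => y; exact: IHs.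
Qed.

Lemma pderives_laplace s u x : csm u ->
  pderives s (laplace u) x = \sum_i pderives (s ++ [:: i; i]) u x.
Proof.
move=> su; rewrite /laplace (pderives_sum s (index_enum _) (F := fun i => pderive i (pderive i u))).
  by apply: eq_bigr => i _; rewrite /pderives foldr_cat.
by move=> i; exact: (csmooth_pderives [:: i; i] su).
Qed.

Definition chart_inv_derive v (l : 'I_n) X : R[i] :=
  ('D_v (fun Z => chart_inv Z 0 l) X)%:C.

Lemma csmooth_chart_inv_derive v l : csmooth_on W (chart_inv_derive v l).
Proof.
apply: csmooth_on_real; first exact: open_chart_region.
by apply: smooth_on_derive; exact: smooth_map_chart_inv.
Qed.

Lemma csmooth_chart_inv_comp u : csm u -> csmooth_on W (u \o @chart_inv R n).
Proof.
move=> su; apply: (csmooth_on_comp _ openT su) => //; first exact: open_chart_region.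
exact: smooth_map_chart_inv.
Qed.

Lemma csmooth_chart_term c u : csmooth_on W c -> csm u ->
  csmooth_on W (fun Y => c Y * u (chart_inv Y)).
Proof.
move=> sc su; apply: csmooth_onM => //; first exact: open_chart_region.
exact: csmooth_chart_inv_comp.
Qed.

Lemma cderive_chart_term c u v X : csmooth_on W c -> csm u -> W X ->
  cderive v (fun Y => c Y * u (chart_inv Y)) X =
  cderive v c X * u (chart_inv X) +
  \sum_l (c X * chart_inv_derive v l X) * pderive l u (chart_inv X).
Proof.
move=> sc su WX; rewrite (cderiveM v sc (csmooth_chart_inv_comp su) WX); congr (_ + _).
rewrite (cderive_comp v openT su (@smooth_map_chart_inv R n) _ WX) // mulr_sumr.
by apply: eq_bigr => l _; rewrite mulrA.
Qed.

(** On the chart region, terms [c(Y) (d^s u) (chart_inv Y)]. *)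
Local Notation chart_below := (terms_below W csm (fun=> True) size
  (fun s u Y => pderives s u (chart_inv Y))).

Lemma csmooth_chart_inv_pderives s u : True -> csm u ->
  csmooth_on W (fun Y => pderives s u (chart_inv Y)).
Proof. by move=> _ su; exact: (csmooth_chart_inv_comp (csmooth_pderives s su)). Qed.

Lemma csmooth_chart_below m A u : chart_below m A -> csm u -> csmooth_on W (A u).
Proof. exact: (csmooth_terms (@open_chart_region R n) csmooth_chart_inv_pderives). Qed.

Lemma chart_below_cderive m v A : chart_below m A ->
  chart_below m.+1 (fun u => cderive v (A u)).
Proof.
have oW := @open_chart_region R n.
apply: (terms_cderive oW csmooth_chart_inv_pderives) => {}v s _.
apply: (terms_eq (A := fun u X =>
    \sum_l chart_inv_derive v l X * pderives (l :: s) u (chart_inv X))).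
  move=> u X su WX; symmetry.
  exact: (cderive_comp v openT (csmooth_pderives s su) (@smooth_map_chart_inv R n) _ WX).
by apply: terms_sum => l _; apply: terms_term => //; exact: csmooth_chart_inv_derive.
Qed.

Lemma chart_below_box m A : chart_below m A -> chart_below m.+2 (fun u => box (A u)).
Proof. by move=> dA; apply: terms_sum => i _; do 2 apply: chart_below_cderive. Qed.

Lemma chart_below_laplace j s m c : csmooth_on W c -> (size s + 2 * j < m)%N ->
  chart_below m (fun u X => c X * pderives s (iter j (@laplace R n) u) (chart_inv X)).
Proof.
move=> sc; elim: j s => [|j IHj] s sm; first by apply: terms_term; rewrite // addn0 in sm.
apply: (terms_eq (A := fun u X => \sum_i
  (c X * pderives (s ++ [:: i; i]) (iter j (@laplace R n) u) (chart_inv X)))).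
  move=> u X su _; rewrite iterS pderives_laplace; last exact: csmooth_affine_iter.
  by rewrite mulr_sumr.
apply: terms_sum => i _; apply: IHj.
by rewrite size_cat /= -addnA -mulnS.
Qed.

(** Stereographic projection is conformal: the gradients of its coordinates are
    orthogonal and of equal length for the ambient form. *)
Lemma chart_inv_conformal X (l m : 'I_n) : W X ->
  \sum_i chart_inv_derive (basis R i) l X * chart_inv_derive (dual_basis R i) m X =
  (l == m)%:R * ((height X ^+ 2)^-1)%:C.
Proof.
move=> [SX hX]; have oS := @open_spacelike R n.
have r0 : 0 < space_norm X by rewrite sqrtr_gt0.
have h0 : height X != 0 by rewrite gt_eqF.
(* [N] and [M i] are the gradients, for the ambient form, of the height and of the
   [i]-th coordinate. *)
have [N NE] : exists N : amb, N = 2^-1 *: (basis R ord0 + basis R ord_max) +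
    (space_norm X)^-1 *: (X - (time X / 2) *: @time_axis R n) by eexists.
pose M (i : 'I_n) : amb := (height X)^-1 *: basis R (mid i) -
  (X 0 (mid i) / height X ^+ 2) *: N.
have b0 Y : form Y (basis R ord0) = Y 0 ord_max.
  by rewrite -form_dual /dual_basis tpermR.
have bM Y : form Y (basis R ord_max) = Y 0 ord0.
  by rewrite -form_dual /dual_basis tpermL.
have bm (i : 'I_n) Y : form Y (basis R (mid i)) = Y 0 (mid i).
  by rewrite -form_dual /dual_basis tpermD // eq_sym ?mid_neq0 ?mid_neq_max.
have dtime v : is_derive X v (@time R n) (time v).
  by apply: is_derive_linear => Y z t; rewrite time_lin.
have dsq v : is_derive X v (@space_sq R n) (4 * form v X + 2 * time X * time v).
  have D := is_deriveD (is_deriveZ 2 (is_derive_Q v X)) (is_deriveM (dtime v) (dtime v)).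
  have := D; congr (is_derive _ _ _ _).
  by rewrite /GRing.scale /=; ring.
have dnorm v : is_derive X v (@space_norm R n)
    ((2 * form v X + time X * time v) / space_norm X).
  have := is_derive_comp1 (dsq v) (is_derive1_sqrt SX); congr (is_derive _ _ _ _).
  by rewrite -/(space_norm X); field; rewrite gt_eqF.
have dheight v : is_derive X v (@height R n) (form v N).
  have := is_deriveZ 2^-1 (is_deriveD (is_deriveD (is_derive_coord X v ord0)
    (is_derive_coord X v ord_max)) (dnorm v)).
  congr (is_derive _ _ _ _).
    by apply/funext => Y; rewrite /height !fctE /GRing.scale_fun /GRing.scale /= mulrC.
  rewrite NE; move: (@time_axis R n) (@form_time_axis R n) => e fe.
  rewrite !(form_addr, form_oppr, form_scaler) b0 bM fe /GRing.scale /=.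
  by field; rewrite gt_eqF.
have dp v i : is_derive X v (fun Z => chart_inv Z 0 i) (form v (M i)).
  have dinv : is_derive (height X) 1 (fun y : R => y^-1) (- (height X) ^- 2).
    have := @is_deriveV R id (height X) 1 1 h0 (is_derive_id (height X : R^o) 1).
    by rewrite [X in is_derive _ _ _ X]mulr1.
  have := is_deriveM (is_derive_coord X v (mid i)) (is_derive_comp1 (dheight v) dinv).
  congr (is_derive _ _ _ _).
    by apply/funext => Y; rewrite !fctE mxE.
  rewrite /M form_addr form_oppr !form_scaler bm /GRing.scale /=.
  by field.
have E i v : chart_inv_derive v i X = (form v (M i))%:C.
  by rewrite /chart_inv_derive; have [_ ->] := dp v i.
transitivity ((form (M l) (M m))%:C).
  rewrite -sum_form_dual rmorph_sum; apply: eq_bigr => i _.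
  by rewrite !E -rmorphM (form_sym (M l)) (form_sym (M m)).
have -> : (l == m)%:R = ((l == m)%:R : R)%:C :> R[i] by rewrite rmorph_nat.
rewrite -rmorphM /=; congr (_%:C).
have eM (i : 'I_n) Y : form (basis R (mid i)) Y = Y 0 (mid i) by rewrite form_sym bm.
have m0 (i : 'I_n) : (ord0 == mid i) = false by rewrite eq_sym mid_neq0.
have mM (i : 'I_n) : (ord_max == mid i) = false by rewrite eq_sym mid_neq_max.
have Nm i : N 0 (mid i) = X 0 (mid i) / space_norm X.
  rewrite NE /time_axis !mxE !mid_neq0 !mid_neq_max !eqxx /=.
  by field; rewrite gt_eqF.
have NN : form N N = 2 * height X / space_norm X.
  have sr : space_norm X ^+ 2 = 2 * form X X + time X ^+ 2 by rewrite sqr_sqrtr ?ltW.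
  have te := @time_axisE R n; have fe := @form_time_axis R n.
  have te0 : @time_axis R n 0 ord0 = 1.
    by rewrite /time_axis !mxE eqxx /=; ring.
  have teM : @time_axis R n 0 ord_max = -1.
    by rewrite /time_axis !mxE !eqxx /=; ring.
  rewrite NE; move: (@time_axis R n) te fe te0 teM => e te fe te0 teM.
  rewrite !(form_addl, form_addr, form_oppl, form_oppr, form_scalel, form_scaler).
  have b0' Y : form (basis R ord0) Y = Y 0 ord_max by rewrite form_sym b0.
  have bM' Y : form (basis R ord_max) Y = Y 0 ord0 by rewrite form_sym bM.
  rewrite !b0' !bM' !b0 !bM (form_sym e X) !fe te te0 teM.
  rewrite !mxE !eqxx /=.
  have -> : form X X = (space_norm X ^+ 2 - time X ^+ 2) / 2 by rewrite sr; field.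
  by rewrite /height; field; rewrite gt_eqF.
rewrite /M !(form_addl, form_addr, form_oppl, form_oppr, form_scalel, form_scaler).
rewrite (form_sym N) !eM.
rewrite NN !Nm [basis R (mid m) 0 _]mxE eqxx mid_eq.
by field; rewrite h0 gt_eqF.
Qed.

(** By conformality the terms in which both derivatives fall on [L u] form a multiple
    of its Laplacian; the other terms contain at most one derivative of [L u]. *)
Lemma chart_below_box_term m c (L : (aff -> R[i]) -> aff -> R[i]) :
  csmooth_on W c -> (forall u, csm u -> csm (L u)) ->
  (forall c' s, csmooth_on W c' -> (size s <= 1)%N ->
     chart_below m (fun u X => c' X * pderives s (L u) (chart_inv X))) ->
  chart_below m (fun u X => box (fun Y => c Y * L u (chart_inv Y)) X -
    c X * ((height X ^+ 2)^-1)%:C * laplace (L u) (chart_inv X)).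
Proof.
move=> sc sL cL; have oW := @open_chart_region R n.
pose ci i := cderive (dual_basis R i) c.
pose q i l X := c X * chart_inv_derive (dual_basis R i) l X.
have sci i : csmooth_on W (ci i) by exact: csmooth_on_derive.
have sq i l : csmooth_on W (q i l).
  by apply: csmooth_onM => //; exact: csmooth_chart_inv_derive.
apply: (terms_eq (A := fun u X => \sum_(i < n.+2)
   (cderive (basis R i) (ci i) X * pderives [::] (L u) (chart_inv X) +
    \sum_l (ci i X * chart_inv_derive (basis R i) l X +
       cderive (basis R i) (q i l) X) * pderives [:: l] (L u) (chart_inv X)))).
  move=> u X su WX; set v := L u; have sv : csm v := sL u su.
  have spv l : csm (pderive l v) := csmooth_pderives [:: l] sv.
  rewrite /box; apply/eqP; rewrite eq_sym subr_eq; apply/eqP.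
  have step i : cderive (basis R i) (cderive (dual_basis R i)
       (fun Y => c Y * v (chart_inv Y))) X =
    (cderive (basis R i) (ci i) X * v (chart_inv X) +
    \sum_l (ci i X * chart_inv_derive (basis R i) l X +
       cderive (basis R i) (q i l) X) * pderive l v (chart_inv X)) +
    \sum_l \sum_l' c X * (chart_inv_derive (basis R i) l' X *
       chart_inv_derive (dual_basis R i) l X) * pderive l' (pderive l v) (chart_inv X).
    have st1 := csmooth_chart_term (sci i) sv.
    have st2 l := csmooth_chart_term (sq i l) (spv l).
    have st3 := csmooth_on_sum (index_enum _) oW st2.
    transitivity (cderive (basis R i) (fun Y => ci i Y * v (chart_inv Y) +
        \sum_l q i l Y * pderive l v (chart_inv Y)) X).
      by apply: (cderive_eq _ oW WX) => Y WY; exact: cderive_chart_term.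
    rewrite (cderiveD _ st1 st3 WX) (cderive_sum _ _ oW st2 WX).
    rewrite (cderive_chart_term _ (sci i) sv WX).
    have E l := cderive_chart_term (basis R i) (sq i l) (spv l) WX.
    under [X in _ + X = _]eq_bigr do rewrite E.
    rewrite big_split /= -!addrA; congr (_ + _); rewrite addrA -big_split /=.
    congr (_ + _); first by apply: eq_bigr => l _; rewrite mulrDl.
    apply: eq_bigr => l _; apply: eq_bigr => l' _; rewrite /q; congr (_ * _).
    by rewrite -mulrA; congr (_ * _); rewrite mulrC.
  rewrite (eq_bigr _ (fun i _ => step i)) big_split /=; congr (_ + _).
  rewrite exchange_big /= /laplace mulr_sumr; apply: eq_bigr => l _.
  rewrite exchange_big /=.
  have E l' : \sum_i c X * (chart_inv_derive (basis R i) l' X *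
     chart_inv_derive (dual_basis R i) l X) * pderive l' (pderive l v) (chart_inv X) =
     c X * ((l' == l)%:R * ((height X ^+ 2)^-1)%:C) * pderive l' (pderive l v) (chart_inv X).
    by rewrite -mulr_suml -mulr_sumr chart_inv_conformal.
  rewrite (eq_bigr _ (fun l' _ => E l')) (bigD1 l) //= eqxx mul1r big1 ?addr0 //.
  by move=> l' /negbTE ->; rewrite mul0r mulr0 mul0r.
apply: terms_sum => i _; apply: termsD.
  by apply: cL => //; exact: csmooth_on_derive.
apply: terms_sum => l _; apply: cL => //; apply: csmooth_onD => //.
  by apply: csmooth_onM => //; exact: csmooth_chart_inv_derive.
exact: csmooth_on_derive.
Qed.

End ChartOperators.

(** * The symbol *)

Section OrderAndSymbol.
Variables (R : realType) (n : nat).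
Local Notation amb := 'rV[R]_(n.+2).
Local Notation aff := 'rV[R]_n.
Variables (Phi Pos : {fset amb}) (k : amb -> R[i]) (w : R[i]).
Hypotheses (rootsPhi : root_system Phi) (euclPhi : euclidean_roots Phi)
  (posPhi : positive_roots Phi Pos) (multk : multiplicity Phi k).
Implicit Types (X Y v : amb) (x y : aff) (u : aff -> R[i]) (f : amb -> R[i]) (c : aff -> R[i]).
Implicit Types (s : seq 'I_n) (m j : nat) (g : amb -> amb).
Implicit Types (A B : (amb -> R[i]) -> aff -> R[i]).

Local Notation Lap := (dunkl_laplace Pos k).
Local Notation S := (@spacelike_nonzero R n).
Local Notation W := (@chart_region R n).
Local Notation csm := (csmooth_on [set: aff]).
Local Notation Omega := (off_mirrors Phi).
Local Notation reg := (regular Phi).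
Local Notation diffdiff_below := (terms_below Omega (csmooth_on S)
  (fun sg => refl_group Phi sg.2) (fun sg => size sg.1)
  (fun sg F => mderive sg.1 (F \o sg.2))).
Local Notation chart_below := (terms_below W csm (fun=> True) size
  (fun s u Y => pderives s u (chart_inv Y))).

(** The operators of [diffdiff_lt], in the form to which the closure properties of
    [terms_below] apply. *)
Local Notation lt_terms := (terms_below reg (density w)
  (fun sg => refl_group Phi sg.2) (fun sg => size sg.1)
  (fun sg f x => pderives sg.1 (f \o sg.2 \o @chart R n) x)).

Lemma lt_terms_diffdiff m A : lt_terms m A -> diffdiff_lt Phi w m A.
Proof.
elim=> [{}A A0|c [s g] {}A B sc gP sm _ [N [gs [ss [cs [gsP ssm scs EB]]]]] E].
  exists 0%N, (fun=> id), (fun=> [::]), (fun=> fun=> 0); split; try by case.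
  by move=> f x df rx; rewrite big_ord0 A0.
pose ext T (t0 : T) (ts : 'I_N -> T) (t : 'I_N.+1) :=
  if unlift ord0 t is Some t' then ts t' else t0.
have extP T (P : T -> Prop) t0 ts : P t0 -> (forall t, P (ts t)) -> forall t, P (ext T t0 ts t).
  by move=> P0 Pt t; rewrite /ext; case: unlift.
exists N.+1, (ext _ g gs), (ext _ s ss), (ext _ c cs); split.
- exact: extP.
- exact: (extP _ (fun s => (size s < m)%N)).
- exact: extP.
move=> f x df rx; rewrite E // EB // big_ord_recl /ext unlift_none; congr (_ + _).
by apply: eq_bigr => t _; rewrite liftK.
Qed.

Lemma diffdiff_lt_terms m A : diffdiff_lt Phi w m A -> lt_terms m A.
Proof.
move=> [N [gs [ss [cs [gsP ssm scs EA]]]]].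
apply: (terms_eq (A := fun f x =>
    \sum_(t < N) cs t x * pderives (ss t) (f \o gs t \o @chart R n) x)).
  by move=> f x df rx; rewrite EA.
by apply: terms_sum => t _; exact: (terms_term (ss t, gs t) (scs t) (gsP t) (ssm t)).
Qed.

Lemma regular_off_mirrors x : reg x -> Omega (chart x).
Proof. by move=> rx; split; [exact/cone_spacelike/cone_chart|exact: rx]. Qed.

Lemma open_regular : open reg.
Proof.
apply: open_forall_seq => a; apply: open_neq0; apply: smoothT_continuous.
by apply: (smooth_on_comp openT openT (smooth_on_form a openT)) => //; exact: smooth_map_chart.
Qed.

Lemma csmooth_regular_comp (C : amb -> R[i]) : csmooth_on Omega C ->
  csmooth_on reg (C \o @chart R n).
Proof.
move=> sC; apply: (csmooth_on_comp open_regular (@open_off_mirrors _ _ Phi) sC).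
  by move=> i; apply: smooth_on_sub (@smooth_map_chart R n i).
exact: regular_off_mirrors.
Qed.

Lemma csmooth_chart_comp (C : amb -> R[i]) : csmooth_on W C -> csm (C \o @chart R n).
Proof.
move=> sC; apply: (csmooth_on_comp openT (@open_chart_region R n) sC).
  exact: smooth_map_chart.
by move=> x _; have [] := chart_invK x.
Qed.

Lemma csmooth_density_chart f : density w f -> csm (f \o @chart R n).
Proof.
move=> df; apply: (csmooth_density_comp openT df); first exact: smooth_map_chart.
by move=> x _; exact: cone_chart.
Qed.

Lemma lt_terms_chart m g P : refl_group Phi g -> chart_below m P ->
  lt_terms m (fun f x => P (f \o g \o @chart R n) (chart x)).
Proof.
move=> gP; apply: (terms_pull (phi := fun f => f \o g \o @chart R n) (psi := @chart R n)).
- move=> f df.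
  exact: csmooth_density_chart (density_isometry (refl_group_isometry rootsPhi euclPhi gP) df).
- by move=> x _; have [] := chart_invK x.
move=> c s sc _ sm.
have scc : csmooth_on reg (c \o @chart R n) by apply: csmooth_on_sub (csmooth_chart_comp sc).
apply: terms_eq (terms_term (s, g) scc gP sm) => f x df rx.
by have [_ px _] := chart_invK x; rewrite px.
Qed.

(** The homogeneous function of degree [w] given by [u] in the chart, constant along
    the time axis. *)
Definition chart_density u Y : R[i] := cpow (height Y) w * u (chart_inv Y).

Lemma cone_proj_density f Y : density w f -> W Y ->
  f (cone_proj Y) = chart_density (f \o @chart R n) Y.
Proof.
move=> [_ hf] WY; rewrite cone_projE // hf //; first by case: WY.
exact: cone_chart.
Qed.

Lemma csmooth_height_pow (z : R[i]) : csmooth_on W (fun Y => cpow (height Y) z).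
Proof.
apply: csmooth_on_cpow; first exact: open_chart_region.
  by apply: smooth_on_sub (@smooth_on_height R n) => Y [].
by move=> Y [].
Qed.

Lemma chart_below_mderive (s : seq amb) :
  chart_below (size s).+1 (fun u => mderive s (chart_density u)).
Proof.
elim: s => [|v s IHs] /=; last exact: chart_below_cderive.
exact: (terms_term [::] (csmooth_height_pow w)).
Qed.

Lemma mderive_eq (U : set amb) (s : seq amb) (F G : amb -> R[i]) X : open U -> U X ->
  (forall Y, U Y -> F Y = G Y) -> mderive s F X = mderive s G X.
Proof.
move=> oU + FG; elim: s X => [|v s IHs] X UX /=; first exact: FG.
by apply: (cderive_eq v oU UX) => Y; exact: IHs.
Qed.

Lemma diffdiff_below_lt m (A : (amb -> R[i]) -> amb -> R[i]) : diffdiff_below m A ->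
  lt_terms m (fun f x => A (f \o @cone_proj R n) (chart x)).
Proof.
apply: (terms_pull (phi := fun f => f \o @cone_proj R n) (psi := @chart R n)).
- by move=> f; exact: csmooth_cone_proj.
- exact: regular_off_mirrors.
move=> c [s g] sc gP sm /=.
have T := lt_terms_chart gP (terms_le sm (chart_below_mderive s)).
apply: terms_eq (termsM open_regular (csmooth_regular_comp sc) T) => f x df rx.
congr (_ * _); have ig := refl_group_isometry rootsPhi euclPhi gP.
have [Wx _ _] := chart_invK x.
apply: (mderive_eq s (@open_chart_region R n) Wx) => Y WY /=.
by rewrite (isometry_cone_proj ig) -(cone_proj_density (density_isometry ig df) WY).
Qed.

(** Each wave operator acts as the Laplacian of the chart ([chart_below_box_term]) and
    lowers the exponent of the height by two, up to terms of lower order. *)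
Lemma chart_below_iter_box j : chart_below (2 * j) (fun u Y =>
  iter j (@box R n) (chart_density u) Y -
  cpow (height Y) (w - (2 * j)%N%:R) * iter j (@laplace R n) u (chart_inv Y)).
Proof.
have oW := @open_chart_region R n.
elim: j => [|j IHj].
  by apply: terms_zero => u Y _ _; rewrite muln0 subr0 subrr.
pose L u := iter j (@laplace R n) u.
pose c Y : R[i] := cpow (height Y) (w - (2 * j)%N%:R).
have sc : csmooth_on W c by exact: csmooth_height_pow.
have sL u : csm u -> csm (L u) by exact: csmooth_affine_iter.
have cL (c' : amb -> R[i]) (s : seq 'I_n) : csmooth_on W c' -> (size s <= 1)%N ->
    chart_below (2 * j.+1) (fun u X => c' X * pderives s (L u) (chart_inv X)).
  by move=> sc' s1; apply: chart_below_laplace => //; rewrite mulnS addSn ltnS leq_add2r.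
apply: (terms_eq (A := fun u Y =>
  box (fun Z => iter j (@box R n) (chart_density u) Z - c Z * L u (chart_inv Z)) Y +
  (box (fun Z => c Z * L u (chart_inv Z)) Y -
    c Y * ((height Y ^+ 2)^-1)%:C * laplace (L u) (chart_inv Y)))).
  move=> u Y su WY.
  have s1 := csmooth_chart_below IHj su.
  have s2 : csmooth_on W (fun Z => c Z * L u (chart_inv Z)).
    by apply: csmooth_chart_term => //; exact: sL.
  have E1 : box (fun Z => iter j (@box R n) (chart_density u) Z - c Z * L u (chart_inv Z)) Y +
      box (fun Z => c Z * L u (chart_inv Z)) Y = iter j.+1 (@box R n) (chart_density u) Y.
    rewrite iterS /box -big_split /=; apply: eq_bigr => i _.
    have d1 := csmooth_on_derive (dual_basis R i) s1.
    have d2 := csmooth_on_derive (dual_basis R i) s2.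
    rewrite -(cderiveD (basis R i) d1 d2 WY).
    apply: (cderive_eq _ oW WY) => Z WZ; rewrite -(cderiveD (dual_basis R i) s1 s2 WZ).
    by congr (cderive _ _ Z); apply/funext => Z'; rewrite subrK.
  have E2 : c Y * ((height Y ^+ 2)^-1)%:C = cpow (height Y) (w - (2 * j.+1)%N%:R).
    have h0 : 0 < height Y by case: WY.
    rewrite /c -(cpowB_nat (w - (2 * j)%N%:R) 2 h0) mulrC mulrA -rmorphM /=.
    rewrite mulVf ?mul1r; last by rewrite expf_neq0 // gt_eqF.
    by congr (cpow _ _); rewrite mulnS natrD; ring.
  have assoc (p q r d e z : R[i]) : p + q = r -> d = e -> p + (q - d * z) = r - e * z.
    by move=> <- ->; rewrite addrA.
  exact: (assoc _ _ _ _ _ _ E1 E2).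
apply: termsD; last exact: chart_below_box_term.
rewrite mulnS; exact: (chart_below_box IHj).
Qed.

Lemma symbol_terms j : lt_terms (2 * j) (fun f x =>
  iter j Lap (f \o @cone_proj R n) (chart x) - iter j (@laplace R n) (f \o @chart R n) x).
Proof.
have dL := diffdiff_below_lt (diffdiff_iter_laplace_box k rootsPhi euclPhi posPhi j).
have dB := lt_terms_chart (refl_group_id Phi) (chart_below_iter_box j).
apply: terms_eq (termsD dB dL) => f x df rx.
have [Wx px h1] := chart_invK x; rewrite px h1 cpow1l mul1r.
have -> : iter j (@box R n) (chart_density (f \o idfun \o @chart R n)) (chart x) =
    iter j (@box R n) (f \o @cone_proj R n) (chart x).
  elim: j (chart x) Wx {px h1 dL dB} => [|j IHj] Y WY /=.
    by rewrite (cone_proj_density df).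
  apply: (box_eq (@open_chart_region R n) WY) => Z WZ; exact: IHj.
by rewrite addrC addrA subrK.
Qed.

Lemma laplace_terms j :
  lt_terms (2 * j).+1 (fun f x => iter j (@laplace R n) (f \o @chart R n) x).
Proof.
have s1 : csmooth_on W (fun=> 1) := csmooth_on_cst 1 (@open_chart_region R n).
apply: terms_eq (lt_terms_chart (refl_group_id Phi)
  (chart_below_laplace (s := [::]) (j := j) s1 (leqnn _))) => f x df rx.
by have [_ px _] := chart_invK x; rewrite px !mul1r.
Qed.

End OrderAndSymbol.

(** * Vanishing of derivatives at a point *)

Section Flatness.
Variables (R : realType) (n : nat).
Local Notation aff := 'rV[R]_n.
Local Notation csm := (csmooth_on [set: aff]).
Implicit Types (x y : aff) (f g : aff -> R[i]) (m j : nat).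

(** The Taylor polynomial of [f] at [x] of degree below [m] is zero. *)
Fixpoint flat m x f : Prop :=
  if m is m'.+1 then f x = 0 /\ forall i, flat m' x (pderive i f) else True.

Lemma csmooth_pderive i f : csm f -> csm (pderive i f).
Proof. exact: csmooth_on_derive. Qed.

Lemma flatW m x f : flat m.+1 x f -> flat m x f.
Proof.
elim: m f => [//|m IHm] f [f0 df]; split => // i; exact: IHm (df i).
Qed.

Lemma flatD m x f g : csm f -> csm g -> flat m x f -> flat m x g ->
  flat m x (fun y => f y + g y).
Proof.
elim: m f g => [//|m IHm] f g sf sg [f0 df] [g0 dg]; split.
  by rewrite f0 g0 addr0.
move=> i; have -> : pderive i (fun y => f y + g y) = fun y => pderive i f y + pderive i g y.
  by apply/funext => y; rewrite /pderive (cderiveD _ sf sg (I : setT y)).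
by apply: IHm; solve [exact: csmooth_pderive|exact: df|exact: dg].
Qed.

(** Leibniz' rule, by induction on the sum of the two orders: a derivative lowers one
    of them. *)
Lemma flatM a b x f g : csm f -> csm g -> flat a x f -> flat b x g ->
  flat (a + b) x (fun y => f y * g y).
Proof.
move: {2}(a + b)%N (erefl (a + b)%N) => N.
elim: N a b f g => [|N IHN] a b f g abN sf sg fa gb; first by rewrite abN.
rewrite abN; split.
  case: a abN fa => [|a] abN fa; last by case: fa => -> _; rewrite mul0r.
  by case: b abN gb => [//|b] abN [-> _]; rewrite mulr0.
move=> i; have sdf := csmooth_pderive i sf; have sdg := csmooth_pderive i sg.
have -> : pderive i (fun y => f y * g y) =
    fun y => pderive i f y * g y + f y * pderive i g y.
  by apply/funext => y; rewrite /pderive (cderiveM _ sf sg (I : setT y)).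
apply: flatD; [exact: csmooth_onM openT _ _|exact: csmooth_onM openT _ _| |].
- case: a abN fa => [|a] abN fa.
    case: b abN gb => [//|b]; rewrite add0n => -[bN] gb.
    by rewrite -[N]bN -[b]add0n; apply: (IHN 0%N b) => //; exact: flatW.
  move: abN; rewrite addSn => -[abN]; rewrite -abN.
  by apply: (IHN a b) => //; case: fa => _; exact.
- case: b abN gb => [|b] abN gb.
    case: a abN fa => [//|a]; rewrite addSn => -[abN] fa.
    by rewrite -abN; apply: (IHN a 0%N) => //; exact: flatW.
  move: abN; rewrite addnS => -[abN]; rewrite -abN.
  by apply: (IHN a b) => //; case: gb => _; exact.
Qed.

Lemma flat_pderives m (s : seq 'I_n) x f : flat m x f -> flat (m - size s) x (pderives s f).
Proof.
move=> fm; elim: s => [|i s IHs] /=; first by rewrite subn0.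
rewrite subnS; case: (m - size s)%N IHs => [//|k] [_]; exact.
Qed.

Lemma flat_eq0 m (s : seq 'I_n) x f : flat m x f -> (size s < m)%N -> pderives s f x = 0.
Proof. by move=> /(flat_pderives s); rewrite -subn_gt0; case: (m - _)%N => // k []. Qed.

Lemma flat_laplace m x f : csm f -> flat m.+2 x f -> flat m x (laplace f).
Proof.
move=> sf fm; rewrite /laplace.
suff : forall r : seq 'I_n, flat m x (fun y => \sum_(i <- r) pderive i (pderive i f) y) by exact.
have s2 i : csm (pderive i (pderive i f)) by do 2 apply: csmooth_pderive.
have f2 i : flat m x (pderive i (pderive i f)).
  by case: fm => _ /(_ i) [_]; exact.
elim=> [|i r IHr].
  have -> : (fun y : aff => \sum_(i <- [::]) pderive i (pderive i f) y) = fun=> 0.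
    by apply/funext => y; rewrite big_nil.
  elim: m {fm f2} => [//|m IHm]; split => // i.
  by have -> : pderive i (fun _ : aff => 0) = fun=> 0 by apply/funext => y; exact: cderive_cst.
have -> : (fun y => \sum_(l <- i :: r) pderive l (pderive l f) y) =
    fun y => pderive i (pderive i f) y + \sum_(l <- r) pderive l (pderive l f) y.
  by apply/funext => y; rewrite big_cons.
by apply: flatD => //; apply: csmooth_on_sum => //; exact: openT.
Qed.

Lemma flat_iter_laplace j x f : csm f -> flat (2 * j).+1 x f -> iter j (@laplace R n) f x = 0.
Proof.
elim: j f => [|j IHj] f sf; first by case.
rewrite mulnS => fj; rewrite iterSr; apply: IHj; first exact: csmooth_affine_laplace.
exact: flat_laplace.
Qed.

Lemma laplaceD f g x : csm f -> csm g -> laplace (fun y => f y + g y) x = laplace f x + laplace g x.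
Proof.
move=> sf sg; rewrite /laplace -big_split /=; apply: eq_bigr => i _.
rewrite /pderive -(cderiveD _ (csmooth_pderive i sf) (csmooth_pderive i sg) (I : setT x)).
by congr (cderive _ _ x); apply/funext => y; exact: (cderiveD _ sf sg (I : setT y)).
Qed.

Lemma laplaceZ (c : R[i]) f x : csm f -> laplace (fun y => c * f y) x = c * laplace f x.
Proof.
move=> sf; rewrite /laplace mulr_sumr; apply: eq_bigr => i _.
rewrite /pderive -(cderiveZ _ _ openT (csmooth_pderive i sf) (I : setT x)).
by congr (cderive _ _ x); apply/funext => y; exact: (cderiveZ _ _ openT sf (I : setT y)).
Qed.

Lemma iter_laplace_linear j (c : R[i]) f g x : csm f -> csm g ->
  iter j (@laplace R n) (fun y => f y + c * g y) x =
  iter j (@laplace R n) f x + c * iter j (@laplace R n) g x.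
Proof.
elim: j f g => [//|j IHj] f g sf sg; rewrite !iterSr -IHj; try exact: csmooth_affine_laplace.
congr (iter j _ _ x); apply/funext => y.
have scg : csm (fun y => c * g y).
  by apply: csmooth_onM => //; [exact: openT|exact: csmooth_on_cst openT].
by rewrite (laplaceD _ sf scg) laplaceZ.
Qed.

Variable x : aff.

Definition dist_sq (y : aff) : R[i] := \sum_i ((y 0 i - x 0 i) * (y 0 i - x 0 i))%:C.

Let dx i (y : aff) : R[i] := (y 0 i - x 0 i)%:C.

Let csmooth_dx i : csm (dx i).
Proof.
apply: csmooth_on_real; first exact: openT.
apply: smooth_onB; [exact: openT|exact: smooth_on_coord openT|exact: smooth_on_cst openT].
Qed.

Let dist_sqE : dist_sq = fun y => \sum_i dx i y * dx i y.
Proof. by apply/funext => y; apply: eq_bigr => i _; rewrite rmorphM. Qed.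

Lemma csmooth_dist_sq : csm dist_sq.
Proof.
rewrite dist_sqE; apply: csmooth_on_sum => [|i]; first exact: openT.
by apply: csmooth_onM => //; exact: openT.
Qed.

Lemma csmooth_dist_sqX j : csm (fun y => dist_sq y ^+ j).
Proof. by apply: csmooth_onX; [exact: openT|exact: csmooth_dist_sq]. Qed.

Let pderive_dx i l y : pderive i (dx l) y = (l == i)%:R.
Proof.
rewrite /pderive cderive_real.
have D := is_deriveB (is_derive_coord y (delta_mx 0 i) l) (is_derive_cst (x 0 l) y (delta_mx 0 i)).
have -> : 'D_(delta_mx 0 i) (fun y => y 0 l - x 0 l) y = (delta_mx 0 i : aff) 0 l - 0.
  by have [_ <-] := D.
by rewrite subr0 mxE eqxx /= rmorph_nat.
Qed.

Lemma flat_dist_sq : flat 2 x dist_sq.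
Proof.
have f1 i : flat 1 x (dx i) by split => //; rewrite /dx subrr.
rewrite dist_sqE; elim: (index_enum _) => [|i r IHr].
  have -> : (fun y : aff => \sum_(i <- [::]) dx i y * dx i y) = fun=> 0.
    by apply/funext => y; rewrite big_nil.
  by split => // i; split => //; exact: cderive_cst.
have -> : (fun y => \sum_(l <- i :: r) dx l y * dx l y) =
    fun y => dx i y * dx i y + \sum_(l <- r) dx l y * dx l y.
  by apply/funext => y; rewrite big_cons.
apply: flatD => //; first exact: csmooth_onM openT _ _.
  by apply: csmooth_on_sum => [|l]; [exact: openT|exact: csmooth_onM openT _ _].
exact: (@flatM 1 1).
Qed.

Lemma flat_dist_sqX j : flat (2 * j) x (fun y => dist_sq y ^+ j).
Proof.
elim: j => [//|j IHj].
have -> : (fun y => dist_sq y ^+ j.+1) = fun y => dist_sq y * dist_sq y ^+ j.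
  by apply/funext => y; rewrite exprS.
rewrite mulnS; apply: (@flatM 2) => //; [exact: csmooth_dist_sq|exact: csmooth_dist_sqX|].
exact: flat_dist_sq.
Qed.

Let pderive_dist_sq i y : pderive i dist_sq y = 2 * dx i y.
Proof.
rewrite dist_sqE /pderive (cderive_sum _ _ openT _ (I : setT y)); last first.
  by move=> l; exact: csmooth_onM openT _ _.
rewrite (bigD1 i) //= big1 ?addr0.
  rewrite (cderiveM _ (csmooth_dx i) (csmooth_dx i) (I : setT y)).
  by rewrite -/(pderive i (dx i) y) pderive_dx eqxx /=; ring.
move=> l /negbTE li; rewrite (cderiveM _ (csmooth_dx l) (csmooth_dx l) (I : setT y)).
by rewrite -/(pderive i (dx l) y) pderive_dx li mul0r mulr0 addr0.
Qed.

Let pderive_dist_sqX i j y :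
  pderive i (fun y => dist_sq y ^+ j.+1) y = 2 * j.+1%:R * dx i y * dist_sq y ^+ j.
Proof.
elim: j y => [|j IHj] y.
  have -> : (fun y => dist_sq y ^+ 1) = dist_sq by [].
  by rewrite pderive_dist_sq expr0 !mulr1.
have -> : (fun y => dist_sq y ^+ j.+2) = fun y => dist_sq y * dist_sq y ^+ j.+1.
  by apply/funext => z; rewrite exprS.
rewrite /pderive (cderiveM _ csmooth_dist_sq (csmooth_dist_sqX j.+1) (I : setT y)).
rewrite -/(pderive i dist_sq y) -/(pderive i (fun y => dist_sq y ^+ j.+1) y) IHj.
by rewrite pderive_dist_sq !exprS -[j.+2%:R]natr1; ring.
Qed.

Lemma laplace_dist_sqX j y : laplace (fun y => dist_sq y ^+ j.+1) y =
  2 * j.+1%:R * (n + 2 * j)%N%:R * dist_sq y ^+ j.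
Proof.
have step i : pderive i (pderive i (fun y => dist_sq y ^+ j.+1)) y =
    2 * j.+1%:R * (dist_sq y ^+ j + dx i y * pderive i (fun y => dist_sq y ^+ j) y).
  have -> : pderive i (fun y => dist_sq y ^+ j.+1) =
      fun z => (2 * j.+1%:R) * (dx i z * dist_sq z ^+ j).
    by apply/funext => z; rewrite pderive_dist_sqX mulrA.
  have s1 : csm (fun z => dx i z * dist_sq z ^+ j).
    by apply: csmooth_onM => //; [exact: openT|exact: csmooth_dist_sqX].
  rewrite /pderive (cderiveZ _ _ openT s1 (I : setT y)).
  rewrite (cderiveM _ (csmooth_dx i) (csmooth_dist_sqX j) (I : setT y)).
  by rewrite -/(pderive i (dx i) y) pderive_dx eqxx mul1r.
rewrite /laplace (eq_bigr _ (fun i _ => step i)) -mulr_sumr big_split /= sumr_const card_ord.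
rewrite -[RHS]mulrA; congr (_ * _).
case: j step => [|j] step.
  rewrite big1 ?addr0 ?muln0 ?addn0 ?expr0 ?mulr1 // => i _.
  by rewrite /pderive (_ : (fun y => dist_sq y ^+ 0) = fun=> 1) // cderive_cst mulr0.
have -> : \sum_i dx i y * pderive i (fun y => dist_sq y ^+ j.+1) y =
    2 * j.+1%:R * dist_sq y ^+ j.+1.
  transitivity (2 * j.+1%:R * dist_sq y ^+ j * \sum_i dx i y * dx i y).
    by rewrite mulr_sumr; apply: eq_bigr => i _; rewrite pderive_dist_sqX; ring.
  have -> : \sum_i dx i y * dx i y = dist_sq y by rewrite dist_sqE.
  by rewrite exprS; ring.
by rewrite -[_ *+ n]mulr_natl natrD natrM; ring.
Qed.

Lemma iter_laplace_dist_sqX j : (0 < n)%N ->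
  iter j (@laplace R n) (fun y => dist_sq y ^+ j) x != 0.
Proof.
move=> n0; elim: j => [|j IHj]; first by rewrite /= expr0 oner_neq0.
rewrite iterSr.
have -> : laplace (fun y => dist_sq y ^+ j.+1) =
    fun y => 0 + (2 * j.+1%:R * (n + 2 * j)%N%:R) * dist_sq y ^+ j.
  by apply/funext => y; rewrite laplace_dist_sqX add0r.
rewrite (iter_laplace_linear _ _ _ (csmooth_on_cst 0 openT) (csmooth_dist_sqX j)).
rewrite [iter j _ (fun=> 0) x](_ : _ = 0) ?add0r; last first.
  apply: flat_iter_laplace; first exact: csmooth_on_cst openT.
  elim: (2 * j).+1 => [//|m IHm]; split => // i.
  by have -> : pderive i (fun _ : aff => 0) = fun=> 0 by apply/funext => y; exact: cderive_cst.
rewrite mulf_neq0 // !mulf_neq0 ?pnatr_eq0 //.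
by rewrite -lt0n addn_gt0 n0.
Qed.

(** Only the value of [h] at [x] matters, as [|y - x|^(2 j) (h y - h x)] vanishes to
    order [2 j + 1]; and the [j]-th Laplacian of [|y - x|^(2 j)] is a nonzero constant. *)
Lemma iter_laplace_dist_sqM j h : (0 < n)%N -> csm h -> h x != 0 ->
  iter j (@laplace R n) (fun y => dist_sq y ^+ j * h y) x != 0.
Proof.
move=> n0 sh hx.
have shx : csm (fun y => h y - h x).
  by apply: csmooth_onB => //; [exact: openT|exact: csmooth_on_cst openT].
have sp := csmooth_dist_sqX j.
have s1 : csm (fun y => dist_sq y ^+ j * (h y - h x)).
  by apply: csmooth_onM => //; exact: openT.
have -> : (fun y => dist_sq y ^+ j * h y) =
    fun y => dist_sq y ^+ j * (h y - h x) + h x * dist_sq y ^+ j.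
  by apply/funext => y; ring.
rewrite (iter_laplace_linear _ _ _ s1 sp) flat_iter_laplace //.
  by rewrite add0r mulf_neq0 // iter_laplace_dist_sqX.
rewrite -addn1; apply: flatM => //; first exact: flat_dist_sqX.
by split => //; rewrite subrr.
Qed.

End Flatness.

(** * Points off the mirrors *)

Section RegularPoint.
Variables (R : realType) (n : nat).
Local Notation amb := 'rV[R]_(n.+2).
Implicit Types (a X Y Z : amb).

Lemma poly_nonroot (p : {poly R}) : p != 0 -> exists s : R, p.[s] != 0.
Proof.
move=> p0; pose rs := [seq (i%:R : R) | i <- iota 0 (size p)].
have urs : uniq rs.
  by rewrite map_inj_uniq ?iota_uniq // => i l /eqP; rewrite eqr_nat => /eqP.
have [/(max_poly_roots p0)/(_ urs)|/allPn[s _ ps]] := boolP (all (root p) rs).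
  by rewrite size_map size_iota ltnn.
by exists s.
Qed.

Definition moment_curve (s : R) : 'rV[R]_n := \row_i s ^+ i.+1.

(** The restriction of [<a, .>] to the moment curve in the chart. *)
Definition mirror_poly a : {poly R} :=
  (a 0 ord_max)%:P + \sum_(i < n) a 0 (mid i) *: 'X^(i.+1)
   - (a 0 ord0 / 2) *: \sum_(i < n) 'X^(2 * i.+1).

Lemma mirror_polyE a s : (mirror_poly a).[s] = form a (chart (moment_curve s)).
Proof.
rewrite form_chart /mirror_poly !hornerE !horner_sum.
have -> : \sum_(i < n) ('X^(2 * i.+1) : {poly R}).[s] =
    \sum_(i < n) moment_curve s 0 i ^+ 2.
  by apply: eq_bigr => i _; rewrite hornerXn mxE -exprM mulnC.
have -> : \sum_(i < n) (a 0 (mid i) *: 'X^(i.+1) : {poly R}).[s] =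
    \sum_(i < n) a 0 (mid i) * moment_curve s 0 i.
  by apply: eq_bigr => i _; rewrite !hornerE mxE.
by congr (_ - _); exact: mulrAC.
Qed.

(** The quadratic part has degree [2 n > n], which isolates the coordinate [a^0]; when
    that is zero, the other coordinates are the coefficients of the polynomial. *)
Lemma mirror_poly_neq0 a : (0 < n)%N -> a != 0 -> mirror_poly a != 0.
Proof.
move=> n0; apply: contraNneq => a0.
have coefE l : (mirror_poly a)`_l = a 0 ord_max * (l == 0)%N%:R +
   \sum_(i < n) a 0 (mid i) * (l == i.+1)%N%:R -
   a 0 ord0 / 2 * \sum_(i < n) (l == (2 * i.+1)%N)%:R.
  rewrite /mirror_poly coefB coefD coefC coefZ !coef_sum.
  congr (_ + _ - _ * _).
  - by case: (l == 0)%N; rewrite ?mulr1 ?mulr0.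
  - by apply: eq_bigr => i _; rewrite coefZ coefXn.
  - by apply: eq_bigr => i _; rewrite coefXn.
have n1 : (n.-1 < n)%N by rewrite prednK.
(* The only summand of degree [2 n] comes from the last coordinate of the curve. *)
have c0 : a 0 ord0 = 0.
  have := coefE (2 * n)%N; rewrite a0 coef0 big1 => [|i _]; last first.
    by rewrite (_ : _ == _ = false) ?mulr0 //; apply/negbTE; have := ltn_ord i; lia.
  rewrite (bigD1 (Ordinal n1)) //= big1 => [|i iN]; last first.
    rewrite (_ : _ == _ = false) //; apply/negbTE; move: iN.
    by rewrite -val_eqE /=; have := ltn_ord i; lia.
  rewrite prednK // eqxx muln_eq0 (gtn_eqF n0) /= mulr0 !addr0 add0r mulr1.
  by move=> /esym/eqP; rewrite oppr_eq0 mulf_eq0 invr_eq0 pnatr_eq0 orbF => /eqP.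
move: coefE; rewrite a0 c0 => coefE.
apply/eqP/rowP => b; rewrite [RHS]mxE; have [->|->|[i ->]] := amb_cases b => //.
  have := coefE 0%N; rewrite coef0 big1 => [|i _]; last by rewrite mulr0.
  by rewrite eqxx mul0r mul0r subr0 addr0 mulr1.
have := coefE i.+1; rewrite coef0 (bigD1 i) //= big1 => [|l li]; last first.
  by rewrite eqSS val_eqE eq_sym (negbTE li) mulr0.
by rewrite eqxx mulr0 mul0r mul0r subr0 addr0 add0r mulr1.
Qed.

(** The mirrors cut a moment curve of the chart in finitely many points. *)
Lemma exists_regular (Phi : {fset amb}) : (0 < n)%N -> root_system Phi ->
  exists x, regular Phi x.
Proof.
move=> n0 [Phi0 _ _].
have [|s ps] := @poly_nonroot (\prod_(a <- enum_fset Phi) mirror_poly a).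
  rewrite prodf_seq_neq0; apply/allP => a aPhi; apply: mirror_poly_neq0 => //.
  by apply: contraNneq (Phi0 a aPhi) => ->; rewrite /form !mxE !mul0r !add0r big1 // => i _; rewrite !mxE mul0r.
exists (moment_curve s) => a aPhi; rewrite -mirror_polyE.
move: ps; rewrite horner_prod prodf_seq_neq0 => /allP; exact.
Qed.

End RegularPoint.

(** * A lower bound for the order *)

Section LowerBound.
Variables (R : realType) (n : nat).
Local Notation amb := 'rV[R]_(n.+2).
Local Notation aff := 'rV[R]_n.
Variables (Phi : {fset amb}) (w : R[i]).
Hypotheses (rootsPhi : root_system Phi) (euclPhi : euclidean_roots Phi).
Implicit Types (X Y Z : amb) (x y : aff) (j : nat).

(** The difference [X - Z] is null and of time zero, and the form is definite on the
    vectors of time zero. *)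
Lemma cone_form_eq0 X Z : cone X -> cone Z -> time X = time Z -> form Z X = 0 -> X = Z.
Proof.
move=> [X0 _] [Z0 _] tXZ ZX; apply/eqP; rewrite -subr_eq0; apply/eqP.
set D := X - Z; have tD : time D = 0.
  by move: tXZ; rewrite /D /time !mxE; lra.
have QD : form D D = 0.
  by rewrite /D !(form_subl, form_subr) X0 Z0 (form_sym X Z) ZX !subr0.
have := space_sqE D; rewrite /space_sq QD tD expr0n /= mulr0 addr0 => /esym/eqP.
rewrite paddr_eq0 ?sqr_ge0 ?mulr_ge0 ?sumr_ge0 //; last by move=> i _; exact: sqr_ge0.
rewrite sqrf_eq0 mulf_eq0 pnatr_eq0 /= => /andP[/eqP s0].
rewrite psumr_eq0; last by move=> i _; exact: sqr_ge0.
move=> /allP m0; have h0 : D 0 ord0 = 0 by move: tD s0; rewrite /time; lra.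
apply/rowP => b; rewrite [RHS]mxE; have [->|->|[i ->]] := amb_cases b => //.
  by move: tD; rewrite /time h0 sub0r => /eqP; rewrite oppr_eq0 => /eqP.
by have := m0 i (mem_index_enum i); rewrite sqrf_eq0 => /eqP.
Qed.

(** Homogeneous of degree zero in [Y] and, in the chart, the squared distance to [Z] up
    to a nonvanishing factor ([ratio_isometry]). *)
Definition ratio Z Y : R[i] := (form Z Y / time Y)%:C.

Lemma csmooth_on_ratio Z : csmooth_on [set Y : amb | 0 < time Y] (ratio Z).
Proof.
have ot : open [set Y : amb | 0 < time Y].
  exact: open_pos (smoothT_continuous (smooth_on_time openT)).
apply: csmooth_on_real => //; apply: smooth_onM => //; first exact: smooth_on_form.
by apply: smooth_onV => //; [exact: smooth_on_time|move=> Y /lt0r_neq0].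
Qed.

Lemma csmooth_on_prod (V : normedModType R) (U : set V) (I : Type) (r : seq I)
    (F : I -> V -> R[i]) : open U -> (forall i, csmooth_on U (F i)) ->
  csmooth_on U (fun v => \prod_(i <- r) F i v).
Proof.
move=> oU sF; elim: r => [|i r IHr].
  by apply: csmooth_on_eq (csmooth_on_cst 1 oU) => // v _; rewrite big_nil.
apply: (csmooth_on_eq (F := fun v => F i v * \prod_(l <- r) F l v)) => //.
  by move=> v _; rewrite big_cons.
exact: csmooth_onM.
Qed.

(** A density that vanishes to order [2 j] at every point of a finite list. *)
Definition vanishing_density j (r : seq amb) Y : R[i] :=
  (\prod_(Z <- r) ratio Z Y ^+ j) * cpow (time Y) w.

Lemma csmooth_vanishing_density j r :
  csmooth_on [set Y : amb | 0 < time Y] (vanishing_density j r).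
Proof.
have ot : open [set Y : amb | 0 < time Y].
  exact: open_pos (smoothT_continuous (smooth_on_time openT)).
apply: csmooth_onM => //; last by apply: csmooth_on_cpow => //; exact: smooth_on_time.
by apply: csmooth_on_prod => // Z; apply: csmooth_onX => //; exact: csmooth_on_ratio.
Qed.

Lemma density_vanishing j r : density w (vanishing_density j r).
Proof.
split=> [X cX|l X l0 cX].
  exists [set Y : amb | 0 < time Y], (vanishing_density j r); split => //.
  - exact: open_pos (smoothT_continuous (smooth_on_time openT)).
  - by case: cX => _; rewrite /= /time subr_gt0.
  - exact: csmooth_vanishing_density.
have tX : 0 < time X by case: cX => _; rewrite /time subr_gt0.
rewrite /vanishing_density timeZ cpowMl // mulrCA; congr (_ * _).
congr (_ * _); apply: eq_bigr => Z _; congr (_ ^+ _).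
rewrite /ratio form_scaler timeZ; congr (_%:C).
by field; rewrite !gt_eqF.
Qed.

Lemma time_chart_gt0 x : 0 < time (chart x : amb).
Proof. by have [_] := @cone_chart R n x; rewrite /time subr_gt0. Qed.

Lemma ratio_isometry g x y : space_isometry g ->
  ratio (g (chart x)) (g (chart y)) = - (2 * time (chart y : amb))^-1%:C * dist_sq x y.
Proof.
move=> ig; case: (ig) => _ fg _; rewrite /ratio fg isometry_time // form_chart_chart.
have -> : dist_sq x y = (\sum_i (y 0 i - x 0 i) ^+ 2)%:C.
  by rewrite /dist_sq rmorph_sum; apply: eq_bigr => i _; rewrite expr2.
rewrite -rmorphN -rmorphM /=; congr (_%:C).
by field; rewrite gt_eqF ?time_chart_gt0.
Qed.

Lemma csmooth_time_inv : csmooth_on [set: aff]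
  (fun y => - (2 * time (chart y : amb))^-1%:C).
Proof.
have st : smooth_on [set: aff] (@time R n \o @chart R n).
  by apply: (smooth_on_comp openT openT (smooth_on_time openT)) => //; exact: smooth_map_chart.
apply: csmooth_onN; first exact: openT.
apply: csmooth_on_real; first exact: openT.
apply: smooth_onV; first exact: openT.
  by apply: smooth_onM => //; [exact: openT|exact: smooth_on_cst openT].
by move=> y _; rewrite mulf_neq0 ?pnatr_eq0 // gt_eqF ?time_chart_gt0.
Qed.

Lemma csmooth_chart_time (F : amb -> R[i]) : csmooth_on [set Y : amb | 0 < time Y] F ->
  csmooth_on [set: aff] (F \o @chart R n).
Proof.
move=> sF; apply: (csmooth_on_comp openT _ sF).
- exact: open_pos (smoothT_continuous (smooth_on_time openT)).
- exact: smooth_map_chart.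
- by move=> y _; exact: time_chart_gt0.
Qed.

(** If [g X] occurs in the list then, read in the chart through [g], the density
    has the factor [|y - x|^(2 j)]; when it occurs once, the cofactor does not
    vanish at [x]. *)
Lemma vanishing_density_chart j r g x : space_isometry g ->
  g (chart x) \in r -> exists h : aff -> R[i], [/\ csmooth_on [set: aff] h,
    (vanishing_density j r \o g \o @chart R n) = (fun y => dist_sq x y ^+ j * h y) &
    uniq r -> (forall Z, Z \in r -> cone Z /\ time Z = time (chart x : amb)) -> h x != 0].
Proof.
move=> ig gr; set X := g (chart x).
pose h0 (y : aff) : R[i] := (- (2 * time (chart y : amb))^-1%:C) ^+ j.
pose h1 Y : R[i] := (\prod_(Z <- rem X r) ratio Z Y ^+ j) * cpow (time Y) w.
have sh1 : csmooth_on [set Y : amb | 0 < time Y] h1.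
  exact: (csmooth_vanishing_density j (rem X r)).
have ot : open [set Y : amb | 0 < time Y].
  exact: open_pos (smoothT_continuous (smooth_on_time openT)).
have sh1g : csmooth_on [set Y : amb | 0 < time Y] (h1 \o g).
  apply: (csmooth_on_comp ot ot sh1); first exact: (smooth_map_isometry ig).
  by move=> Y; rewrite /= isometry_time.
(* [h0] comes from the factor of [X] itself, [h1] from the other points. *)
exists (fun y => h0 y * (h1 \o g \o @chart R n) y); split.
- apply: csmooth_onM; first exact: openT.
    by apply: csmooth_onX; [exact: openT|exact: csmooth_time_inv].
  exact: csmooth_chart_time.
- apply/funext => y; rewrite /vanishing_density /= (perm_big _ (perm_to_rem gr)) big_cons /=.
  by rewrite (ratio_isometry x y ig) exprMn /h0 /h1; ring.
move=> ur rP; rewrite mulf_neq0 //.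
  by rewrite expf_neq0 // oppr_eq0 fmorph_eq0 invr_eq0 mulf_neq0 ?pnatr_eq0 // gt_eqF ?time_chart_gt0.
rewrite /h1 /= mulf_neq0 //; last by rewrite cpow_neq0 // (isometry_time ig) time_chart_gt0.
rewrite big_seq prodf_seq_neq0; apply/allP => Z _; apply/implyP => Zr.
have ZX : Z != X by move: Zr; rewrite mem_rem_uniq // inE => /andP[].
have {Zr} : Z \in r by move: Zr; rewrite mem_rem_uniq // inE => /andP[].
move=> /rP[cZ tZ]; rewrite expf_neq0 // fmorph_eq0.
rewrite mulf_eq0 invr_eq0 (isometry_time ig) (gt_eqF (time_chart_gt0 x)) orbF.
apply: contra ZX => /eqP ZX0; apply/eqP/esym; apply: (cone_form_eq0 _ cZ) => //.
- exact: isometry_cone ig _ (cone_chart x).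
- by rewrite isometry_time.
Qed.

(** A sum of terms of order below [2 j], reflected by finitely many [g], annihilates at
    [x] every density that vanishes to order [2 j] at the points [g (chart x)]. These
    points are listed without repetition, so that [chart x] is a zero of order exactly
    [2 j] and the [j]-th power of the Laplacian is nonzero there. *)
Lemma laplace_not_lt j : (0 < n)%N -> (exists x, regular Phi x) ->
  ~ diffdiff_lt Phi w (2 * j) (fun f x => iter j (@laplace R n) (f \o @chart R n) x).
Proof.
move=> n0 [x rx] [N [gs [ss [cs [gsP ssm _ E]]]]].
have ig t : space_isometry (gs t) := refl_group_isometry rootsPhi euclPhi (gsP t).
pose r := undup (chart x :: [seq gs t (chart x) | t <- enum 'I_N]).
pose f := vanishing_density j r.
have df : density w f := density_vanishing j r.
have rP Z : Z \in r -> cone Z /\ time Z = time (chart x : amb).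
  rewrite mem_undup inE => /orP[/eqP ->|/mapP[t _ ->]]; first by split => //; exact: cone_chart.
  by split; [exact: isometry_cone (ig t) _ (cone_chart x)|exact: isometry_time].
have xr : idfun (chart x : amb) \in r by rewrite mem_undup mem_head.
have [h [sh fh hx]] := vanishing_density_chart j (space_isometry_id _ _) xr.
have := iter_laplace_dist_sqM j n0 sh (hx (undup_uniq _) rP).
rewrite -fh -/f => /eqP; apply.
rewrite (E f x df rx) big1 // => t _.
have tr : gs t (chart x) \in r by rewrite mem_undup inE map_f ?orbT // mem_enum.
have [h' [sh' fh' _]] := vanishing_density_chart j (ig t) tr.
rewrite /f fh' (flat_eq0 (m := 2 * j) (x := x)) ?mulr0 //.
rewrite -[(2 * j)%N]addn0; apply: flatM => //; first exact: csmooth_dist_sqX.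
exact: flat_dist_sqX.
Qed.

End LowerBound.

(** * The operator on densities *)

Section RestrictedOperator.
Variables (R : realType) (n : nat).
Local Notation amb := 'rV[R]_(n.+2).
Variables (Phi Pos : {fset amb}) (k : amb -> R[i]) (j : nat) (w : R[i]).
Hypotheses (rootsPhi : root_system Phi) (euclPhi : euclidean_roots Phi)
  (posPhi : positive_roots Phi Pos) (multk : multiplicity Phi k).
Implicit Types (f : amb -> R[i]) (g : amb -> amb) (X Y : amb).
Local Notation Lap := (dunkl_laplace Pos k).

(** The extension is the one that is constant along the time axis; it is defined on a
    set invariant under the reflections. *)
Definition restricted_laplace f : amb -> R[i] := iter j Lap (f \o @cone_proj R n).

Lemma density_restricted_laplace f : density w f ->
  density (w - (2 * j)%:R) (restricted_laplace f).
Proof.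
move=> df; have [U [oU cU sF Ff hF]] := extension_cone_proj df.
split=> [X cX|l X l0 cX].
  exists (@spacelike_nonzero R n), (restricted_laplace f); split => //.
  - exact: open_spacelike.
  - exact: cone_spacelike.
  - exact: (csmooth_spacelike_iter k rootsPhi euclPhi posPhi j (csmooth_cone_proj df)).
have nd := pos_nondegenerate rootsPhi posPhi.
have ce := cone_iter_core nd (pos_euclidean euclPhi posPhi) j cU.
have hD := iter_laplace_homogeneous k nd (m := j) oU sF hF.
exact: hD l0 (ce _ cX) (ce _ (coneZ l0 cX)).
Qed.

Lemma restricted_laplace_group g f X : refl_group Phi g -> density w f -> cone X ->
  restricted_laplace (f \o g) X = restricted_laplace f (g X).
Proof.
move=> gP df cX; have ig := refl_group_isometry rootsPhi euclPhi gP.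
rewrite /restricted_laplace -(iter_laplace_group rootsPhi euclPhi posPhi multk) //.
- congr (iter j Lap _ X); apply/funext => Y /=; congr f; exact/esym/(isometry_cone_proj ig).
- exact: csmooth_cone_proj df.
- exact: cone_spacelike.
Qed.

(** The power of the Laplacian in the chart, which differs by terms of lower order,
    would otherwise itself have lower order. *)
Lemma restricted_laplace_not_lt : (0 < n)%N ->
  ~ diffdiff_lt Phi w (2 * j) (fun f x => restricted_laplace f (chart x)).
Proof.
move=> n0 ltD.
apply: (laplace_not_lt (w := w) rootsPhi euclPhi (j := j) n0 (exists_regular n0 rootsPhi)).
apply: lt_terms_diffdiff; have T := symbol_terms k w rootsPhi euclPhi posPhi j.
have sN : csmooth_on (regular Phi) (fun=> -1) := csmooth_on_cst (-1) (@open_regular R n Phi).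
apply: terms_eq (termsD (diffdiff_lt_terms ltD) (termsM (@open_regular R n Phi) sN T)) => f x df rx.
by rewrite mulN1r opprB addrCA subrr addr0.
Qed.

End RestrictedOperator.

Theorem theorem3p7 (R : realType) (n : nat) (n_gt0 : (0 < n)%N)
    (Phi Pos : {fset 'rV[R]_(n.+2)}) (k : 'rV[R]_(n.+2) -> R[i])
    (rootsPhi : root_system Phi) (euclPhi : euclidean_roots Phi)
    (posPhi : positive_roots Phi Pos) (multk : multiplicity Phi k)
    (j : nat) (w : R[i])
    (w_def : w = - (n%:R / 2%:R) + j%:R - gamma Pos k) :
  (forall f : 'rV[R]_(n.+2) -> R[i], density w f ->
     exists F, extension w f F) /\
  (forall f F1 F2 : 'rV[R]_(n.+2) -> R[i], density w f ->
     extension w f F1 -> extension w f F2 ->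
     forall X, cone X ->
       iter j (dunkl_laplace Pos k) F1 X = iter j (dunkl_laplace Pos k) F2 X) /\
  (exists D : ('rV[R]_(n.+2) -> R[i]) -> 'rV[R]_(n.+2) -> R[i],
     [/\ forall f F, density w f -> extension w f F ->
           forall X, cone X -> D f X = iter j (dunkl_laplace Pos k) F X,
         forall f, density w f -> density (w - (2 * j)%N%:R) (D f),
         exists f, density w f /\ exists X, cone X /\ D f X != 0,
         forall g f, refl_group Phi g -> density w f ->
           density w (f \o g) /\
           forall X, cone X -> D (f \o g) X = D f (g X) &
         diffdiff_order Phi w (2 * j)%N (fun f x => D f (chart x)) /\
         diffdiff_symbol Phi w (2 * j)%N (fun f x => D f (chart x))
           (fun h => iter j (@laplace R n) h)]).
Proof.
have nd := pos_nondegenerate rootsPhi posPhi.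
have eu := pos_euclidean euclPhi posPhi.
have indep f F1 F2 : extension w f F1 -> extension w f F2 -> forall X, cone X ->
    iter j (dunkl_laplace Pos k) F1 X = iter j (dunkl_laplace Pos k) F2 X.
  by move=> e1 e2 X; exact: iter_laplace_extension nd eu _ _ _ _ _ _ w_def e1 e2.
have notlt := restricted_laplace_not_lt (k := k) (j := j) (w := w) rootsPhi euclPhi posPhi n_gt0.
have symb := symbol_terms k w rootsPhi euclPhi posPhi j.
split; first by move=> f df; eexists; exact: extension_cone_proj df.
split; first by move=> f F1 F2 _; exact: indep.
exists (restricted_laplace Pos k j); split.
- by move=> f F df eF X; exact: indep (extension_cone_proj df) eF X.
- by move=> f df; exact: (density_restricted_laplace k j rootsPhi euclPhi posPhi df).
(* An operator that annihilates all densities would have order below [2 j]. *)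
- apply: contrapT => no; apply: notlt; apply: lt_terms_diffdiff; apply: terms_zero => f x df _.
  apply/eqP; apply: contrapT => /negP D0; apply: no.
  by exists f; split => //; exists (chart x); split => //; exact: cone_chart.
- move=> g f gP df; split; first exact: (density_isometry (refl_group_isometry rootsPhi euclPhi gP)).
  by move=> X cX; exact: (restricted_laplace_group j rootsPhi euclPhi posPhi multk gP df cX).
split; last exact: (lt_terms_diffdiff symb).
split; last exact: notlt.
apply: lt_terms_diffdiff.
have := termsD (terms_le (leqnSn _) symb) (laplace_terms w rootsPhi euclPhi j).
by apply: terms_eq => f x df rx; rewrite subrK.
Qed.
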